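(* Consider the online weighted multi-color discrepancy problem with vectors $v_1,\dots,v_T$ sampled i.i.d. from a distribution $\mathsf{p}$ on $\mathbb{R}^n$ supported on vectors of Euclidean norm at most $1$, with $R$ colors having weights $w_c\in[1,\eta]$. (1) For any such $\mathsf{p}$ and any set $\mathcal{S}\subseteq\mathbb{R}^n$ of $\mathrm{poly}(nT)$ test vectors of Euclidean norm at most $1$, there is an online algorithm that, with high probability, maintains $\mathsf{disc}_t(\|\cdot\|_* ) = O(\log^2(R\eta)\cdot\log^4(nT))$ for all $t\in[T]$, where $\|x\|_*=\max_{z\in\mathcal{S}}|\langle x,z\rangle|$. (2) If moreover $\mathsf{p}$ has sub-exponential tails, then for any symmetric convex body $K\subseteq\mathbb{R}^n$ with $\gamma_n(K)\ge 1/2$, there is an online algorithm that, with high probability, maintains $\mathsf{disc}_t(\|\cdot\|_K)=O(\log^2(R\eta)\cdot\log^5(nT))$ for all $t\in[T]$.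
   Context: In the online weighted multi-color discrepancy problem, upon arrival of $v_t$ the algorithm must irrevocably assign it a color $c\in[R]$, using only $v_1,\dots,v_t$, earlier choices, knowledge of $\mathsf{p}$, and possibly internal randomness. Let $d_c(t)$ be the sum of the vectors assigned color $c$ up to time $t$. For a norm $\|\cdot\|_*$, $\mathsf{disc}_t(\|\cdot\|_* )=\max_{c\ne c'}\big\|\frac{d_c(t)/w_c-d_{c'}(t)/w_{c'}}{1/w_c+1/w_{c'}}\big\|_*$. $\|x\|_K=\inf\{s>0: x\in sK\}$. $\gamma_n$ is the standard Gaussian measure on $\mathbb{R}^n$. A distribution has sub-exponential tails if there is a universal $c>0$ with $\mathbb{P}_{v\sim\mathsf{p}}[|\langle v,\theta\rangle-\mu_\theta|\ge\sigma_\theta r]\le e^{-cr}$ for all unit $\theta$ and $r>0$, where $\mu_\theta,\sigma_\theta$ are the mean and standard deviation of $\langle v,\theta\rangle$. ''With high probability'' refers to the randomness of inputs and algorithm. *)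

(* Defs.v *)
From HB Require Import structures.
From mathcomp Require Import all_boot all_order all_algebra finmap.
From mathcomp Require Import all_classical all_reals all_analysis.

Set Implicit Arguments.
Unset Strict Implicit.
Unset Printing Implicit Defensive.

Import Order.TTheory GRing.Theory Num.Theory.
Import numFieldNormedType.Exports.

Local Open Scope classical_set_scope.
Local Open Scope ring_scope.

(* Row vectors carry the product sigma-algebra, as tuples do in the library;
   over a realType it is the Borel sigma-algebra of R^n. *)
Definition measure_row_display : measure_display -> measure_display.
Proof. exact. Qed.

Section measurable_row.
Context {d} {T : measurableType d}.
Variable n : nat.

Let coords : 'I_n -> 'rV[T]_n -> T := fun i x => x ord0 i.

Let row_set0 : g_sigma_preimage coords set0.
Proof. exact: sigma_algebra0. Qed.

Let row_setC A : g_sigma_preimage coords A -> g_sigma_preimage coords (~` A).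
Proof. exact: sigma_algebraC. Qed.

Let row_bigcup (F : (set 'rV[T]_n)^nat) :
  (forall i, g_sigma_preimage coords (F i)) ->
  g_sigma_preimage coords (\bigcup_i (F i)).
Proof. exact: sigma_algebra_bigcup. Qed.

HB.instance Definition _ := @isMeasurable.Build (measure_row_display d)
  'rV[T]_n (g_sigma_preimage coords) row_set0 row_setC row_bigcup.

End measurable_row.

Lemma measurable_fun_row d d' (T1 : measurableType d) (T2 : measurableType d')
    n (f : T1 -> 'rV[T2]_n) :
  (forall i, measurable_fun [set: T1] (fun x => f x ord0 i)) ->
  measurable_fun [set: T1] f.
Proof.
move=> mf _ A; rewrite setTI; move: A.
apply: smallest_sub.
  split.
  - by rewrite preimage_set0; exact: measurable0.
  - by move=> A; rewrite setTD -preimage_setC; exact: measurableC.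
  - by move=> F mF; rewrite preimage_bigcup; exact: bigcup_measurable.
move=> A; rewrite -bigcup_seq/= => -[i _] [B mB <-]; rewrite setTI.
by rewrite -[X in measurable X]setTI; exact: (mf i).
Qed.

Lemma measurable_row_coord d (T : measurableType d) n (i : 'I_n) :
  measurable_fun [set: 'rV[T]_n] (fun x => x ord0 i).
Proof.
move=> _ B mB; apply: sub_sigma_algebra.
by rewrite -bigcup_seq/=; exists i; [exact: mem_index_enum|exists B].
Qed.

Section gaussian.
Variable R : realType.

(* normal_prob lives on measurableTypeR R, hence the type of x.1. *)
Definition row_cons n (x : measurableTypeR R * 'rV[R]_n) : 'rV[R]_n.+1 :=
  \row_i (if unlift ord0 i is Some j then x.2 ord0 j else x.1).

Lemma measurable_row_cons n : measurable_fun [set: _] (@row_cons n).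
Proof.
apply: measurable_fun_row => i.
case: (unliftP ord0 i) => [j|] ->.
- have -> : (fun x => row_cons x ord0 (lift ord0 j)) =
            (fun v : 'rV[R]_n => v ord0 j) \o snd.
    by apply/funext => x; rewrite /row_cons mxE liftK.
  by apply: measurableT_comp => //; exact: measurable_row_coord.
- have -> : (fun x => @row_cons n x ord0 ord0) = fst.
    by apply/funext => x; rewrite /row_cons mxE unlift_none.
  exact: measurable_fst.
Qed.

HB.instance Definition _ n :=
  isMeasurableFun.Build _ _ _ _ (@row_cons n) (@measurable_row_cons n).

(* Standard Gaussian measure on R^n: the law of n independent N(0, 1). *)
Fixpoint gaussian n : probability 'rV[R]_n R :=
  if n is m.+1 then
    distribution (normal_prob 0 1 \x gaussian m)%E (@row_cons m)
  else dirac (0 : 'rV[R]_0).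

End gaussian.

Section euclidean.
Variables (R : realType) (n : nat).
Implicit Types (x y z : 'rV[R]_n) (K : set 'rV[R]_n) (S : {fset 'rV[R]_n}).

Definition dot x y : R := \sum_(i < n) x ord0 i * y ord0 i.

(* The library norm on row vectors is the sup norm. *)
Definition enorm x : R := Num.sqrt (dot x x).

(* The default 0 is only reached when S is empty. *)
Definition test_norm S x : R := \big[Num.max/0]_(z <- S) `|dot x z|.

(* inf is 0 on the empty set; this does not occur for a K satisfying
   symmetric_convex_body, which is absorbing. *)
Definition body_norm K x : R :=
  inf [set s : R | 0 < s /\ exists2 y, K y & x = s *: y].

Definition symmetric_convex_body K : Prop :=
  [/\ convex_set K, compact K, (interior K !=set0) &
      forall x, K x -> K (- x)].

Implicit Type p : probability 'rV[R]_n R.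

Definition supported_in_unit_ball p : Prop :=
  p [set v | enorm v <= 1] = 1%E.

Definition mean p theta : R := fine ('E_p[fun v => dot v theta])%E.

Definition stddev p theta : R :=
  Num.sqrt (fine ('V_p[fun v => dot v theta])%E).

Definition subexponential_tails (c : R) p : Prop :=
  forall theta, enorm theta = 1 -> forall r : R, 0 < r ->
    (p [set v | stddev p theta * r <= `|dot v theta - mean p theta|]%R
       <= (expR (- (c * r)))%:E)%E.

End euclidean.

Section iid.
Context (R : realType) (n T : nat) (p : probability 'rV[R]_n R).
Context d (Omega : measurableType d) (P : probability Omega R).
Variable X : 'I_T -> {RV P >-> 'rV[R]_n}.

Definition mutually_independent : Prop :=
  forall (J : {set 'I_T}) (A : 'I_T -> set 'rV[R]_n),
    (forall i, measurable (A i)) ->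
    P (\bigcap_(i in [set` J]) (X i @^-1` A i)) =
    (\prod_(i in J) P (X i @^-1` A i))%E.

Definition iid_from : Prop :=
  mutually_independent /\
  forall i (A : set 'rV[R]_n), measurable A -> distribution P (X i) A = p A.

End iid.

Section online.
Variables (R : realType) (n q : nat).

(* At each step the color is a function of the vectors received so far
   (current one included), the colors already assigned and a random seed drawn
   beforehand, which carries all the internal randomness. The law of the input
   and the color weights are known: an algorithm may be chosen as a function
   of them. *)
Record online_algorithm := OnlineAlgorithm {
  seed_display : measure_display ;
  seed : measurableType seed_display ;
  seed_law : probability seed R ;
  choose : seq 'rV[R]_n -> seq 'I_q -> seed -> 'I_q ;
  measurable_choose : forall t (cs : seq 'I_q) (c : 'I_q),
    measurable [set x : t.-tuple 'rV[R]_n * seed | choose x.1 cs x.2 = c]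
}.

Variables (A : online_algorithm) (vs : seq 'rV[R]_n) (u : seed A).

Fixpoint colors (t : nat) : seq 'I_q :=
  if t is s.+1 then rcons (colors s) (choose (take s.+1 vs) (colors s) u)
  else [::].

Definition color_sum (t : nat) (c : 'I_q) : 'rV[R]_n :=
  \sum_(x <- zip (take t vs) (colors t) | x.2 == c) x.1.

(* With a single color there is no pair and disc is 0. *)
Definition disc (w : 'I_q -> R) (nrm : 'rV[R]_n -> R) (t : nat) : R :=
  \big[Num.max/0]_(x : 'I_q * 'I_q | x.1 != x.2)
    nrm (((w x.1)^-1 + (w x.2)^-1)^-1 *:
         ((w x.1)^-1 *: color_sum t x.1 - (w x.2)^-1 *: color_sum t x.2)).

End online.

(* The product measure makes the seed independent of the input. A bound holds
   with high probability if, for every b > 0, it is maintained with failure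
   (n T)^-b, where the implied constant of the bound may depend on b. *)
Definition maintains (R : realType) (n q T : nat) (p : probability 'rV[R]_n R)
    (w : 'I_q -> R) (nrm : 'rV[R]_n -> R) (A : online_algorithm R n q)
    (bound failure : R) : Prop :=
  forall d (Omega : measurableType d) (P : probability Omega R)
    (X : 'I_T -> {RV P >-> 'rV[R]_n}), iid_from p X ->
  ((1 - failure)%:E <=
   (P \x seed_law A)
     [set x | forall t, (0 < t <= T)%N ->
        disc [tuple X i x.1 | i < T] x.2 w nrm t <= bound]%R)%E.

(* Main.v *)
(* Each colour of weight [w] is cut into [floor w] chunks of weight between 1 and
   2, and the chunks, sorted by colour, become the leaves of a balanced binary
   tree of logarithmic depth. An arriving vector descends the tree: a node whose
   left subtree carries a fraction [p] of its weight sends the vector left with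
   probability [p] minus a small pull [kappa * <y, v>], where [y] is the sum of
   the vectors sent left minus [p] times the sum of all vectors seen (the
   self-balancing walk of Alweiss, Liu and Sawhney). One step of this walk is
   dominated, in the convex order, by a Gaussian step that leaves the
   distribution of [sigma * g] invariant, [g] being a standard Gaussian vector.
   Hence [E f(y) <= E f(sigma * g)] for every nonnegative convex [f], whatever
   the input sequence; with [f = exp (c * N ^ 2)] and Fernique's theorem, [N y]
   has Gaussian tails at scale [sigma] for every seminorm [N] whose unit ball has
   Gaussian measure at least 1/2. The seminorms [|<_, v_t>| / 2] show that the
   pull never exceeds what the bias of a coin can realize; the test norm (by a
   union bound over the tests) and the norm of the body give the discrepancy. *)
From HB Require Import structures.
Require Import Defs.
From mathcomp Require Import all_boot all_order all_algebra finmap.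
From mathcomp Require Import all_classical all_reals all_analysis.
From mathcomp Require Import measurable_realfun.
From mathcomp Require Import ring lra zify.

Set Implicit Arguments.
Unset Strict Implicit.
Unset Printing Implicit Defensive.

Import Order.TTheory GRing.Theory Num.Theory.
Import numFieldNormedType.Exports.

Local Open Scope classical_set_scope.
Local Open Scope ring_scope.

(** * Translations of Gaussian measures *)

(** Reflections preserve the law of a pair [(g, x)] of independent standard Gaussians, and the
    second component of a reflection reads [x], minus a multiple of [<x, a> a], plus a multiple of
    [g a]: a pull and a noise. The invariance of the Gaussian step is therefore exact, and the tails
    of the walk do not grow with time; time enters only through a union bound. The walk lives at
    scale [sigma] but is allowed the radius [sigma ^+ 2], which it leaves with probability
    exponentially small in [sigma ^+ 2]. So [sigma ^+ 2] of order [ln (q * eta) + ln (n * T)] pays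
    for all nodes, times and tests, and the discrepancy is this radius times the depth of the tree.
    The rate [kappa] is of order [1 / sigma ^+ 2], hence the same radius keeps the pull below 1/5;
    chunks of weight in [[1, 2]] keep split ratios in [[1/5, 4/5]], which leaves room for it.
    Sorting the chunks matters because a prefix of the list cuts at most one node per level, and a
    colour is a difference of two prefixes. The walk bound holds for every fixed input sequence, so
    it applies at each node once the seeds of its ancestors are fixed. *)

Section density.
Local Open Scope ereal_scope.
Context d (T : measurableType d) (R : realType).
Variables (mu nu : {measure set T -> \bar R}) (g : T -> R).
Hypothesis g0 : forall x, (0 <= g x)%R.
Hypothesis mg : measurable_fun setT g.
Hypothesis nuE : forall A, measurable A -> nu A = \int[mu]_(x in A) (g x)%:E.

Import HBNNSimple.

(** On indicators this is [nuE]; linearity and monotone convergence along simple functions do the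
    rest. It turns integrals against [normal_prob], given by the masses of sets, into Lebesgue
    integrals. *)
Lemma ge0_integral_density (f : T -> \bar R) :
  measurable_fun setT f -> (forall x, 0 <= f x) ->
  \int[nu]_x f x = \int[mu]_x (f x * (g x)%:E).
Proof.
move=> mf f0; pose f_ := nnsfun_approx measurableT mf.
have mgE : measurable_fun setT (EFin \o g) by exact/measurable_EFinP.
have fcvg x : limn (fun n => (f_ n x)%:E) = f x.
  by apply/cvg_lim => //; exact: cvg_nnsfun_approx.
transitivity (limn (fun n => \int[nu]_x (f_ n x)%:E)).
  rewrite -monotone_convergence//.
  - by apply: eq_integral => x _; rewrite fcvg.
  - by move=> n; exact/measurable_EFinP.
  - by move=> *; rewrite lee_fin.
  - by move=> x _ m n mn; rewrite lee_fin; exact/lefP/nd_nnsfun_approx.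
transitivity (limn (fun n => \int[mu]_x ((f_ n x)%:E * (g x)%:E))); last first.
  rewrite -monotone_convergence//; last 3 first.
  - move=> n; apply: emeasurable_funM => //; exact/measurable_EFinP.
  - by move=> *; rewrite mule_ge0 ?lee_fin.
  - move=> x _ m n mn; apply: lee_wpmul2r; rewrite lee_fin//.
    exact/lefP/nd_nnsfun_approx.
  apply: eq_integral => x _; rewrite -fcvg.
  under eq_fun do rewrite muleC.
  rewrite limeMl 1?muleC//.
  apply/ereal_nondecreasing_is_cvgn => m n mn; rewrite lee_fin.
  exact/lefP/nd_nnsfun_approx.
congr (limn _); apply/funext => n.
under eq_integral do rewrite fimfunE -fsumEFin//.
under [RHS]eq_integral.
  move=> x _; rewrite fimfunE -fsumEFin// muleC ge0_mule_fsumr; last first.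
    by move=> r; rewrite EFinM nnfun_muleindic_ge0.
  over.
rewrite ge0_integral_fsum//; last 2 first.
- by move=> r; exact/measurable_EFinP/measurable_funM.
- by move=> r x _; rewrite EFinM nnfun_muleindic_ge0.
rewrite ge0_integral_fsum//; last 2 first.
- by move=> r; apply: emeasurable_funM => //; apply/measurable_EFinP/measurable_funM.
- move=> r x _; apply: mule_ge0; first by rewrite lee_fin.
  by rewrite EFinM nnfun_muleindic_ge0.
apply: eq_fsbigr => r rf.
have r0 : (0 <= r)%R by move: rf; rewrite inE => -[x _ <-].
under eq_integral do rewrite EFinM.
under [RHS]eq_integral do rewrite EFinM muleCA.
rewrite ge0_integralZl//; last exact/measurable_EFinP.
rewrite ge0_integralZl//; last 2 first.
- by apply: emeasurable_funM => //; exact/measurable_EFinP.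
- by move=> x _; rewrite mule_ge0 ?lee_fin.
congr (_ * _); rewrite integral_indic// setIT nuE// integral_mkcond.
by apply: eq_integral => x _; rewrite patchE indicE; case: ifPn => _;
  rewrite ?mule1 ?mule0.
Qed.

End density.

Section cameron_martin_line.
Local Open Scope ereal_scope.
Context {R : realType}.
Local Notation mu := (@lebesgue_measure R).

Definition translate (m : R) (x : measurableTypeR R) : measurableTypeR R :=
  (x + m)%R.

Lemma measurable_translate m : measurable_fun setT (translate m).
Proof. exact: measurable_funD. Qed.

HB.instance Definition _ m := isMeasurableFun.Build _ _ _ _ (translate m)
  (measurable_translate m).

Lemma lebesgue_measure_translate (m : R) (A : set R) : measurable A ->
  pushforward mu (translate m) A = mu A.
Proof.
move=> mA; apply/esym/lebesgue_measure_unique => //= _ [[a b]] _ <-.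
rewrite /pushforward.
have -> : translate m @^-1` `]a, b]%classic = `](a - m)%R, (b - m)%R]%classic.
  by apply/seteqP; split => x /=; rewrite !in_itv/= ltrBlDr lerBrDr.
rewrite !lebesgue_measure_itv/= !lte_fin ltrD2r; case: ifPn => // _.
by rewrite -!EFinB; congr EFin; ring.
Qed.

Lemma ge0_integral_translate (m : R) (f : R -> \bar R) :
  measurable_fun setT f -> (forall x, 0 <= f x) ->
  \int[mu]_x f (x + m)%R = \int[mu]_x f x.
Proof.
move=> mf f0; transitivity (\int[pushforward mu (translate m)]_x f x).
  by rewrite ge0_integral_pushforward//=; exact: measurable_translate.
apply: eq_measure_integral => //= A mA _; exact: lebesgue_measure_translate.
Qed.

Lemma ge0_integral_normal_prob (m s : R) (f : R -> \bar R) :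
  measurable_fun setT f -> (forall x, 0 <= f x) ->
  \int[normal_prob m s]_x f x = \int[mu]_x (f x * (normal_pdf m s x)%:E).
Proof.
move=> mf f0; apply: ge0_integral_density => //.
- by move=> x; exact: normal_pdf_ge0.
- exact: measurable_normal_pdf.
Qed.

(** Translation invariance of Lebesgue measure moves the shift into the density, and [(x - m)^2 / 2
    = x^2 / 2 - (m x - m^2 / 2)]. *)
Lemma normal_cameron_martin (m : R) (f : R -> \bar R) :
  measurable_fun setT f -> (forall x, 0 <= f x) ->
  \int[normal_prob 0 1]_x f (x + m)%R =
  \int[normal_prob 0 1]_x (f x * (expR (m * x - m ^+ 2 / 2))%:E).
Proof.
move=> mf f0.
have mpdf : measurable_fun setT (@normal_pdf R 0 1) by exact: measurable_normal_pdf.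
have mw : measurable_fun setT (fun x : R => expR (m * x - m ^+ 2 / 2))%R.
  by apply: measurableT_comp => //; apply: measurable_funB => //; exact: measurable_funM.
have mfm : measurable_fun setT (fun x : R => f (x + m)%R).
  by apply: measurableT_comp => //; exact: measurable_funD.
have mfw : measurable_fun setT (fun x => f x * (expR (m * x - m ^+ 2 / 2))%:E).
  by apply: emeasurable_funM => //; exact/measurable_EFinP.
rewrite (ge0_integral_normal_prob _ _ mfm)//.
rewrite (ge0_integral_normal_prob _ _ mfw); last first.
  by move=> x; rewrite mule_ge0 ?lee_fin ?expR_ge0.
rewrite -[RHS](ge0_integral_translate m); last 2 first.
- by apply: emeasurable_funM => //; exact/measurable_EFinP.
- by move=> x; rewrite !mule_ge0 ?lee_fin ?expR_ge0 ?normal_pdf_ge0.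
apply: eq_integral => x _; rewrite -muleA; congr (_ * _).
rewrite -EFinM; congr EFin.
rewrite !normal_pdfE ?oner_eq0// /normal_fun mulrCA -expRD; congr (_ * expR _)%R.
by field.
Qed.

End cameron_martin_line.

(** * Row vectors: measurable operations and the inner product *)

Section measurable_row_vectors.
Context {R : realType} d (Z : measurableType d) (n : nat).
Implicit Types (f g : Z -> 'rV[R]_n) (k : Z -> R).

Lemma measurable_fun_coord f i :
  measurable_fun setT f -> measurable_fun setT (fun z => f z ord0 i).
Proof. by move=> mf; exact: (measurableT_comp (measurable_row_coord i) mf). Qed.

Lemma measurable_fun_rowD f g : measurable_fun setT f -> measurable_fun setT g ->
  measurable_fun setT (fun z => f z + g z).
Proof.
move=> mf mg; apply: measurable_fun_row => i; under eq_fun do rewrite mxE.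
by apply: measurable_funD; exact: measurable_fun_coord.
Qed.

Lemma measurable_fun_rowZ k f : measurable_fun setT k -> measurable_fun setT f ->
  measurable_fun setT (fun z => k z *: f z).
Proof.
move=> mk mf; apply: measurable_fun_row => i; under eq_fun do rewrite mxE.
by apply: measurable_funM => //; exact: measurable_fun_coord.
Qed.

Lemma measurable_fun_dot f g : measurable_fun setT f -> measurable_fun setT g ->
  measurable_fun setT (fun z => dot (f z) (g z)).
Proof.
move=> mf mg; apply: measurable_sum => i.
by apply: measurable_funM; exact: measurable_fun_coord.
Qed.

Lemma measurable_fun_rowB f g : measurable_fun setT f -> measurable_fun setT g ->
  measurable_fun setT (fun z => f z - g z).
Proof.
move=> mf mg; apply: measurable_fun_rowD => //.
under eq_fun do rewrite -scaleN1r.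
by apply: measurable_fun_rowZ => //; exact: measurable_cst.
Qed.

End measurable_row_vectors.

Section dot.
Context {R : realType} {n : nat}.
Implicit Types x y z : 'rV[R]_n.

Lemma dotC x y : dot x y = dot y x.
Proof. by apply: eq_bigr => i _; rewrite mulrC. Qed.

Lemma dotDl x y z : dot (x + y) z = dot x z + dot y z.
Proof. by rewrite -big_split; apply: eq_bigr => i _ /=; rewrite mxE mulrDl. Qed.

Lemma dotZl a x y : dot (a *: x) y = a * dot x y.
Proof. by rewrite /dot mulr_sumr; apply: eq_bigr => i _; rewrite mxE mulrA. Qed.

Lemma dotDr x y z : dot x (y + z) = dot x y + dot x z.
Proof. by rewrite dotC dotDl !(dotC _ x). Qed.

Lemma dotZr a x y : dot x (a *: y) = a * dot x y.
Proof. by rewrite dotC dotZl dotC. Qed.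

Lemma dotNl x y : dot (- x) y = - dot x y.
Proof. by rewrite -scaleN1r dotZl mulN1r. Qed.

Lemma dotNr x y : dot x (- y) = - dot x y.
Proof. by rewrite dotC dotNl dotC. Qed.

Lemma dot_ge0 x : 0 <= dot x x.
Proof. by apply: sumr_ge0 => i _; rewrite -expr2 sqr_ge0. Qed.

Lemma dot0l x : dot 0 x = 0.
Proof. by rewrite -(scale0r 0) dotZl mul0r. Qed.

Definition dotE := (dotDl, dotDr, dotZl, dotZr, dotNl, dotNr).

End dot.

(** * The Cameron-Martin formula on R^n *)

Section gaussian_integral.
Local Open Scope ereal_scope.
Context {R : realType}.

Lemma row_cons0 n (x : measurableTypeR R) (y : 'rV[R]_n) :
  row_cons (x, y) ord0 ord0 = x.
Proof. by rewrite mxE unlift_none. Qed.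

Lemma row_consS n (x : measurableTypeR R) (y : 'rV[R]_n) i :
  row_cons (x, y) ord0 (lift ord0 i) = y ord0 i.
Proof. by rewrite mxE liftK. Qed.

Lemma row_cons_surj n (h : 'rV[R]_n.+1) :
  h = row_cons (h ord0 ord0, \row_j h ord0 (lift ord0 j)).
Proof.
apply/rowP => i; case: (unliftP ord0 i) => [j|] ->; rewrite ?row_cons0//.
by rewrite row_consS mxE.
Qed.

Lemma dot_row_cons n (x x' : R) (y y' : 'rV[R]_n) :
  dot (row_cons (x, y)) (row_cons (x', y')) = (x * x' + dot y y')%R.
Proof.
rewrite /dot big_ord_recl !row_cons0; congr (_ + _)%R.
by apply: eq_bigr => i _; rewrite !row_consS.
Qed.

Lemma row_consD n (x x' : R) (y y' : 'rV[R]_n) :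
  (row_cons (x, y) + row_cons (x', y'))%R = row_cons ((x + x')%R, (y + y')%R).
Proof.
apply/rowP => i; rewrite mxE; case: (unliftP ord0 i) => [j|] ->.
  by rewrite !row_consS mxE.
by rewrite !row_cons0.
Qed.

Lemma ge0_integral_gaussianS n (f : 'rV[R]_n.+1 -> \bar R) :
  measurable_fun setT f -> (forall x, 0 <= f x) ->
  \int[gaussian R n.+1]_x f x =
  \int[normal_prob 0 1]_x \int[gaussian R n]_y f (row_cons (x, y)).
Proof.
move=> mf f0; rewrite /= ge0_integral_distribution//.
rewrite fubini_tonelli1//; last by move=> z; exact: f0.
exact: (measurableT_comp mf (@measurable_row_cons R n)).
Qed.

Lemma measurable_fun_Tonelli d1 d2 (T1 : measurableType d1)
    (T2 : measurableType d2) (mu : probability T2 R) (f : T1 * T2 -> \bar R) :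
  measurable_fun setT f -> (forall z, 0 <= f z) ->
  measurable_fun setT (fun x => \int[mu]_y f (x, y)).
Proof. by move=> mf f0; exact: measurable_fun_fubini_tonelli_F. Qed.

Lemma measurable_expE d (Z : measurableType d) (g : Z -> R) :
  measurable_fun setT g -> measurable_fun setT (fun z => (expR (g z))%:E).
Proof. by move=> mg; apply/measurable_EFinP; exact: measurableT_comp. Qed.

(** The exponent is additive over coordinates, so Tonelli peels them off one by one. The reflection
    and the rotation below are composed of such shifts and are thus obtained without a density on
    R^n. *)
Lemma gaussian_cameron_martin n (h : 'rV[R]_n) (f : 'rV[R]_n -> \bar R) :
  measurable_fun setT f -> (forall x, 0 <= f x) ->
  \int[gaussian R n]_x f (x + h)%R =
  \int[gaussian R n]_x (f x * (expR (dot h x - dot h h / 2))%:E).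
Proof.
move: n h f.
have mw n (h : 'rV[R]_n) :
    measurable_fun setT (fun x => (expR (dot h x - dot h h / 2))%:E).
  apply: measurable_expE; apply: measurable_funB => //.
  by apply: measurable_fun_dot => //; exact: measurable_cst.
have mD n (h : 'rV[R]_n) (f : 'rV[R]_n -> \bar R) : measurable_fun setT f ->
    measurable_fun setT (fun x : 'rV[R]_n => f (x + h)%R).
  move=> mf; apply: measurableT_comp => //.
  by apply: measurable_fun_rowD => //; exact: measurable_cst.
elim=> [|n IHn] h f mf f0.
  rewrite /gaussian !integral_dirac//; first last.
  - exact: (mD _ h).
  - exact: (emeasurable_funM mf (mw _ h)).
  by rewrite !(thinmx0 (_ + _)%R) !(thinmx0 h) dot0l mul0r subrr expR0 mule1.
rewrite ge0_integral_gaussianS//; last exact: mD.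
rewrite ge0_integral_gaussianS//; last 2 first.
- exact: (emeasurable_funM mf (mw _ h)).
- by move=> x; rewrite mule_ge0 ?lee_fin ?expR_ge0.
rewrite (row_cons_surj h).
set a := h _ _; set k := (\row_j _)%R.
have mrc d (Z : measurableType d) (u : Z -> measurableTypeR R) (v : Z -> 'rV[R]_n) :
    measurable_fun setT u -> measurable_fun setT v ->
    measurable_fun setT (fun z => f (row_cons (u z, v z))).
  move=> mu mv; apply: measurableT_comp => //.
  by apply: measurableT_comp; [exact: measurable_row_cons|exact: measurable_fun_pair].
pose g (x : R) := \int[gaussian R n]_y
  (f (row_cons (x, y)) * (expR (dot k y - dot k k / 2))%:E).
have g0 x : 0 <= g x.
  by apply: integral_ge0 => y _; rewrite mule_ge0 ?lee_fin ?expR_ge0.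
have mg : measurable_fun setT g.
  apply: (@measurable_fun_Tonelli _ _ _ _ _ (fun z : measurableTypeR R * 'rV[R]_n =>
    f (row_cons (z.1, z.2)) * (expR (dot k z.2 - dot k k / 2))%:E)).
    apply: emeasurable_funM; first exact: mrc.
    by apply: (measurableT_comp (mw _ k)).
  by move=> z; rewrite mule_ge0 ?lee_fin ?expR_ge0.
transitivity (\int[normal_prob 0 1]_x g (x + a)%R).
  apply: eq_integral => x _; rewrite /g -(IHn _ (fun y => f (row_cons (_, y))))//.
    by apply: eq_integral => y _; rewrite row_consD.
  exact: mrc.
rewrite normal_cameron_martin//; apply: eq_integral => x _.
rewrite /g muleC -ge0_integralZl//; last 2 first.
- by apply: emeasurable_funM; [exact: mrc|exact: mw].
- by move=> y _; rewrite mule_ge0 ?lee_fin ?expR_ge0.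
apply: eq_integral => y _; rewrite muleCA -EFinM -expRD !dot_row_cons.
by congr (_ * (expR _)%:E); ring.
Qed.

End gaussian_integral.

(** * Rotations of Gaussian measures and Fernique's theorem *)

Section gaussian_reflection.
Local Open Scope ereal_scope.
Context {R : realType}.

Lemma ge0_integral_swap d1 d2 (T1 : measurableType d1) (T2 : measurableType d2)
    (m1 : probability T1 R) (m2 : probability T2 R) (f : T1 -> T2 -> \bar R) :
  measurable_fun setT (fun z : T1 * T2 => f z.1 z.2) ->
  (forall x y, 0 <= f x y) ->
  \int[m1]_x \int[m2]_y f x y = \int[m2]_y \int[m1]_x f x y.
Proof.
by move=> mf f0; rewrite (@fubini_tonelli _ _ _ _ _ m1 m2 _ mf)// => -[x y].
Qed.

Lemma integral_normal_expR (m : R) :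
  \int[normal_prob 0 1]_x (expR (m * x - m ^+ 2 / 2))%:E = 1.
Proof.
transitivity (\int[normal_prob 0 1]_x (cst 1 x * (expR (m * x - m ^+ 2 / 2))%:E)).
  by apply: eq_integral => x _; rewrite mul1e.
rewrite -normal_cameron_martin//.
transitivity (\int[@normal_prob R 0 1]_x cst 1 x); first exact: eq_integral.
by rewrite integral_cst// mul1e; exact: probability_setT.
Qed.

(* [x |-> x + k (g - <x, a>) a] is the second component of the reflection of
   [(g, x)] in the hyperplane orthogonal to [(-1, a)]; as [g] does not matter,
   two shears suffice. *)
Lemma gaussian_reflection n (a : 'rV[R]_n) (f : 'rV[R]_n -> \bar R) :
  measurable_fun setT f -> (forall x, 0 <= f x) ->
  \int[normal_prob 0 1]_g \int[gaussian R n]_x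
    f (x + (2 / (1 + dot a a) * (g - dot x a)) *: a)%R =
  \int[gaussian R n]_x f x.
Proof.
move=> mf f0; set k := (2 / _)%R.
have da : (1 + dot a a != 0)%R by rewrite gt_eqF// ltr_pwDl// dot_ge0.
pose w (g m : R) := (expR (- m * g - m ^+ 2 / 2))%:E.
have w0 g m : 0 <= w g m by rewrite lee_fin expR_ge0.
have mdot d (Z : measurableType d) (x : Z -> 'rV[R]_n) :
    measurable_fun setT x -> measurable_fun setT (fun z => dot (x z) a).
  by move=> mx; apply: measurable_fun_dot => //; exact: measurable_cst.
have mw d (Z : measurableType d) (g m : Z -> R) :
    measurable_fun setT g -> measurable_fun setT m ->
    measurable_fun setT (fun z => w (g z) (m z)).
  move=> mg mm; apply: measurable_expE; apply: measurable_funB.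
    by apply: measurable_funM => //; exact: measurableT_comp.
  by apply: measurable_funM => //; exact: measurable_funX.
have msh d (Z : measurableType d) (x : Z -> 'rV[R]_n) (g : Z -> R) :
    measurable_fun setT x -> measurable_fun setT g ->
    measurable_fun setT (fun z => f (x z + (k * g z) *: a)%R).
  move=> mx mg; apply: measurableT_comp => //; apply: measurable_fun_rowD => //.
  apply: measurable_fun_rowZ; last exact: measurable_cst.
  exact: measurable_funM.
pose ntype := measurableTypeR R.
have m1 : measurable_fun setT (fst : ntype * 'rV[R]_n -> R) by exact: measurable_fst.
have m2 : measurable_fun setT (snd : ntype * 'rV[R]_n -> _) by exact: measurable_snd.
have m1' : measurable_fun setT (fst : 'rV[R]_n * ntype -> _) by exact: measurable_fst.
have m2' : measurable_fun setT (snd : 'rV[R]_n * ntype -> R) by exact: measurable_snd.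
rewrite ge0_integral_swap//; last first.
  by apply: msh => //; apply: measurable_funB => //; exact: mdot.
(* First shear: for fixed [x], the substitution in [g] removes [<x, a>] from the argument of [f] and
   leaves the weight [w g (dot x a)]. *)
transitivity (\int[gaussian R n]_x \int[normal_prob 0 1]_g
    (f (x + (k * g) *: a)%R * w g (dot x a))).
  apply: eq_integral => x _.
  have mg : measurable_fun setT (fun g => f (x + (k * g) *: a)%R).
    by apply: msh => //; exact: measurable_cst.
  apply: etrans (normal_cameron_martin (- dot x a)%R mg (fun _ => f0 _)) _.
  by apply: eq_integral => g _; rewrite /w sqrrN.
rewrite ge0_integral_swap//; last 2 first.
- by apply: emeasurable_funM; [exact: msh|apply: mw => //; exact: mdot].
- by move=> x g; rewrite mule_ge0.
(* Second shear, in [x] for fixed [g]. The value [k = 2 / (1 + |a|^2)] is the one that cancels the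
   terms in [g^2] and flips the coefficient of [<x, a> g] from -1 to 1; the remaining weight
   integrates to 1 over [g]. *)
transitivity (\int[normal_prob 0 1]_g \int[gaussian R n]_x
    (f x * w g (- dot x a)%R)).
  apply: eq_integral => g _; pose h := ((k * g) *: a)%R.
  pose F x := f x * w g (dot (x - h)%R a).
  transitivity (\int[gaussian R n]_x F (x + h)%R).
    by apply: eq_integral => x _; rewrite /F addrK.
  rewrite gaussian_cameron_martin; last 2 first.
  - apply: emeasurable_funM => //; apply: mw; first exact: measurable_cst.
    by apply: mdot; apply: measurable_fun_rowB => //; exact: measurable_cst.
  - by move=> x; rewrite mule_ge0.
  apply: eq_integral => x _; rewrite /F -muleA; congr (_ * _).
  rewrite /w -EFinM -expRD; congr (expR _)%:E.
  rewrite /h !dotE (dotC a x) /k; move: (dot x a) (dot a a) da => m t t1.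
  by field.
rewrite -ge0_integral_swap//; last 2 first.
- apply: emeasurable_funM; first exact: measurableT_comp.
  by apply: mw => //; apply: measurableT_comp => //; exact: mdot.
- by move=> x g; rewrite mule_ge0.
apply: eq_integral => x _; rewrite ge0_integralZl//; last first.
  by apply: mw => //; exact: measurable_cst.
rewrite -[RHS]mule1; congr (_ * _); rewrite -(integral_normal_expR (dot x a)).
by apply: eq_integral => g _; rewrite /w opprK sqrrN.
Qed.

End gaussian_reflection.

Section gaussian_rotation.
Local Open Scope ereal_scope.
Context {R : realType} {n : nat}.
Notation V := 'rV[R]_n.
Notation gam := (gaussian R n).
Implicit Types (F : V -> V -> \bar R).

Let mpair F := measurable_fun setT (fun z : V * V => F z.1 z.2).

Let mcomp F (x y : V * V -> V) : mpair F ->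
  measurable_fun setT x -> measurable_fun setT y ->
  measurable_fun setT (fun z => F (x z) (y z)).
Proof.
move=> mF mx my.
by apply: (measurableT_comp mF (g := fun z => (x z, y z))); exact: measurable_fun_pair.
Qed.

Let m1 : measurable_fun setT (fst : V * V -> V). Proof. exact: measurable_fst. Qed.
Let m2 : measurable_fun setT (snd : V * V -> V). Proof. exact: measurable_snd. Qed.

Let w a (x y : V) : \bar R := (expR (a * dot x y - a ^+ 2 * dot y y / 2))%:E.

Let w0 a x y : 0 <= w a x y. Proof. by rewrite lee_fin expR_ge0. Qed.

Let mw a (x y : V * V -> V) :
  measurable_fun setT x -> measurable_fun setT y ->
  measurable_fun setT (fun z => w a (x z) (y z)).
Proof.
move=> mx my; apply: measurable_expE; apply: measurable_funB.
  by apply: measurable_funM => //; exact: measurable_fun_dot.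
by do 2 apply: measurable_funM => //; exact: measurable_fun_dot.
Qed.

Let msh a (x y : V * V -> V) :
  measurable_fun setT x -> measurable_fun setT y ->
  measurable_fun setT (fun z => x z + a *: y z)%R.
Proof.
move=> mx my; apply: measurable_fun_rowD => //.
by apply: measurable_fun_rowZ => //; exact: measurable_cst.
Qed.

Let shear_l a F : mpair F -> (forall x y, 0 <= F x y) ->
  \int[gam]_x \int[gam]_y F (x + a *: y)%R y =
  \int[gam]_x \int[gam]_y (F x y * w a x y).
Proof.
move=> mF F0; have mS := mcomp mF (msh a m1 m2) m2.
have mFw : mpair (fun x y => F x y * w a x y).
  exact: (emeasurable_funM mF (mw a m1 m2)).
rewrite (ge0_integral_swap _ _ mS (fun _ _ => F0 _ _)).
rewrite (ge0_integral_swap _ _ mFw (fun _ _ => mule_ge0 (F0 _ _) (w0 _ _ _))).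
apply: eq_integral => y _.
have mFy : measurable_fun setT (F^~ y).
  exact: (measurableT_comp mF (pair2_measurable y)).
apply: etrans (gaussian_cameron_martin (a *: y) mFy (fun _ => F0 _ _)) _.
apply: eq_integral => x _; congr (_ * (expR _)%:E).
by rewrite !dotE (dotC y x); ring.
Qed.

Let shear_r a F : mpair F -> (forall x y, 0 <= F x y) ->
  \int[gam]_x \int[gam]_y F x (y + a *: x)%R =
  \int[gam]_x \int[gam]_y (F x y * w a y x).
Proof.
move=> mF F0.
have mF' : mpair (fun x y => F y x) by exact: (mcomp mF m2 m1).
have mS : mpair (fun x y => F x (y + a *: x)%R) by exact: (mcomp mF m1 (msh a m2 m1)).
have mFw : mpair (fun x y => F x y * w a y x).
  exact: (emeasurable_funM mF (mw a m2 m1)).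
rewrite (ge0_integral_swap _ _ mS (fun _ _ => F0 _ _)).
rewrite (ge0_integral_swap _ _ mFw (fun _ _ => mule_ge0 (F0 _ _) (w0 _ _ _))).
exact: (@shear_l a (fun x y => F y x) mF' (fun x y => F0 y x)).
Qed.

(** With [a] the tangent of half the angle, a rotation is a product of three shears with parameters
    [a], [- s], [a]. Each shear is a Cameron-Martin shift in one variable with the other fixed, and
    the three weights multiply to 1 because a rotation preserves [|x|^2 + |y|^2]. *)
Lemma gaussian_rotation (a : R) F : mpair F -> (forall x y, 0 <= F x y) ->
  let c := ((1 - a ^+ 2) / (1 + a ^+ 2))%R in
  let s := (2 * a / (1 + a ^+ 2))%R in
  \int[gam]_x \int[gam]_y F (c *: x + s *: y)%R (c *: y - s *: x)%R =
  \int[gam]_x \int[gam]_y F x y.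
Proof.
move=> mF F0 c s; have a1 : (1 + a ^+ 2 != 0)%R.
  by rewrite gt_eqF// ltr_pwDl// sqr_ge0.
have [b bE] : exists b, b = (- s)%R by exists (- s)%R.
(* [G1], [G2], [G3] are the integrands before the first, second and third shear, written in the
   sheared variables; the weights already produced are included. *)
pose G1 x y := F (x + a *: (y + b *: x))%R (y + b *: x)%R.
pose G2 x y := F (x + a *: y)%R y * w a x (y + (- b) *: x)%R.
pose G3 x y := F x y * w a (x + (- a) *: y)%R (y + (- b) *: (x + (- a) *: y))%R
  * w b y (x + (- a) *: y)%R.
have mG1 : mpair G1 by exact: (mcomp mF (msh a m1 (msh b m2 m1)) (msh b m2 m1)).
have mG2 : mpair G2.
  exact: (emeasurable_funM (mcomp mF (msh a m1 m2) m2) (mw a m1 (msh (- b) m2 m1))).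
have mu := msh (- a) m1 m2.
have mG3 : mpair G3.
  apply: emeasurable_funM; last exact: (mw b m2 mu).
  exact: (emeasurable_funM mF (mw a mu (msh (- b) m2 mu))).
transitivity (\int[gam]_x \int[gam]_y G1 (x + a *: y)%R y).
  apply: eq_integral => x _; apply: eq_integral => y _; rewrite /G1; congr F.
    by apply/rowP => i; rewrite !mxE bE /s /c; field.
  by apply/rowP => i; rewrite !mxE bE /s /c; field.
rewrite (shear_l _ mG1 (fun _ _ => F0 _ _)).
transitivity (\int[gam]_x \int[gam]_y G2 x (y + b *: x)%R).
  apply: eq_integral => x _; apply: eq_integral => y _.
  by rewrite /G2 scaleNr addrK.
rewrite (shear_r _ mG2 (fun _ _ => mule_ge0 (F0 _ _) (w0 _ _ _))).
transitivity (\int[gam]_x \int[gam]_y G3 (x + a *: y)%R y).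
  apply: eq_integral => x _; apply: eq_integral => y _.
  by rewrite /G3 scaleNr addrK.
rewrite (shear_l _ mG3 (fun _ _ => mule_ge0 (mule_ge0 (F0 _ _) (w0 _ _ _)) (w0 _ _ _))).
apply: eq_integral => x _; apply: eq_integral => y _.
rewrite /G3 -!muleA -[RHS]mule1; congr (_ * _).
rewrite /w -!EFinM -!expRD; apply: (@etrans _ _ (expR 0)%:E); last by rewrite expR0.
congr (expR _)%:E.
rewrite !dotE (dotC y x) bE /s.
by move: (dot x x) (dot x y) (dot y y) => X P Y; field.
Qed.

End gaussian_rotation.

(** * Measurable seminorms and Fernique's theorem *)

Record measurable_seminorm (R : realType) n (N : 'rV[R]_n -> R) : Prop :=
  MeasurableSeminorm {
    seminormD : forall x y, N (x + y) <= N x + N y ;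
    seminormZ : forall a x, N (a *: x) = `|a| * N x ;
    measurable_seminormE : measurable_fun setT N }.

Section seminorm.
Context {R : realType} {n : nat} {N : 'rV[R]_n -> R}.
Hypothesis hN : measurable_seminorm N.

Lemma seminorm0 : N 0 = 0.
Proof. by rewrite -(scale0r 0) (seminormZ hN) normr0 mul0r. Qed.

Lemma seminormN x : N (- x) = N x.
Proof. by rewrite -scaleN1r (seminormZ hN) normrN1 mul1r. Qed.

Lemma seminorm_ge0 x : 0 <= N x.
Proof.
have := seminormD hN x (- x); rewrite subrr seminorm0 seminormN.
by rewrite -mulr2n pmulrn_lge0.
Qed.

Lemma seminormB x y : N (x - y) <= N x + N y.
Proof. by rewrite -(seminormN y); exact: seminormD. Qed.

Lemma measurable_seminorm_le t : measurable [set x | N x <= t].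
Proof.
rewrite -[X in measurable X]setTI; apply: measurable_fun_le => //.
exact: measurable_seminormE.
Qed.

Lemma measurable_seminorm_gt t : measurable [set x | t < N x].
Proof.
rewrite (_ : [set _ | _] = ~` [set x | N x <= t]).
  by apply: measurableC; exact: measurable_seminorm_le.
by apply/seteqP; split => x /=; rewrite ltNge => /negP.
Qed.

End seminorm.

(** [X], [Y] stand for the seminorms of a pair and [U], [W] for those of the rotated pair. As soon
    as two of the four are at most 1, the triangle inequality bounds [X] and [Y] by
    [1 + 3 / 2 = 5 / 2]; here 3/2 and 3/4 majorize [sqrt 2] and [1 / sqrt 2]. *)
Lemma two_of_four_bound (R : realType) (X Y U W : R) :
  0 <= X -> 0 <= Y -> 0 <= U -> 0 <= W ->
  X <= 3 / 2 * U + Y -> Y <= 3 / 2 * U + X ->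
  X <= Y + 3 / 2 * W -> Y <= X + 3 / 2 * W ->
  X <= 3 / 4 * (U + W) -> Y <= 3 / 4 * (U + W) ->
  ((X <= 1)%R%:R + (Y <= 1)%R%:R + (U <= 1)%R%:R + (W <= 1)%R%:R : R) <=
  1 + 3 * ((X <= 5 / 2)%R && (Y <= 5 / 2)%R)%:R.
Proof.
move=> *; have [|] := leP X (5 / 2); have [|] := leP Y (5 / 2);
have [|] := leP X 1; have [|] := leP Y 1;
have [|] := leP U 1; have [|] := leP W 1; rewrite /=; lra.
Qed.

Section fernique.
Context {R : realType} {n : nat} {N : 'rV[R]_n -> R}.
Hypothesis hN : measurable_seminorm N.
Notation V := 'rV[R]_n.
Notation gam := (gaussian R n).
Notation gam2 := (gam \x gam)%E.

(* [c] stands for [1 / sqrt 2]. *)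
Variable c : R.
Hypotheses (c_ge0 : 0 <= c) (cE : c ^+ 2 = 1 / 2).

Let c_bnd : 7 / 10 <= c <= 3 / 4.
Proof.
apply/andP; split; last by move: cE; nra.
by have [//|h] := leP (7 / 10) c; exfalso; move: cE c_ge0; nra.
Qed.

Definition rotate_pair (z : V * V) : V * V :=
  (c *: z.1 + c *: z.2, c *: z.2 - c *: z.1).

Let measurable_rotate_pair : measurable_fun setT rotate_pair.
Proof.
have m1 : measurable_fun setT (fun z : V * V => c *: z.1).
  by apply: measurable_fun_rowZ; [exact: measurable_cst|exact: measurable_fst].
have m2 : measurable_fun setT (fun z : V * V => c *: z.2).
  by apply: measurable_fun_rowZ; [exact: measurable_cst|exact: measurable_snd].
apply: measurable_fun_pair; first exact: measurable_fun_rowD.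
exact: measurable_fun_rowB.
Qed.

Let measurable_preimage_rotate (E : set (V * V)) : measurable E ->
  measurable (rotate_pair @^-1` E).
Proof. by move=> mE; rewrite -[X in measurable X]setTI; exact: measurable_rotate_pair. Qed.

Let gam2_rotate (E : set (V * V)) : measurable E ->
  gam2 (rotate_pair @^-1` E) = gam2 E.
Proof.
move=> mE; have mE' := measurable_preimage_rotate mE.
have indE (A : set (V * V)) : measurable A ->
    gam2 A = (\int[gam]_x \int[gam]_y (\1_A (x, y))%:E)%E.
  move=> mA; rewrite -[A in LHS]setIT -integral_indic//.
  have mA1 : measurable_fun setT (EFin \o (\1_A : V * V -> R)) by exact/measurable_EFinP.
  by rewrite (@fubini_tonelli1 _ _ _ _ _ gam gam _ mA1)// => z; rewrite lee_fin.
rewrite (indE _ mE') (indE _ mE).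
have e2 : (2 * c - 1) ^+ 2 = 3 - 4 * c by move: cE; lra.
have d0 : 1 + (2 * c - 1) ^+ 2 != 0 by rewrite gt_eqF// ltr_pwDl// sqr_ge0.
have := @gaussian_rotation R n (2 * c - 1) (fun x y => (\1_E (x, y))%:E).
have -> : (1 - (2 * c - 1) ^+ 2) / (1 + (2 * c - 1) ^+ 2) = c.
  by apply: (mulIf d0); rewrite mulfVK// e2; move: cE; lra.
have -> : 2 * (2 * c - 1) / (1 + (2 * c - 1) ^+ 2) = c.
  by apply: (mulIf d0); rewrite mulfVK// e2; move: cE; lra.
apply => //; apply/measurable_EFinP; rewrite (_ : (fun _ => _) = \1_E)//.
by apply/funext => -[].
Qed.

Let P (A : set V) : R := fine (gam A).

Let PE A : measurable A -> gam A = (P A)%:E.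
Proof. by move=> mA; rewrite /P fineK// fin_num_measure. Qed.

Let gam2X A B : measurable A -> measurable B -> gam2 (A `*` B) = (P A * P B)%:E.
Proof.
move=> mA mB; rewrite product_measure1E// EFinM.
by congr (_ * _)%E; exact: PE.
Qed.

Let NcZ x : N (c *: x) = c * N x.
Proof. by rewrite (seminormZ hN) ger0_norm. Qed.
Let N2cZ x : N ((2 * c) *: x) = 2 * c * N x.
Proof. by rewrite (seminormZ hN) ger0_norm// mulr_ge0. Qed.

Let cc a : 2 * c * (c * a) = a.
Proof. by transitivity (2 * c ^+ 2 * a); [ring|rewrite cE; lra]. Qed.

Let un_rotate1 (x y : V) : x = c *: (c *: x + c *: y) - c *: (c *: y - c *: x).
Proof.
apply/rowP => i; rewrite !mxE; transitivity (2 * c ^+ 2 * x ord0 i); last by ring.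
by rewrite cE; lra.
Qed.

Let un_rotate2 (x y : V) : y = c *: (c *: x + c *: y) + c *: (c *: y - c *: x).
Proof.
apply/rowP => i; rewrite !mxE; transitivity (2 * c ^+ 2 * y ord0 i); last by ring.
by rewrite cE; lra.
Qed.

(** Fernique's recursion gains only from a ball of mass strictly above 1/2, more than is assumed of
    the unit ball. By rotation invariance each of the four events of [two_of_four_bound] has mass at
    least 1/2, so integrating that bound gives [2 <= 1 + 3 * P ^+ 2] for the ball of radius 5/2. *)
Let gaussian_fernique_start : ((1 / 2)%:E <= gam [set x : V | (N x <= 1)%R])%E ->
  1 / 3 <= P [set x : V | N x <= 5 / 2] ^+ 2.
Proof.
set A := [set x | _]; set B := [set x : V | N x <= 5 / 2].
have mA : measurable A by exact: measurable_seminorm_le.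
have mB : measurable B by exact: measurable_seminorm_le.
rewrite PE// lee_fin => hA.
have mAT : measurable (A `*` [set: V]) by exact: measurableX.
have mTA : measurable ([set: V] `*` A) by exact: measurableX.
have mBB : measurable (B `*` B) by exact: measurableX.
pose E1 := A `*` [set: V]; pose E2 := [set: V] `*` A.
pose E3 := rotate_pair @^-1` E1; pose E4 := rotate_pair @^-1` E2.
have mE3 : measurable E3 by exact: measurable_preimage_rotate.
have mE4 : measurable E4 by exact: measurable_preimage_rotate.
have PT : P [set: V] = 1 by rewrite /P probability_setT.
have gE1 : gam2 E1 = (P A)%:E by rewrite gam2X// PT mulr1.
have gE2 : gam2 E2 = (P A)%:E by rewrite gam2X// PT mul1r.
have gE3 : gam2 E3 = (P A)%:E by rewrite gam2_rotate.
have gE4 : gam2 E4 = (P A)%:E by rewrite gam2_rotate.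
pose f (z : V * V) : R := \1_E1 z + \1_E2 z + \1_E3 z + \1_E4 z.
have mind (E : set (V * V)) : measurable E -> measurable_fun setT (fun z => (\1_E z : R)%:E).
  by move=> mE; exact/measurable_EFinP.
have intf : (\int[gam2]_z (f z)%:E = (P A + P A + P A + P A)%:E)%E.
  rewrite /f; under eq_integral do rewrite !EFinD.
  rewrite ge0_integralD//; last 3 first.
  - by move=> z _; rewrite !adde_ge0 ?lee_fin.
  - by do !apply: emeasurable_funD; exact: mind.
  - exact: mind.
  rewrite ge0_integralD//; last 3 first.
  - by move=> z _; rewrite !adde_ge0 ?lee_fin.
  - by do !apply: emeasurable_funD; exact: mind.
  - exact: mind.
  rewrite ge0_integralD//; [|exact: mind..].
  rewrite !integral_indic// !setIT.
  by rewrite !EFinD; congr (_ + _ + _ + _)%E.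
have intg : (\int[gam2]_z (1 + 3 * \1_(B `*` B) z)%:E = (1 + 3 * (P B * P B))%:E)%E.
  under eq_integral do rewrite EFinD EFinM.
  rewrite ge0_integralD//; last first.
    by apply: emeasurable_funM => //; exact: mind.
  rewrite ge0_integralZl_EFin//; last exact: mind.
  rewrite integral_cst// mul1e integral_indic// setIT.
  transitivity (1%:E + 3%:E * (P B * P B)%:E)%E; last by rewrite -EFinM -EFinD.
  by congr (_ + _ * _)%E; [exact: probability_setT|exact: gam2X].
have : ((P A + P A + P A + P A)%:E <= (1 + 3 * (P B * P B))%:E :> \bar R)%E.
  rewrite -intf -intg; apply: ge0_le_integral => //.
  - by move=> z _; rewrite lee_fin !addr_ge0.
  - apply/measurable_EFinP.
    by do !apply: measurable_funD; apply: measurable_indic => //; exact: measurableX.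
  - apply/measurable_EFinP; apply: measurable_funD => //; apply: measurable_funM => //.
  move=> [x y] _; rewrite lee_fin /f !indicE.
  have i1 : ((x, y) \in E1) = (N x <= 1).
    by apply/idP/idP => [/set_mem[]//|h]; exact/mem_set.
  have i2 : ((x, y) \in E2) = (N y <= 1).
    by apply/idP/idP => [/set_mem[]//|h]; exact/mem_set.
  have i3 : ((x, y) \in E3) = (N (c *: x + c *: y) <= 1).
    by apply/idP/idP => [/set_mem[]//|h]; exact/mem_set.
  have i4 : ((x, y) \in E4) = (N (c *: y - c *: x) <= 1).
    by apply/idP/idP => [/set_mem[]//|h]; exact/mem_set.
  have iB : ((x, y) \in B `*` B) = (N x <= 5 / 2) && (N y <= 5 / 2).
    by apply/idP/idP => [/set_mem[/= -> ->]//|/andP[? ?]]; exact/mem_set.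
  rewrite i1 i2 i3 i4 iB.
  set u := c *: x + c *: y; set v := c *: y - c *: x.
  have x0 := seminorm_ge0 hN x; have y0 := seminorm_ge0 hN y.
  have u0 := seminorm_ge0 hN u; have v0 := seminorm_ge0 hN v.
  have d1 : N x <= c * N u + c * N v.
    by rewrite {1}(un_rotate1 x y) -!NcZ; exact: seminormB.
  have d2 : N y <= c * N u + c * N v.
    by rewrite {1}(un_rotate2 x y) -!NcZ; exact: seminormD.
  have d3 : N x <= 2 * c * N u + N y.
    rewrite -N2cZ; apply: le_trans (seminormB hN _ _); rewrite le_eqVlt; apply/orP; left.
    apply/eqP; congr N; apply/rowP => i; rewrite !mxE.
    by rewrite mulrDr ?mulrN !cc; ring.
  have d4 : N y <= 2 * c * N u + N x.
    rewrite -N2cZ; apply: le_trans (seminormB hN _ _); rewrite le_eqVlt; apply/orP; left.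
    apply/eqP; congr N; apply/rowP => i; rewrite !mxE.
    by rewrite mulrDr ?mulrN !cc; ring.
  have d5 : N x <= N y + 2 * c * N v.
    rewrite -N2cZ; apply: le_trans (seminormB hN _ _); rewrite le_eqVlt; apply/orP; left.
    apply/eqP; congr N; apply/rowP => i; rewrite !mxE.
    by rewrite mulrDr ?mulrN !cc; ring.
  have d6 : N y <= N x + 2 * c * N v.
    rewrite -N2cZ; apply: le_trans (seminormD hN _ _); rewrite le_eqVlt; apply/orP; left.
    apply/eqP; congr N; apply/rowP => i; rewrite !mxE.
    by rewrite mulrDr ?mulrN !cc; ring.
  have cb : 2 * c <= 3 / 2 by case/andP: c_bnd => _ ?; lra.
  have cu : 2 * c * N u <= 3 / 2 * N u by exact: ler_wpM2r.
  have cv : 2 * c * N v <= 3 / 2 * N v by exact: ler_wpM2r.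
  by apply: two_of_four_bound => //; move: d1 d2 d3 d4 d5 d6 cu cv u0 v0; lra.
by rewrite lee_fin expr2; lra.
Qed.

(** If the rotated pair [(u, v)] has [N u] large and [N v <= s], then [x = c (u - v)] and
    [y = c (u + v)] both have seminorm above [t]. Both pairs have the same law, with independent
    components. *)
Let fernique_step s t :
  P [set x : V | N x <= s] * P [set x : V | s + 2 * c * t < N x] <=
  P [set x : V | t < N x] ^+ 2.
Proof.
set A := [set x : V | N x <= s]; set B := [set x : V | _ + _ < _].
set D := [set x : V | t < N x].
have mA : measurable A by exact: measurable_seminorm_le.
have mB : measurable B by exact: measurable_seminorm_gt.
have mD : measurable D by exact: measurable_seminorm_gt.
have mBA : measurable (B `*` A) by exact: measurableX.
have mDD : measurable (D `*` D) by exact: measurableX.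
rewrite expr2 -lee_fin -(gam2X mD mD) mulrC -(gam2X mB mA) -(gam2_rotate mBA).
apply: le_measure; rewrite ?inE//; first exact: measurable_preimage_rotate.
move=> [x y] [/=]; rewrite /B /A /D /=.
set u := c *: x + c *: y; set v := c *: y - c *: x => hu hv.
have cu : c * (s + 2 * c * t) < c * N u by rewrite ltr_pM2l//; case/andP: c_bnd; lra.
have cv : c * N v <= c * s by exact: ler_wpM2l.
have ct : c * (s + 2 * c * t) = c * s + t.
  by transitivity (c * s + 2 * c ^+ 2 * t); [ring|rewrite cE; lra].
split.
  have : N (c *: u) <= N x + N (c *: v).
    have xE : x = c *: u - c *: v := un_rotate1 x y.
    by apply: le_trans (seminormD hN _ _); rewrite xE subrK.
  by rewrite !NcZ; lra.
have : N (c *: u) <= N y + N (c *: v).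
  have yE : y = c *: u + c *: v := un_rotate2 x y.
  by apply: le_trans (seminormB hN _ _); rewrite yE addrK.
by rewrite !NcZ; lra.
Qed.

(** Thresholds with [5 / 2 + sqrt 2 * T k <= T k.+1], as [fernique_step] requires: 25/4 is
    [(5 / 2) / (7 / 5 - 1)], with 7/5 below [sqrt 2], and 9 makes [T 0] at least 5/2. *)
Let T k : R := 9 * (2 * c) ^+ k - 25 / 4.

Hypothesis N1 : ((1 / 2)%:E <= gam [set x : V | (N x <= 1)%R])%E.

Let p := P [set x : V | N x <= 5 / 2].

Let p_bnd : 4 / 7 <= p <= 1.
Proof.
have p1 : p <= 1.
  by rewrite -lee_fin -PE ?probability_le1//; exact: measurable_seminorm_le.
have p0 : 0 <= p by rewrite /p /P fine_ge0.
have h := gaussian_fernique_start N1; rewrite p1 andbT.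
suff H (z : R) : 0 <= z -> 1 / 3 <= z ^+ 2 -> 4 / 7 <= z by exact: H.
move=> z0 hz; rewrite -(@ler_pXn2r _ 2)// ?nnegrE//.
by lra.
Qed.

(** Each [fernique_step] squares the ratio of the tail to [p]. It starts below 3/4, because
    [(1 - p) / p <= 3 / 4] once [p >= 4 / 7]. *)
Let tail k : P [set x : V | T k < N x] <= p * (3 / 4) ^+ (2 ^ k).
Proof.
have le_P (A B : set V) : measurable A -> measurable B -> A `<=` B -> P A <= P B.
  by move=> mA mB AB; rewrite -lee_fin -!PE//; apply: le_measure; rewrite ?inE.
have mgt t : measurable [set x : V | t < N x] by exact: measurable_seminorm_gt.
have /andP[c7 c3] := c_bnd; elim: k => [|k IHk].
  rewrite expn0 expr1; apply: (@le_trans _ _ (1 - p)); last by case/andP: p_bnd; lra.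
  rewrite (_ : 1 - p = P (~` [set x : V | N x <= 5 / 2])); last first.
    have mle : measurable [set x : V | N x <= 5 / 2] by exact: measurable_seminorm_le.
    by apply: EFin_inj; rewrite -PE ?probability_setC ?PE//; exact: measurableC.
  apply: le_P => //; first by apply: measurableC; exact: measurable_seminorm_le.
  by move=> x /=; rewrite /T expr0 => h; apply/negP; rewrite -ltNge; lra.
have /andP[p47 p1] := p_bnd; have p0 : 0 < p by lra.
rewrite -(ler_pM2l p0).
apply: (@le_trans _ _ (P [set x : V | T k < N x] ^+ 2)); last first.
  rewrite mulrA -expr2 expnS mulnC exprM -exprMn lerXn2r// nnegrE.
    by rewrite /P fine_ge0.
  by rewrite mulr_ge0 ?exprn_ge0// ltW.
apply: le_trans (fernique_step (5 / 2) (T k)).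
rewrite ler_pM2l//; apply: le_P => // x /=; apply: le_lt_trans.
rewrite /T exprS; set e := _ ^+ k.
by rewrite (_ : 2 * c * (9 * e - 25 / 4) = 9 * (2 * c * e) - 25 / 2 * c); [lra|field].
Qed.

Let T_cofinal x : exists k, x <= T k.
Proof.
have /andP[c7 c3] := c_bnd; have hk k : 1 + 2 / 5 * k%:R <= (2 * c) ^+ k.
  elim: k => [|k IHk]; first by rewrite expr0; lra.
  rewrite exprS -natr1; set e := _ ^+ k in IHk *.
  have k0 : 0 <= k%:R :> R by [].
  have e0 : 0 <= e by lra.
  by have : 7 / 5 * e <= 2 * c * e; [apply: ler_wpM2r => //; lra|lra].
set m := Num.truncn `|x|; exists m.+3; have := hk m.+3.
rewrite (_ : m.+3%:R = m.+1%:R + 2 :> R); last by rewrite -natrD addn2.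
have := truncnS_gt `|x|; have := ler_norm x; have := normr_ge0 x.
by rewrite /T -/m; lra.
Qed.

(** Between [T k] and [T k.+1] one has [N x ^+ 2 <= 162 * 2 ^+ k], so the integrand is at most
    [e k]. As [expR (162 / 3000) <= 16 / 15] and [16 / 15 * (3 / 4) = 4 / 5], layer [k] contributes
    at most [(4 / 5) ^ (2 ^ k) <= (4 / 5) ^ k.+1]; these sum to at most 4, and the part below [T 0]
    accounts for the remaining 2. *)
Lemma gaussian_fernique :
  (\int[gam]_x (expR (N x ^+ 2 / 3000))%:E <= 6%:E)%E.
Proof.
pose e k : R := expR (162 / 3000 * 2 ^+ k).
have mind k : measurable_fun setT
    (fun x => (e k * \1_[set x : V | T k < N x] x)%:E).
  apply/measurable_EFinP; apply: measurable_funM => //.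
  by apply: measurable_indic; exact: measurable_seminorm_gt.
have ind0 k x : (0 <= (e k * \1_[set x : V | T k < N x] x)%:E)%E.
  by rewrite lee_fin mulr_ge0 ?expR_ge0.
have e1 : expR (162 / 3000) <= 16 / 15 :> R.
  have := @expR_ge1Dx R (- (162 / 3000)); rewrite expRN => h.
  rewrite -[leRHS]invrK -[leLHS]invrK lef_pV2 ?posrE ?invr_gt0 ?expR_gt0//.
  by apply: le_trans h; lra.
apply: (@le_trans _ _ (\int[gam]_x (2%:E +
    \sum_(0 <= k <oo) (e k * \1_[set x : V | T k < N x] x)%:E))%E).
  apply: ge0_le_integral.
  - exact: measurableT.
  - by move=> x _; rewrite lee_fin expR_ge0.
  - apply: measurable_expE; apply: measurable_funM; last exact: measurable_cst.
    by apply: measurable_funX; exact: measurable_seminormE.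
  - apply: emeasurable_funD; first exact: measurable_cst.
    by apply: ge0_emeasurable_sum => // k x _ _; exact: ind0.
  move=> x _; have N0 := seminorm_ge0 hN x.
  have [k0 k0P kmin] := ex_minnP (T_cofinal (N x)).
  have NT : N x ^+ 2 <= 81 * 2 ^+ k0.
    have h : N x <= 9 * (2 * c) ^+ k0 by move: k0P; rewrite /T; lra.
    apply: (@le_trans _ _ ((9 * (2 * c) ^+ k0) ^+ 2)).
      by rewrite lerXn2r// nnegrE// (le_trans N0).
    rewrite exprMn (_ : ((2 * c) ^+ k0) ^+ 2 = 2 ^+ k0); first by lra.
    by rewrite exprAC (_ : (2 * c) ^+ 2 = 2)// exprMn cE; lra.
  case: k0 => [|k] in k0P kmin NT *.
    apply: (@le_trans _ _ 2%:E); last by rewrite leeDl// nneseries_ge0.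
    rewrite lee_fin (@le_trans _ _ (expR (162 / 3000)))//; last by lra.
    by rewrite ler_expR; move: NT; rewrite expr0; lra.
  have kT : T k < N x.
    by rewrite ltNge; apply/negP => /kmin; rewrite ltnn.
  apply: (@le_trans _ _ (e k)%:E).
    rewrite lee_fin ler_expR; move: NT; rewrite (exprS 2 k); lra.
  apply: (@le_trans _ _ (\sum_(0 <= i <oo) (e i * \1_[set x : V | T i < N x] x)%:E)%E).
    apply: le_trans (nneseries_lim_ge k.+1 _) => //.
    rewrite big_nat_recr//= indicE mem_set// mulr1 leeDr//.
    by rewrite sume_ge0.
  by rewrite leeDr// lee_fin.
have msum : measurable_fun setT (fun x : V =>
    \sum_(0 <= k <oo) (e k * \1_[set x : V | T k < N x] x)%:E)%E.
  by apply: ge0_emeasurable_sum => // k x _ _; exact: ind0.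
rewrite (ge0_integralD _ measurableT _ (measurable_cst _) _ msum); last 2 first.
- by move=> x _; rewrite lee_fin.
- by move=> x _; apply: nneseries_ge0 => k _ _; exact: ind0.
rewrite (integral_cst _ measurableT) [X in (_ * X)%E]probability_setT mule1.
rewrite (integral_nneseries _ measurableT mind (fun k x _ => ind0 k x)).
rewrite (_ : 6%:E = 2%:E + 4%:E :> \bar R)%E; last by rewrite -EFinD; congr EFin; lra.
apply: leeD => //; apply: lime_le.
  by apply: is_cvg_nneseries => k _ _; apply: integral_ge0 => x _; exact: ind0.
apply: nearW => m.
have em k : (\int[gam]_x (e k * \1_[set x : V | T k < N x] x)%:E <= ((4 / 5) ^+ k.+1)%:E)%E.
  under eq_integral do rewrite EFinM.
  rewrite ge0_integralZl_EFin//; last 2 first.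
  - by apply/measurable_EFinP/measurable_indic; exact: measurable_seminorm_gt.
  - exact: expR_ge0.
  rewrite integral_indic//; last exact: measurable_seminorm_gt.
  rewrite setIT [X in (_ * X)%E]PE; last exact: measurable_seminorm_gt.
  rewrite -EFinM lee_fin.
  apply: (@le_trans _ _ ((4 / 5) ^+ (2 ^ k))); last first.
    by apply: ler_wiXn2l; [lra|lra|exact: ltn_expl].
  apply: (@le_trans _ _ ((16 / 15) ^+ (2 ^ k) * (3 / 4) ^+ (2 ^ k))).
    apply: ler_pM => //; first exact: expR_ge0.
    - by rewrite /P fine_ge0.
    - rewrite /e -natrX expRM_natr lerXn2r// nnegrE ?expR_ge0//.
    - apply: le_trans (tail k) _; have /andP[_ p1] := p_bnd.
      by rewrite -[leRHS]mul1r; apply: ler_wpM2r => //; exact: exprn_ge0.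
  by rewrite -exprMn (_ : 16 / 15 * (3 / 4) = 4 / 5 :> R)//; lra.
apply: (@le_trans _ _ (\sum_(0 <= k < m) ((4 / 5) ^+ k.+1)%:E)%E).
  by apply: lee_sum => k _; exact: em.
rewrite sumEFin lee_fin.
suff -> : \sum_(0 <= k < m) (4 / 5) ^+ k.+1 = 4 - 4 * (4 / 5) ^+ m :> R.
  by rewrite gerBl mulr_ge0// exprn_ge0.
elim: m => [|m IHm]; first by rewrite big_geq// expr0; lra.
by rewrite big_nat_recr//= IHm !exprS; lra.
Qed.

End fernique.

(** * Convex domination of the self-balancing walk *)

Section normal_noise.
Local Open Scope ereal_scope.
Context {R : realType}.
Notation nu := (@normal_prob R 0 1).

Lemma ge0_integral_normalN (f : R -> \bar R) :
  measurable_fun setT f -> (forall x, 0 <= f x) ->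
  \int[nu]_x f (- x)%R = \int[nu]_x f x.
Proof.
move=> mf f0.
have mN : measurable_fun [set: measurableTypeR R] (-%R : R -> measurableTypeR R).
  exact: oppr_measurable.
have mfN : measurable_fun setT (fun x : R => f (- x)%R) by exact: measurableT_comp.
have mpdf : measurable_fun setT (fun x => (@normal_pdf R 0 1 x)%:E).
  by apply/measurable_EFinP; exact: measurable_normal_pdf.
have pdf0 x : 0 <= (@normal_pdf R 0 1 x)%:E by rewrite lee_fin normal_pdf_ge0.
rewrite (ge0_integral_normal_prob _ _ mfN (fun _ => f0 _)).
rewrite (ge0_integral_normal_prob _ _ mf f0).
transitivity (\int[pushforward lebesgue_measure (-%R : R -> measurableTypeR R)]_x
    (f x * (normal_pdf 0 1 x)%:E)); last first.
  by apply: eq_measure_integral => A mA _; exact: lebesgue_measureN.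
have mfpdf := emeasurable_funM mf mpdf.
rewrite (@ge0_integral_pushforward _ _ (measurableTypeR R) (measurableTypeR R) _
  _ mN _ _ _ measurableT mfpdf); last by move=> x _; exact: mule_ge0.
apply: eq_integral => x _; congr (_ * _%:E).
by rewrite !normal_pdfE ?oner_eq0// /normal_fun !subr0 sqrrN.
Qed.

Let I : set R := `](- (1 / 2))%R, (1 / 2)%R[%classic.

Let mI : measurable I. Proof. exact: measurable_itv. Qed.

(** The interval has length 1 and the density is at most [1 / sqrt (2 pi) <= 1 / 2]. *)
Let normal_I : nu I <= (1 / 2)%:E.
Proof.
rewrite /normal_prob.
apply: (@le_trans _ _ (\int[lebesgue_measure]_(x in I) (cst (1 / 2)%:E x))).
  apply: ge0_le_integral => //.
  - by move=> x _; rewrite lee_fin normal_pdf_ge0.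
  - apply/measurable_EFinP; apply: measurable_funTS; exact: measurable_normal_pdf.
  move=> x _; rewrite lee_fin; apply: le_trans (normal_pdf_ub _ _ _) _.
    by rewrite oner_eq0.
  rewrite /normal_peak expr1n mul1r div1r lef_pV2 ?posrE//; last first.
    by rewrite sqrtr_gt0 mulrn_wgt0// pi_gt0.
  rewrite -[leLHS]ger0_norm// -sqrtr_sqr ler_sqrt; last first.
    by rewrite mulrn_wge0// pi_ge0.
  by have := pi_ge2 R; rewrite -mulr_natr; lra.
have -> : (\int[lebesgue_measure]_(x in I) (cst (1 / 2)%:E x)) =
    (1 / 2)%:E * lebesgue_measure I by exact: integral_cst.
rewrite /I lebesgue_measure_itv/= lte_fin ifT; last by lra.
by rewrite -EFinD -EFinM lee_fin; lra.
Qed.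

Lemma normal_prob_spread : (1 / 2)%:E <= nu (~` I).
Proof.
rewrite probability_setC// leeBrDr; last by rewrite fin_num_measure.
apply: (@le_trans _ _ ((1 / 2)%:E + (1 / 2)%:E)); first exact: leeD2l.
by rewrite -EFinD lee_fin; lra.
Qed.

(** Infinite values are allowed, since Gaussian averages of a convex function may diverge. *)
Definition econvex {V : lmodType R} (f : V -> \bar R) := forall (t : R) x y,
  (0 <= t <= 1)%R ->
  f (t *: x + (1 - t) *: y)%R <= t%:E * f x + (1 - t)%:E * f y.

Lemma econvex_mean {V : lmodType R} (f : V -> \bar R) (m r u w : V) (t : R) :
  econvex f -> (0 <= t <= 1)%R -> (m = t *: u + (1 - t) *: w)%R ->
  f m <= t%:E * f u + (1 - t)%:E * f w.
Proof. by move=> cf t01 ->; exact: cf. Qed.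

(* Convexity on the segment from [x - r v] to [x + r v], with [r >= 2]. *)
Let chord {V : lmodType R} (f : V -> \bar R) x v (r : R) :
  (forall x, 0 <= f x) -> econvex f -> (2 <= `|r|)%R ->
  2%:E * f (x + v)%R + 2%:E * f (x - v)%R <=
  f (x + r *: v)%R + f (x - r *: v)%R + 2%:E * f x.
Proof.
move=> f0 cf; wlog r2 : r / (2 <= r)%R => [hw|_].
  have [r0|r0] := leP 0%R r; first by rewrite ger0_norm// => h; apply: hw; rewrite ?ger0_norm.
  rewrite ltr0_norm// => h; have := hw _ h; rewrite ger0_norm; last by lra.
  by rewrite !scaleNr opprK (addeC (f (x - _)%R)); exact.
have r0 : (r != 0)%R by lra.
have ir : (0 <= r^-1 <= 1 / 2)%R.
  by rewrite invr_ge0 div1r lef_pV2 ?posrE; [apply/andP; split; lra|lra|lra].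
have ir1 : (0 <= r^-1 <= 1)%R by lra.
have h1 : f (x + v)%R <= (r^-1)%:E * f (x + r *: v)%R + (1 - r^-1)%:E * f x.
  apply: econvex_mean => //; rewrite scalerDr scalerA mulVf// scale1r addrAC.
  by rewrite -scalerDl addrCA subrr addr0 scale1r.
have h2 : f (x - v)%R <= (r^-1)%:E * f (x - r *: v)%R + (1 - r^-1)%:E * f x.
  apply: econvex_mean => //; rewrite scalerBr scalerA mulVf// scale1r addrAC.
  by rewrite -scalerDl addrCA subrr addr0 scale1r.
have h3 : f x <= (1 / 2)%:E * f (x + r *: v)%R + (1 - 1 / 2)%:E * f (x - r *: v)%R.
  apply: econvex_mean => //; first by lra.
  rewrite (_ : 1 - 1 / 2 = 1 / 2 :> R)%R; last by lra.
  rewrite -scalerDr addrACA subrr addr0 scalerDr -scalerDl.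
  by rewrite (_ : 1 / 2 + 1 / 2 = 1 :> R)%R ?scale1r//; lra.
move: h1 h2 h3 (f0 (x + v)%R) (f0 (x - v)%R) (f0 (x + r *: v)%R) (f0 (x - r *: v)%R) (f0 x).
have y2 : 2%:E * +oo = +oo :> \bar R by rewrite mulry gtr0_sg ?mul1e.
case: (f (x + r *: v)%R) (f (x - r *: v)%R) (f x) => [a| |] [b| |] [m| |]//;
  rewrite ?y2 ?(addeC (_ + _) +oo) ?(addeC _ +oo) ?addye//; try by move=> *; rewrite leey.
case: (f (x + v)%R) (f (x - v)%R) => [u| |] [w| |]//=;
  rewrite -?EFinM -?EFinD ?lee_fin//.
move=> h1 h2 h3 u0 w0 a0 b0 m0; set i := r^-1%R in ir h1 h2 *.
have : (i * (a + b - 2 * m) <= (1 / 2) * (a + b - 2 * m))%R.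
  by apply: ler_wpM2r; lra.
lra.
Qed.

(** A fair sign is dominated by a Gaussian of standard deviation at least 4. Pair [g] with [- g]:
    midpoint convexity always gives [2 f(x) <= h g + k g], and when [|g| >= 1 / 2], which has mass
    at least 1/2, [|s g| >= 2] and the chord bound gives [2 S - 2 f(x) <= h g + k g], where [S] is
    the left-hand side. Averaging the two bounds yields [S]. *)
Lemma normal_noise_dominates {V : lmodType R} (f : V -> \bar R) x v (s : R) :
  (forall x, 0 <= f x) -> econvex f ->
  measurable_fun setT (fun g : R => f (x + (s * g) *: v)%R) -> (4 <= s)%R ->
  f (x + v)%R + f (x - v)%R <= 2%:E * \int[nu]_g f (x + (s * g) *: v)%R.
Proof.
move=> f0 cf mfs s4; set J := \int[nu]_g _.
pose h (g : R) := f (x + (s * g) *: v)%R.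
have h0 g : 0 <= h g by exact: f0.
have mh : measurable_fun setT h by [].
pose k (g : R) := h (- g)%R.
have k0 g : 0 <= k g by exact: f0.
have mk : measurable_fun setT k by apply: measurableT_comp => //; exact: oppr_measurable.
have J2 : \int[nu]_g (h g + k g) = J + J.
  rewrite (ge0_integralD nu measurableT (fun g _ => h0 g) mh (fun g _ => k0 g) mk).
  by rewrite (ge0_integral_normalN mh h0).
have mH := emeasurable_funD mh mk.
have kE g : k g = f (x - (s * g) *: v)%R by rewrite /k /h mulrN scaleNr.
rewrite (_ : 2%:E = 1 + 1); last by rewrite -EFinD.
rewrite ge0_muleDl// mul1e -J2.
have half g : f x <= (1 / 2)%:E * h g + (1 - 1 / 2)%:E * k g.
  rewrite kE; apply: econvex_mean => //; first by lra.
  rewrite (_ : 1 - 1 / 2 = 1 / 2 :> R)%R; last by lra.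
  rewrite -scalerDr addrACA subrr addr0 scalerDr -scalerDl.
  by rewrite (_ : 1 / 2 + 1 / 2 = 1 :> R)%R ?scale1r//; lra.
have far g : ~ I g -> 2%:E * f (x + v)%R + 2%:E * f (x - v)%R <=
    h g + k g + 2%:E * f x.
  move=> Ig; rewrite kE; apply: chord => //.
  rewrite normrM ger0_norm; last by lra.
  have : (1 / 2 <= `|g|)%R.
    rewrite leNgt; apply/negP; rewrite ltr_norml => /andP[g1 g2].
    by apply: Ig; rewrite /I /= in_itv/= g1 g2.
  by move=> ?; nra.
(* Comparing with every real [r] below the sum also covers the case where the sum is infinite. *)
suff key (r : R) : r%:E <= f (x + v)%R + f (x - v)%R -> r%:E <= \int[nu]_g (h g + k g).
  case E : (f (x + v)%R + f (x - v)%R) => [r| |].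
  - by apply: key; rewrite E.
  - by rewrite leye_eq; apply/eqP/eq_infty => r; apply: key; rewrite E leey.
  - by rewrite leNye.
move=> rS; have := f0 x; case E : (f x) => [m| |]// m0; last first.
  apply: (@le_trans _ _ (\int[nu]_g cst +oo g)).
    rewrite integral_cst//; rewrite [X in _ <= _ * X]probability_setT mule1 leey//.
  apply: ge0_le_integral => //.
  move=> g _ /=; have := half g; rewrite E; have := h0 g; have := k0 g.
  by case: (h g) (k g) => [a| |] [b| |]//=; rewrite -!EFinM -EFinD.
(* [D] is the gain of the chord bound over the midpoint bound [2 m]; as it is nonnegative, the lower
   estimate 1/2 for the mass of the far set may be used: [2 m + D / 2 >= r]. *)
pose D := Num.max 0%R (2 * r - 4 * m)%R.
have D0 : (0 <= D)%R by rewrite /D le_max lexx.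
have DE : (2 * r - 4 * m <= D)%R by rewrite /D le_max lexx orbT.
have mI' : measurable (~` I) by exact: measurableC.
have mDI : measurable_fun setT (fun g => (D * \1_(~` I) g)%:E).
  by apply/measurable_EFinP; apply: measurable_funM => //; exact: measurable_indic.
have DI0 g : 0 <= (D * \1_(~` I) g)%:E by rewrite lee_fin mulr_ge0.
have m20 : 0 <= (2 * m)%:E by rewrite lee_fin mulr_ge0.
apply: (@le_trans _ _ (\int[nu]_g ((cst (2 * m)%:E g) + (D * \1_(~` I) g)%:E))).
  rewrite (ge0_integralD nu measurableT (fun _ _ => m20) (measurable_cst _) (fun g _ => DI0 g) mDI).
  under [X in _ <= _ + X]eq_integral do rewrite EFinM.
  rewrite [X in _ <= _ + X]ge0_integralZl_EFin//; last exact/measurable_EFinP/measurable_indic.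
  rewrite integral_indic// setIT (integral_cst _ measurableT).
  rewrite [X in _ <= _ * X + _]probability_setT mule1.
  apply: (@le_trans _ _ ((2 * m)%:E + D%:E * (1 / 2)%:E)).
    by rewrite -EFinM -EFinD lee_fin; lra.
  by apply: leeD2l; apply: lee_wpmul2l => //; exact: normal_prob_spread.
apply: ge0_le_integral => //.
- by move=> g _; rewrite adde_ge0.
- by apply: emeasurable_funD => //; exact: measurable_cst.
move=> g _; rewrite -EFinD indicE.
have := half g; have := @far g; rewrite E; have := h0 g; have := k0 g.
have := f0 (x + v)%R; have := f0 (x - v)%R; move: rS.
have [/set_mem gI|gI] := boolP (g \in ~` I).
  have y2 : 2%:E * +oo = +oo :> \bar R by rewrite mulry gtr0_sg ?mul1e.
  move=> rS' w0 u0 b0 a0 /(_ gI) hf hh; move: rS' w0 u0 b0 a0 hf hh.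
  case: (h g) (k g) (f (x + v)%R) (f (x - v)%R) => [a| |] [b| |] [u| |] [w| |]//=;
    rewrite ?y2 -?EFinM -?EFinD ?lee_fin ?leey//=.
  rewrite mulr1 /D; case: (leP 0%R (2 * r - 4 * m)%R) => ?; lra.
move=> _ _ _ + + _.
case: (h g) (k g) => [a| |] [b| |]//=; rewrite -?EFinM -?EFinD ?lee_fin ?leey//.
by rewrite mulr0; lra.
Qed.

End normal_noise.

(** * Rows of independent seeds *)

Section iid_rows.
Context d (T : measurableType d) (R : realType).

Definition row_cat n (x : T * 'rV[T]_n) : 'rV[T]_n.+1 :=
  \row_i (if unlift ord0 i is Some j then x.2 ord0 j else x.1).

Lemma measurable_row_cat n : measurable_fun setT (@row_cat n).
Proof.
apply: measurable_fun_row => i; case: (unliftP ord0 i) => [j|] ->.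
- have -> : (fun x => row_cat x ord0 (lift ord0 j)) =
            (fun v : 'rV[T]_n => v ord0 j) \o snd.
    by apply/funext => x; rewrite /row_cat mxE liftK.
  by apply: measurableT_comp; [exact: measurable_row_coord|exact: measurable_snd].
- have -> : (fun x => @row_cat n x ord0 ord0) = fst.
    by apply/funext => x; rewrite /row_cat mxE unlift_none.
  exact: measurable_fst.
Qed.

HB.instance Definition _ n :=
  isMeasurableFun.Build _ _ _ _ (@row_cat n) (@measurable_row_cat n).

(** Total in [t], so that walks and trees can read their seeds as sequences on [nat]; the value past
    the end of the row is [point]. *)
Definition entry n (u : 'rV[T]_n) (t : nat) : T :=
  if insub t is Some i then u ord0 i else point.

Lemma entry0 n x (u : 'rV[T]_n) : entry (row_cat (x, u)) 0 = x.
Proof.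
rewrite /entry; case: insubP => [i _ i0|]//.
by rewrite (_ : i = ord0) ?mxE ?unlift_none//; exact: val_inj.
Qed.

Lemma entryS n x (u : 'rV[T]_n) t : entry (row_cat (x, u)) t.+1 = entry u t.
Proof.
rewrite /entry; case: insubP => [i _ it|]; case: insubP => [j _ jt|].
- rewrite (_ : i = lift ord0 j) ?mxE ?liftK//.
  by apply: val_inj; rewrite /= it jt.
- by rewrite -ltnS -it ltn_ord.
- by rewrite -leqNgt ltnS leqNgt -jt ltn_ord.
- by [].
Qed.

Lemma measurable_entry n t : measurable_fun setT (fun u : 'rV[T]_n => entry u t).
Proof.
rewrite /entry; case: insubP => [i _ _|_]; last exact: measurable_cst.
exact: measurable_row_coord.
Qed.

Variable mu : probability T R.

(** Used at two levels: a row of uniform numbers drives one walk through time, and a row of such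
    rows supplies one walk seed per level of the tree. *)
Fixpoint iid_row n : probability 'rV[T]_n R :=
  if n is m.+1 then distribution (mu \x iid_row m)%E (@row_cat m)
  else dirac (const_mx point : 'rV[T]_0).

Local Open Scope ereal_scope.

Lemma ge0_integral_iid_rowS n (f : 'rV[T]_n.+1 -> \bar R) :
  measurable_fun setT f -> (forall x, 0 <= f x) ->
  \int[iid_row n.+1]_x f x = \int[mu]_x \int[iid_row n]_y f (row_cat (x, y)).
Proof.
move=> mf f0; rewrite /= ge0_integral_distribution//.
have mfc : measurable_fun setT (f \o @row_cat n).
  exact: (measurableT_comp mf (@measurable_row_cat n)).
by rewrite (@fubini_tonelli1 _ _ _ _ _ mu (iid_row n) _ mfc)// => z; exact: f0.
Qed.

Lemma integral_probability_cst d' (S : measurableType d') (P : probability S R)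
  (a : \bar R) : \int[P]_x cst a x = a.
Proof. by rewrite integral_cst// -[RHS]mule1; congr (_ * _); exact: probability_setT. Qed.

End iid_rows.

Section uniform_seed.
Context {R : realType}.

Definition unif : probability (measurableTypeR R) R := uniform_prob (@ltr01 R).

Local Open Scope ereal_scope.

Lemma unif_lt (p : R) : (0 <= p <= 1)%R -> unif [set u | (u < p)%R] = p%:E.
Proof.
move=> /andP[p0 p1]; have mA : measurable ([set u | u < p]%R : set (measurableTypeR R)).
  by rewrite -set_itvNyo; exact: measurable_itv.
have mi : measurable_fun setT (fun u : measurableTypeR R => (\1_[set u | u < p]%R u : R)%:E).
  by apply/measurable_EFinP; exact: measurable_indic.
rewrite -[X in unif X]setIT -integral_indic//.
rewrite (integral_uniform ltr01 mi (fun _ => _)); last by move=> x; rewrite lee_fin.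
rewrite subr0 invr1 mul1e integral_indic//.
rewrite (_ : _ `&` _ = `[0%R, p[%classic).
  apply: etrans (lebesgue_measure_itv _) _; rewrite /= lte_fin oppr0 adde0.
  by move: p0; rewrite le_eqVlt => /predU1P[<-|->]//; rewrite ltxx.
apply/seteqP; split => x /=; rewrite !in_itv/=.
  by move=> [-> /andP[->]].
by move=> /andP[-> xp]; rewrite xp (le_trans (ltW xp)).
Qed.

Lemma integral_unif_if (p : R) (a b : \bar R) : (0 <= p <= 1)%R ->
  0 <= a -> 0 <= b ->
  \int[unif]_u (if (u < p)%R then a else b) = p%:E * a + (1 - p)%:E * b.
Proof.
move=> p01 a0 b0; have mA : measurable ([set u | u < p]%R : set (measurableTypeR R)).
  by rewrite -set_itvNyo; exact: measurable_itv.
have mAC := measurableC mA.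
pose A := [set u : R | (u < p)%R].
transitivity (\int[unif]_u (a * (\1_A u)%:E + b * (\1_(~` A) u)%:E)).
  apply: eq_integral => u _; rewrite !indicE.
  have [up|pu] := ltP u p.
    by rewrite mem_set//= memNset ?mule0 ?mule1 ?adde0//= => /(_ up).
  by rewrite memNset ?mem_set/= ?mule0 ?mule1 ?add0e//=; apply/negP; rewrite -leNgt.
have mi (E : set (measurableTypeR R)) : measurable E ->
  measurable_fun setT (fun u => (\1_E u : R)%:E).
  by move=> mE; apply/measurable_EFinP; exact: measurable_indic.
have i0 (E : set (measurableTypeR R)) u : 0 <= (\1_E u : R)%:E by rewrite lee_fin.
rewrite (ge0_integralD unif measurableT (fun u _ => mule_ge0 a0 (i0 A u))
  (measurable_funeM _ (mi _ mA)) (fun u _ => mule_ge0 b0 (i0 (~` A) u))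
  (measurable_funeM _ (mi _ mAC))).
rewrite (ge0_integralZl unif measurableT (mi _ mA) (fun u _ => i0 A u) a0).
rewrite (ge0_integralZl unif measurableT (mi _ mAC) (fun u _ => i0 (~` A) u) b0).
rewrite !integral_indic// !setIT muleC (muleC b); congr (_ * _ + _ * _).
  exact: unif_lt.
by rewrite EFinB -(unif_lt p01); exact: probability_setC.
Qed.

End uniform_seed.

(** * The self-balancing walk and its Gaussian majorant *)

Section walk.
Context {R : realType} {n : nat}.
Notation V := 'rV[R]_n.
Variables (sigma p : R).
Hypotheses (sigma4 : 4 <= sigma) (p01 : 1 / 5 <= p <= 4 / 5).
Implicit Types (x y v : V) (u : R).

(** For [a = (4 / sigma) v] this is [(4 / sigma)^2] times the factor [2 / (1 + |a|^2)] of
    [gaussian_reflection], that is, the pull of the reflection scaled by [sigma]. *)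
Definition pull_rate v : R := 2 * (4 / sigma) ^+ 2 / (1 + (4 / sigma) ^+ 2 * dot v v).
Definition pull y v : R := pull_rate v * dot y v.
Definition goes_left y v u : bool := u < p - pull y v.

(* When the pull is too strong to be realized by the bias of a coin, the
   idealized walk performs the mean step; on the good event this never happens. *)
Definition walk_step y v u : V :=
  if `|pull y v| <= 1 / 5 then
    if goes_left y v u then y + (1 - p) *: v else y + (- p) *: v
  else y + (- pull y v) *: v.

Fixpoint walk (y0 : V) (vs : nat -> V) (us : nat -> R) (t : nat) : V :=
  if t is s.+1 then walk_step (walk y0 vs us s) (vs s) (us s) else y0.

Lemma walkS_head y0 vs us t : walk y0 vs us t.+1 =
  walk (walk_step y0 (vs 0%N) (us 0%N)) (vs \o S) (us \o S) t.
Proof. by elim: t => //= t ->. Qed.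

Lemma eq_walk y0 vs us vs' us' t : (forall s, (s < t)%N -> vs s = vs' s) ->
  (forall s, (s < t)%N -> us s = us' s) -> walk y0 vs us t = walk y0 vs' us' t.
Proof.
elim: t => //= t IHt hv hu; rewrite IHt ?hv ?hu// => s st.
- by rewrite hv// ltnW.
- by rewrite hu// ltnW.
Qed.

Let lam_ge0 : 0 <= (4 / sigma) ^+ 2. Proof. exact: sqr_ge0. Qed.
Let den_gt0 v : 0 < 1 + (4 / sigma) ^+ 2 * dot v v.
Proof. by rewrite ltr_pwDl// mulr_ge0// dot_ge0. Qed.

Section measurability.
Context d (Z : measurableType d).

Lemma measurable_pull (y v : Z -> V) : measurable_fun setT y ->
  measurable_fun setT v -> measurable_fun setT (fun z => pull (y z) (v z)).
Proof.
move=> my mv; apply: measurable_funM; last exact: measurable_fun_dot.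
apply: measurable_funM; first exact: measurable_cst.
have -> : (fun z => (1 + (4 / sigma) ^+ 2 * dot (v z) (v z))^-1) =
    (fun z => expR (- ln (1 + (4 / sigma) ^+ 2 * dot (v z) (v z)))).
  by apply/funext => z; rewrite expRN lnK// posrE.
apply: measurableT_comp => //; apply: measurableT_comp; first exact: oppr_measurable.
apply: measurableT_comp; first exact: measurable_ln.
apply: measurable_funD; first exact: measurable_cst.
by apply: measurable_funM; [exact: measurable_cst|exact: measurable_fun_dot].
Qed.

Lemma measurable_goes_left (y v : Z -> V) (u : Z -> R) : measurable_fun setT y ->
  measurable_fun setT v -> measurable_fun setT u ->
  measurable_fun setT (fun z => goes_left (y z) (v z) (u z)).
Proof.
move=> my mv mu; apply: measurable_fun_ltr => //; apply: measurable_funB => //.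
exact: measurable_pull.
Qed.

Lemma measurable_walk_step (y v : Z -> V) (u : Z -> R) : measurable_fun setT y ->
  measurable_fun setT v -> measurable_fun setT u ->
  measurable_fun setT (fun z => walk_step (y z) (v z) (u z)).
Proof.
move=> my mv mu; have mpull := measurable_pull my mv.
apply: measurable_fun_ifT; last first.
- apply: measurable_fun_rowD => //; apply: measurable_fun_rowZ => //.
  by apply: measurableT_comp => //; exact: oppr_measurable.
- apply: measurable_fun_ifT; first exact: measurable_goes_left.
  + by apply: measurable_fun_rowD => //; apply: measurable_fun_rowZ => //; exact: measurable_cst.
  + by apply: measurable_fun_rowD => //; apply: measurable_fun_rowZ => //; exact: measurable_cst.
apply: measurable_fun_ler; last exact: measurable_cst.
by apply: measurableT_comp => //; exact: normr_measurable.
Qed.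

Lemma measurable_walk (y0 : Z -> V) (vs : Z -> nat -> V) (us : Z -> nat -> R) t :
  measurable_fun setT y0 ->
  (forall s, measurable_fun setT (vs ^~ s)) ->
  (forall s, measurable_fun setT (us ^~ s)) ->
  measurable_fun setT (fun z => walk (y0 z) (vs z) (us z) t).
Proof.
by move=> my mvs mus; elim: t => //= t IHt; exact: measurable_walk_step.
Qed.

End measurability.

(** The noise of the same scaled reflection. It is at least 4, as [normal_noise_dominates] demands,
    when [sigma >= 4] and [|v| <= 1]: the denominator is then at most 2. *)
Definition noise_rate v : R := 8 / (1 + (4 / sigma) ^+ 2 * dot v v).

Local Open Scope ereal_scope.

(* The Gaussian transition dominating a step of the walk in the convex order. *)
Definition gaussian_step v (f : V -> \bar R) y : \bar R :=
  \int[normal_prob 0 1]_g f (y + (- pull y v) *: v + (noise_rate v * g) *: v)%R.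

Lemma enorm_dot v : (enorm v <= 1)%R -> (dot v v <= 1)%R.
Proof.
by move=> v1; rewrite -(sqr_sqrtr (dot_ge0 v)) exprn_ile1// ?sqrtr_ge0.
Qed.

Let sigma_gt0 : (0 < sigma)%R. Proof. by apply: lt_le_trans sigma4. Qed.

Let noise_rate_ge4 v : (enorm v <= 1)%R -> (4 <= noise_rate v)%R.
Proof.
move=> /enorm_dot v1; rewrite /noise_rate ler_pdivlMr//.
have : ((4 / sigma) ^+ 2 * dot v v <= 1)%R.
  rewrite mulr_ile1 ?dot_ge0// exprn_ile1//; first by rewrite divr_ge0// ltW.
  by rewrite ler_pdivrMr// mul1r.
by lra.
Qed.

Section convex.
Variable f : V -> \bar R.
Hypotheses (f0 : forall x, 0 <= f x) (cf : econvex f) (mf : measurable_fun setT f).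

Let mline d (Z : measurableType d) (y : Z -> V) v (k : Z -> R) :
  measurable_fun setT y -> measurable_fun setT k ->
  measurable_fun setT (fun z => y z + k z *: v)%R.
Proof.
move=> my mk; apply: measurable_fun_rowD => //.
by apply: measurable_fun_rowZ => //; exact: measurable_cst.
Qed.

Let mpull_cst d (Z : measurableType d) (y : Z -> V) v : measurable_fun setT y ->
  measurable_fun setT (fun z => - pull (y z) v)%R.
Proof.
move=> my; apply: measurableT_comp; first exact: oppr_measurable.
by apply: measurable_pull => //; exact: measurable_cst.
Qed.

Let mint d (Z : measurableType d) (y : Z -> V) (g : Z -> R) v :
  measurable_fun setT y -> measurable_fun setT g ->
  measurable_fun setT
    (fun z => f (y z + (- pull (y z) v) *: v + (noise_rate v * g z) *: v)%R).
Proof.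
move=> my mg; apply: measurableT_comp => //; apply: (mline _ (mline _ my (mpull_cst _ my))).
by apply: measurable_funM => //; exact: measurable_cst.
Qed.

Lemma gaussian_step_ge0 v y : 0 <= gaussian_step v f y.
Proof. by apply: integral_ge0 => g _; exact: f0. Qed.

Lemma measurable_gaussian_step v : measurable_fun setT (gaussian_step v f).
Proof.
have mz : measurable_fun setT (fun z : V * measurableTypeR R =>
    f (z.1 + (- pull z.1 v) *: v + (noise_rate v * z.2) *: v)%R).
  by apply: mint; [exact: measurable_fst|exact: measurable_snd].
exact: (measurable_fun_Tonelli (normal_prob 0 1) mz (fun _ => f0 _)).
Qed.

(** For each [g] the new position is affine in [y]. Preserving convexity is what allows the one-step
    domination to be iterated. *)
Lemma econvex_gaussian_step v : econvex (gaussian_step v f).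
Proof.
move=> t x y t01; have t0 : (0 <= t)%R by lra.
have t1 : (0 <= 1 - t)%R by lra.
have [t0E t1E] : 0 <= t%:E /\ 0 <= (1 - t)%:E by rewrite !lee_fin.
have mx z : measurable_fun setT (fun g : measurableTypeR R =>
    f (z + (- pull z v) *: v + (noise_rate v * g) *: v)%R).
  by apply: mint => //; exact: measurable_cst.
rewrite /gaussian_step.
rewrite -(ge0_integralZl_EFin (normal_prob 0 1) measurableT (fun g _ => f0 _) (mx x) t0).
rewrite -(ge0_integralZl_EFin (normal_prob 0 1) measurableT (fun g _ => f0 _) (mx y) t1).
rewrite -(ge0_integralD (normal_prob 0 1) measurableT
  (fun g _ => mule_ge0 t0E (f0 _)) (measurable_funeM _ (mx x))
  (fun g _ => mule_ge0 t1E (f0 _)) (measurable_funeM _ (mx y))).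
apply: ge0_le_integral.
- exact: measurableT.
- by move=> g _; exact: f0.
- exact: mx.
- by apply: emeasurable_funD; apply: measurable_funeM; exact: mx.
move=> g _; apply: econvex_mean => //; apply/rowP => i.
by rewrite /pull !mxE dotDl !dotZl; ring.
Qed.

(** Around the mean position [x] the walk jumps to [x + (1 - r) v] with probability [r] and to
    [x - r v] otherwise. Each endpoint is a convex combination of [x + v] and [x - v], and the
    averaged weights are 1/2 each because the mean is [x]; so the jump is dominated by a fair sign,
    and the sign by the Gaussian. The idealized mean step, staying at [x], is dominated too. *)
Lemma walk_step_dominated v y : (enorm v <= 1)%R ->
  \int[unif]_u f (walk_step y v u) <= gaussian_step v f y.
Proof.
move=> v1; set x := (y + (- pull y v) *: v)%R.
have my : measurable_fun setT (fun g : R => f (x + (noise_rate v * g) *: v)%R).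
  by apply: (mint (y := cst y)) => //; exact: measurable_cst.
have := normal_noise_dominates f0 cf my (noise_rate_ge4 v1).
rewrite -/(gaussian_step v f y); set J := gaussian_step v f y => hJ.
have J0 : 0 <= J by exact: gaussian_step_ge0.
have {}hJ : (1 / 2)%:E * f (x + v)%R + (1 / 2)%:E * f (x - v)%R <= J.
  rewrite -ge0_muleDr//; apply: (@le_trans _ _ ((1 / 2)%:E * (2%:E * J))).
    by apply: lee_wpmul2l => //; rewrite lee_fin.
  by rewrite muleA -EFinM (_ : 1 / 2 * 2 = 1 :> R)%R ?mul1e//; lra.
have fxv : f x <= (1 / 2)%:E * f (x + v)%R + (1 - 1 / 2)%:E * f (x - v)%R.
  apply: econvex_mean => //; first by lra.
  by apply/rowP => i; rewrite !mxE; lra.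
apply: le_trans _ hJ; have [good|bad] := boolP (`|pull y v| <= 1 / 5)%R; last first.
  have -> : \int[unif]_u f (walk_step y v u) = f x.
    rewrite -[RHS](integral_probability_cst unif (f x)); apply: eq_integral => u _.
    by rewrite /walk_step (negbTE bad).
  apply: le_trans fxv _.
  by rewrite (_ : 1 - 1 / 2 = 1 / 2 :> R)%R//; lra.
have := good; rewrite ler_norml => /andP[d1 d2].
pose r := (p - pull y v)%R.
have r01 : (0 <= r <= 1)%R by rewrite /r; move: p01; lra.
pose A := f (y + (1 - p) *: v)%R; pose B := f (y + (- p) *: v)%R.
rewrite (_ : \int[unif]_u _ = \int[unif]_u (if (u < r)%R then A else B)); last first.
  by apply: eq_integral => u _; rewrite /walk_step good /goes_left; case: ifP.
rewrite integral_unif_if// ?f0//.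
have hA : A <= ((2 - r) / 2)%:E * f (x + v)%R + (1 - (2 - r) / 2)%:E * f (x - v)%R.
  apply: econvex_mean => //; first by lra.
  by apply/rowP => i; rewrite !mxE /r; field.
have hB : B <= ((1 - r) / 2)%:E * f (x + v)%R + (1 - (1 - r) / 2)%:E * f (x - v)%R.
  apply: econvex_mean => //; first by lra.
  by apply/rowP => i; rewrite !mxE /r; field.
have h2 : 0 <= (1 / 2)%:E :> \bar R by rewrite lee_fin.
have := f0 (x + v)%R; have := f0 (x - v)%R; have : 0 <= A by exact: f0.
have : 0 <= B by exact: f0.
move: hA hB; case: (f (x + v)%R) (f (x - v)%R) => [a| |] [b| |]//.
- case: A B => [A'| |] [B'| |]//; rewrite -!EFinM -!EFinD !lee_fin => hA hB ? ? ? ?.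
  have h1 : (r * A' <= r * ((2 - r) / 2 * a + (1 - (2 - r) / 2) * b))%R.
    by apply: ler_wpM2l => //; lra.
  have h3 : ((1 - r) * B' <= (1 - r) * ((1 - r) / 2 * a + (1 - (1 - r) / 2) * b))%R.
    by apply: ler_wpM2l => //; lra.
  by apply: le_trans (lerD h1 h3) _; rewrite le_eqVlt; apply/orP; left; apply/eqP; field.
- by move=> *; rewrite mulry gtr0_sg// mul1e addey// leey.
- by move=> *; rewrite mulry gtr0_sg// mul1e addye// leey.
- by move=> *; rewrite mulry gtr0_sg// mul1e addye// leey.
Qed.

(** Started from [sigma *: x], the transition is [sigma] times the map of [gaussian_reflection] for
    [a = (4 / sigma) v]. *)
Lemma gaussian_step_stationary v :
  \int[gaussian R n]_x gaussian_step v f (sigma *: x)%R =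
  \int[gaussian R n]_x f (sigma *: x)%R.
Proof.
have s0 : sigma != 0%R by rewrite gt_eqF.
have mfs : measurable_fun setT (fun x => f (sigma *: x)%R).
  by apply: measurableT_comp => //; apply: measurable_fun_rowZ => //; exact: measurable_cst.
pose a := ((4 / sigma) *: v)%R.
rewrite -(gaussian_reflection a mfs (fun _ => f0 _)).
have msw : measurable_fun setT (fun z : measurableTypeR R * V =>
    f (sigma *: (z.2 + (2 / (1 + dot a a) * (z.1 - dot z.2 a)) *: a))%R).
  apply: (measurableT_comp mfs); apply: mline; first exact: measurable_snd.
  apply: measurable_funM; first exact: measurable_cst.
  apply: measurable_funB; first exact: measurable_fst.
  by apply: measurable_fun_dot; [exact: measurable_snd|exact: measurable_cst].
rewrite (ge0_integral_swap (normal_prob 0 1) (gaussian R n) msw (fun _ _ => f0 _)).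
apply: eq_integral => x _; apply: eq_integral => g _; congr f.
have h := lt0r_neq0 (den_gt0 v).
apply/rowP => i; rewrite /pull /pull_rate /noise_rate /a !mxE !dotE.
have -> : (1 + 4 / sigma * (4 / sigma * dot v v) = 1 + (4 / sigma) ^+ 2 * dot v v)%R by ring.
set D := (1 + _)%R in h *; set X := dot x v; field.
by rewrite h s0.
Qed.

End convex.
End walk.

(** * Tail bounds for the walk *)

Section walk_tail.
Local Open Scope ereal_scope.
Context {R : realType} {n : nat}.
Notation V := 'rV[R]_n.
Notation gam := (gaussian R n).

(** The rotation with [a = 1] is a quarter turn, whose second component is [- x]. *)
Lemma ge0_integral_gaussianN (f : V -> \bar R) :
  measurable_fun setT f -> (forall x, 0 <= f x) ->
  \int[gam]_x f (- x)%R = \int[gam]_x f x.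
Proof.
move=> mf f0.
have mF : measurable_fun setT (fun z : V * V => f z.2).
  by apply: (measurableT_comp mf); exact: measurable_snd.
have h := gaussian_rotation 1 (F := fun _ y => f y) mF (fun _ _ => f0 _).
transitivity (\int[gam]_x \int[gam]_y
    f (((1 - 1 ^+ 2) / (1 + 1 ^+ 2)) *: y - (2 * 1 / (1 + 1 ^+ 2)) *: x)%R).
  apply: eq_integral => x _; rewrite -[LHS](integral_probability_cst gam).
  apply: eq_integral => y _; congr f.
  by rewrite expr1n subrr mul0r mulr1 divff// scale0r sub0r scale1r.
by rewrite h; exact: (integral_probability_cst gam).
Qed.

Lemma econvex_gaussian_jensen (sigma : R) (f : V -> \bar R) :
  measurable_fun setT f -> (forall x, 0 <= f x) -> econvex f ->
  f 0%R <= \int[gam]_x f (sigma *: x)%R.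
Proof.
move=> mf f0 cf; pose h x := f (sigma *: x)%R; pose k x := h (- x)%R.
have mh : measurable_fun setT h.
  by apply: (measurableT_comp mf); apply: measurable_fun_rowZ => //; exact: measurable_cst.
have mk : measurable_fun setT k.
  have mN : measurable_fun setT (fun x : V => (-1) *: x)%R.
    by apply: measurable_fun_rowZ => //; exact: measurable_cst.
  by rewrite (_ : k = h \o (fun x => (-1) *: x)%R) ?funeqE//;
    [exact: (measurableT_comp mh mN)|move=> x; rewrite /k /= scaleN1r].
have h0 x : 0 <= h x by exact: f0.
have k0 x : 0 <= k x by exact: f0.
have half : (0 <= 1 / 2 :> R)%R by lra.
have halfE : 0 <= (1 / 2)%:E :> \bar R by rewrite lee_fin.
rewrite -[leLHS](integral_probability_cst gam).
apply: (@le_trans _ _ (\int[gam]_x ((1 / 2)%:E * h x + (1 / 2)%:E * k x))).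
  apply: ge0_le_integral.
  - exact: measurableT.
  - by move=> x _; exact: f0.
  - exact: measurable_cst.
  - by apply: emeasurable_funD; exact: measurable_funeM.
  move=> x _; rewrite [X in _ <= _ + X%:E * _](_ : 1 / 2 = 1 - 1 / 2)%R; last by lra.
  rewrite /k /h /=; apply: econvex_mean => //; first by lra.
  by apply/rowP => i; rewrite !mxE; lra.
rewrite (ge0_integralD gam measurableT (fun x _ => mule_ge0 halfE (h0 x))
  (measurable_funeM _ mh) (fun x _ => mule_ge0 halfE (k0 x)) (measurable_funeM _ mk)).
rewrite (ge0_integralZl_EFin gam measurableT (fun x _ => h0 x) mh half).
rewrite (ge0_integralZl_EFin gam measurableT (fun x _ => k0 x) mk half).
rewrite (ge0_integral_gaussianN mh h0) -ge0_muleDl ?lee_fin//.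
by rewrite -EFinD (_ : 1 / 2 + 1 / 2 = 1)%R ?mul1e//; lra.
Qed.

Variables (sigma p : R).
Hypotheses (sigma4 : (4 <= sigma)%R) (p01 : (1 / 5 <= p <= 4 / 5)%R).

(** The value at [y] is the expectation of [f] after [t] Gaussian steps from [y]; the first vector
    is the outermost transition. *)
Fixpoint gaussian_steps (vs : nat -> V) (f : V -> \bar R) (t : nat) : V -> \bar R :=
  if t is s.+1 then gaussian_step sigma (vs 0%N) (gaussian_steps (vs \o S) f s)
  else f.

Notation seed T := (iid_row (@unif R) T).

Section domination.
Variable f : V -> \bar R.
Hypotheses (f0 : forall x, 0 <= f x) (cf : econvex f) (mf : measurable_fun setT f).

Let steps_props vs t : [/\ forall x, 0 <= gaussian_steps vs f t x,
  econvex (gaussian_steps vs f t) & measurable_fun setT (gaussian_steps vs f t)].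
Proof.
elim: t vs => // t IHt vs; have [g0 cg mg] := IHt (vs \o S); split => /=.
- by move=> x; exact: gaussian_step_ge0.
- exact: econvex_gaussian_step.
- exact: measurable_gaussian_step.
Qed.

Let steps_stationary vs t :
  \int[gam]_x gaussian_steps vs f t (sigma *: x)%R = \int[gam]_x f (sigma *: x)%R.
Proof.
elim: t vs => // t IHt vs /=; have [g0 cg mg] := steps_props (vs \o S) t.
by rewrite gaussian_step_stationary.
Qed.

Lemma measurable_walk_seed T t y0 (vs : nat -> V) :
  measurable_fun setT (fun us : 'rV[measurableTypeR R]_T => walk sigma p y0 vs (entry us) t).
Proof.
apply: measurable_walk; first exact: measurable_cst.
- by move=> s; exact: measurable_cst.
- by move=> s; exact: measurable_entry.
Qed.

(** Steps are exchanged from the last one backwards: with the first seed fixed, induction replaces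
    the later steps by Gaussian ones, and the resulting function of the position is convex, so the
    first step can be replaced as well. *)
Let walk_steps T t y0 (vs : nat -> V) :
  (t <= T)%N -> (forall s, (enorm (vs s) <= 1)%R) ->
  \int[seed T]_us f (walk sigma p y0 vs (entry us) t) <= gaussian_steps vs f t y0.
Proof.
elim: t T y0 vs => [|t IHt] T y0 vs tT vs1.
  rewrite le_eqVlt; apply/orP; left; apply/eqP.
  exact: (integral_probability_cst (seed T) (f y0)).
case: T tT => // T tT.
have mw := @measurable_walk_seed T.+1 t.+1 y0 vs.
rewrite ge0_integral_iid_rowS; last 2 first.
- exact: (measurableT_comp mf mw).
- by move=> us; exact: f0.
have [g0 cg mg] := steps_props (vs \o S) t.
apply: le_trans (walk_step_dominated sigma4 p01 g0 cg mg y0 (vs1 0%N)).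
apply: ge0_le_integral.
- exact: measurableT.
- by move=> u _; apply: integral_ge0 => us _; exact: f0.
- pose F (z : measurableTypeR R * 'rV[measurableTypeR R]_T) :=
    f (walk sigma p y0 vs (entry (row_cat z)) t.+1).
  apply: (@measurable_fun_Tonelli _ _ _ _ _ (seed T) F) => [|z]; last exact: f0.
  apply: (measurableT_comp mf); apply: (measurableT_comp mw).
  exact: measurable_row_cat.
- have ms : measurable_fun setT (fun u : measurableTypeR R => walk_step sigma p y0 (vs 0%N) u).
    by apply: measurable_walk_step => //; exact: measurable_cst.
  exact: (measurableT_comp mg ms).
move=> u _; apply: le_trans (IHt T _ (vs \o S) tT (fun s => vs1 s.+1)).
rewrite le_eqVlt; apply/orP; left; apply/eqP; apply: eq_integral => us _.
congr f; rewrite walkS_head entry0; apply: eq_walk => // s _ /=.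
exact: entryS.
Qed.

(** The start 0 is the mean of the stationary law, so Jensen's inequality replaces it by a
    stationary start, which the Gaussian steps leave unchanged. *)
Lemma walk_dominated T t (vs : nat -> V) :
  (t <= T)%N -> (forall s, (enorm (vs s) <= 1)%R) ->
  \int[seed T]_us f (walk sigma p 0 vs (entry us) t) <= \int[gam]_x f (sigma *: x)%R.
Proof.
move=> tT vs1; apply: le_trans (walk_steps 0%R tT vs1) _.
have [g0 cg mg] := steps_props vs t; rewrite -(steps_stationary vs t).
exact: econvex_gaussian_jensen.
Qed.

End domination.

(** Markov's inequality for [expR (N ^+ 2 / (3000 * sigma ^+ 2))]; 6 and 3000 are the constants of
    [gaussian_fernique]. *)
Lemma walk_tail (N : V -> R) T t (vs : nat -> V) (B : R) :
  measurable_seminorm N -> (1 / 2)%:E <= gam [set x : V | (N x <= 1)%R] ->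
  (t <= T)%N -> (forall s, (enorm (vs s) <= 1)%R) -> (0 <= B)%R ->
  seed T [set us | (B < N (walk sigma p 0 vs (entry us) t))%R] <=
    (6 * expR (- (B ^+ 2 / (3000 * sigma ^+ 2))))%:E.
Proof.
move=> hN N1 tT vs1 B0; have sigma0 : (0 < sigma)%R by apply: lt_le_trans sigma4.
have [M M0 ME] : exists2 M : R, (0 < M)%R & 3000%R = M.
  by exists 3000%R; [exact: ltr0n|reflexivity].
rewrite ME; have [q qE] : exists q : R, q = (M * sigma ^+ 2)^-1%R by eexists.
have q0 : (0 <= q)%R by rewrite qE invr_ge0; apply: mulr_ge0; [exact: ltW|exact: sqr_ge0].
have q3000 z : ((sigma * z) ^+ 2 * q = z ^+ 2 / M)%R.
  by rewrite qE; field; rewrite !gt_eqF.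
rewrite -qE; pose f (x : V) : \bar R := (expR (N x ^+ 2 * q))%:E.
have f0 x : 0 <= f x by rewrite lee_fin expR_ge0.
have cf : econvex f.
  move=> a x y /andP[a0 a1]; rewrite /f -!EFinM -EFinD lee_fin.
  have a1' : (0 <= 1 - a)%R by rewrite subr_ge0.
  have Nx := seminorm_ge0 hN x; have Ny := seminorm_ge0 hN y.
  set m := (a * (N x ^+ 2 * q) + (1 - a) * (N y ^+ 2 * q))%R.
  apply: (@le_trans _ _ (expR m)).
    rewrite ler_expR /m !mulrA -mulrDl; apply: ler_wpM2r => //.
    have := seminormD hN (a *: x) ((1 - a) *: y).
    rewrite !(seminormZ hN) !ger0_norm// => h.
    apply: (@le_trans _ _ ((a * N x + (1 - a) * N y) ^+ 2)%R).
      by rewrite lerXn2r// nnegrE ?addr_ge0 ?mulr_ge0 ?(seminorm_ge0 hN).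
    rewrite -subr_ge0 (_ : _ - _ = a * (1 - a) * (N x - N y) ^+ 2)%R; last by ring.
    by apply: mulr_ge0; [exact: mulr_ge0|exact: sqr_ge0].
  set X := (N x ^+ 2 * q)%R in m *; set Y := (N y ^+ 2 * q)%R in m *.
  (* Convexity of [expR], from its tangent line at the mean [m]. *)
  have tangent z : (expR m * (1 + (z - m)) <= expR z)%R.
    have -> : expR z = (expR m * expR (z - m))%R by rewrite -expRD subrKC.
    by apply: ler_wpM2l; [exact: expR_ge0|exact: expR_ge1Dx].
  have hX : (a * (expR m * (1 + (X - m))) <= a * expR X)%R by exact: ler_wpM2l.
  have hY : ((1 - a) * (expR m * (1 + (Y - m))) <= (1 - a) * expR Y)%R by exact: ler_wpM2l.
  apply: le_trans (lerD hX hY); rewrite le_eqVlt; apply/orP; left; apply/eqP.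
  rewrite [RHS](_ : _ = expR m * (1 + (a * X + (1 - a) * Y - m)))%R; last by ring.
  by rewrite -/m subrr addr0 mulr1.
have mf : measurable_fun setT f.
  apply: measurable_expE; apply: measurable_funM; last exact: measurable_cst.
  by apply: measurable_funX; exact: measurable_seminormE.
have mw := @measurable_walk_seed T t 0%R vs.
have mE : measurable [set us : 'rV[measurableTypeR R]_T |
    (B < N (walk sigma p 0 vs (entry us) t))%R].
  have h := mw measurableT _ (measurable_seminorm_gt hN B).
  by rewrite setTI in h; exact: h.
have [c c0 c2] : exists2 c : R, (0 <= c)%R & (c ^+ 2 = 1 / 2)%R.
  by exists (Num.sqrt (1 / 2)); [exact: sqrtr_ge0|rewrite sqr_sqrtr//; lra].
have moment : \int[seed T]_us f (walk sigma p 0 vs (entry us) t) <= 6%:E.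
  apply: le_trans (walk_dominated f0 cf mf tT vs1) _.
  have := gaussian_fernique hN c0 c2 N1; rewrite ME; apply: le_trans.
  rewrite le_eqVlt; apply/orP; left; apply/eqP; apply: eq_integral => x _.
  rewrite /f (seminormZ hN) ger0_norm; last exact: ltW.
  by rewrite q3000.
set b := expR (B ^+ 2 * q).
have b0 : (0 < b)%R by exact: expR_gt0.
rewrite expRN -/b; set P := (X in X <= _).
have Pfin : P = (fine P)%:E by rewrite fineK// fin_num_measure.
rewrite Pfin lee_fin ler_pdivlMr// -lee_fin EFinM -Pfin /P.
rewrite -[X in seed T X]setIT -integral_indic//.
have mi : measurable_fun setT (fun us : 'rV[measurableTypeR R]_T =>
    (\1_[set us | (B < N (walk sigma p 0 vs (entry us) t))%R] us : R)%:E).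
  by apply/measurable_EFinP; exact: measurable_indic.
rewrite muleC -(ge0_integralZl_EFin (seed T) measurableT _ mi (ltW b0)); last first.
  by move=> us _; rewrite lee_fin.
apply: le_trans moment; apply: ge0_le_integral.
- exact: measurableT.
- by move=> us _; rewrite -EFinM lee_fin mulr_ge0// ltW.
- exact: measurable_funeM.
- exact: (measurableT_comp mf mw).
move=> us _; rewrite -EFinM indicE; have [/set_mem/= Bw|_] := boolP (us \in _).
  rewrite mulr1 lee_fin ler_expR; apply: ler_wpM2r => //.
  apply: lerXn2r; rewrite ?nnegrE//; first exact: (seminorm_ge0 hN).
  exact: ltW.
by rewrite mulr0.
Qed.

End walk_tail.

(** * Trees of walks *)

Inductive color_tree (R I : Type) : Type :=
| Leaf of I
| Node of R & color_tree R I & color_tree R I.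
Arguments Leaf {R I}.

Section tree.
Context {R : realType} {I : Type}.
Implicit Types (tr : color_tree R I) (A : pred I).

Fixpoint node_count tr : nat :=
  if tr is Node _ l r then (node_count l + node_count r).+1 else 0.

Fixpoint depth tr : nat :=
  if tr is Node _ l r then (maxn (depth l) (depth r)).+1 else 0.

Fixpoint balanced tr : Prop :=
  if tr is Node p l r then [/\ 1 / 5 <= p <= 4 / 5, balanced l & balanced r]
  else True.

Fixpoint share A tr : R :=
  match tr with
  | Leaf c => (A c)%:R
  | Node p l r => p * share A l + (1 - p) * share A r
  end.

(** A node enters with the factor by which the displacement of its walk affects the total routed to
    the leaves in [A]: sending [y] too much to the left changes that total by
    [(share A l - share A r) *: y]. *)
Fixpoint variation A tr : R :=
  if tr is Node _ l r then
    variation A l + variation A r + `|share A l - share A r|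
  else 0.

End tree.

(** * Routing vectors down a tree *)

Section routing.
Context {R : realType} {n : nat} {I : Type}.
Notation V := 'rV[R]_n.
Variable sigma : R.
Hypothesis sigma4 : 4 <= sigma.
Implicit Types (tr : color_tree R I) (vs : nat -> V) (us : nat -> nat -> R).

Definition turns p vs (u : nat -> R) (t : nat) : bool :=
  goes_left sigma p (walk sigma p 0 vs u t) (vs t) (u t).

Definition masked (b : nat -> bool) vs (t : nat) : V := if b t then vs t else 0.

(* A vector not routed to a subtree is presented to it as [0], so that the
   subtree sees a sequence that does not depend on its own seeds. *)
Fixpoint route tr vs us t : I :=
  match tr with
  | Leaf c => c
  | Node p l r =>
      let b := turns p vs (us 0%N) in
      if b t then route l (masked b vs) (us \o S) t
      else route r (masked (predC b) vs) (us \o S) t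
  end.

Lemma eq_turns p vs vs' u t : (forall s, (s <= t)%N -> vs s = vs' s) ->
  turns p vs u t = turns p vs' u t.
Proof.
move=> h; rewrite /turns h//; congr goes_left.
by apply: eq_walk => // s st; rewrite h// ltnW.
Qed.

(** Causality of the routing, which makes it an online rule. *)
Lemma eq_route tr vs vs' us t : (forall s, (s <= t)%N -> vs s = vs' s) ->
  route tr vs us t = route tr vs' us t.
Proof.
elim: tr vs vs' us => //= p l IHl r IHr vs vs' us h.
have hb s : (s <= t)%N -> turns p vs (us 0%N) s = turns p vs' (us 0%N) s.
  by move=> st; apply: eq_turns => s' s's; apply: h; exact: leq_trans st.
rewrite hb//; case: ifP => _.
  by apply: IHl => s st; rewrite /masked hb// h.
by apply: IHr => s st; rewrite /masked /= hb// h.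
Qed.

Section measurability.
Context d (Z : measurableType d).

Lemma measurable_turns p (vs : Z -> nat -> V) (u : Z -> nat -> R) t :
  (forall s, measurable_fun setT (vs ^~ s)) ->
  (forall s, measurable_fun setT (u ^~ s)) ->
  measurable_fun setT (fun z => turns p (vs z) (u z) t).
Proof.
move=> mvs mu; apply: measurable_goes_left => //.
by apply: measurable_walk => //; exact: measurable_cst.
Qed.

Lemma measurable_masked (b : Z -> nat -> bool) (vs : Z -> nat -> V) :
  (forall t, measurable_fun setT (b ^~ t)) ->
  (forall t, measurable_fun setT (vs ^~ t)) ->
  forall t, measurable_fun setT (fun z => masked (b z) (vs z) t).
Proof. by move=> mb mvs t; apply: measurable_fun_ifT => //; exact: measurable_cst. Qed.

Lemma measurable_route tr (vs : Z -> nat -> V) (us : Z -> nat -> nat -> R) t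
    (Q : set I) :
  (forall s, measurable_fun setT (vs ^~ s)) ->
  (forall k s, measurable_fun setT (fun z => us z k s)) ->
  measurable [set z | Q (route tr (vs z) (us z) t)].
Proof.
elim: tr vs us => [c|p l IHl r IHr] vs us mvs mus /=.
  have [Qc|Qc] := pselect (Q c).
    by rewrite (_ : [set _ | _] = setT)//; apply/seteqP; split.
  by rewrite (_ : [set _ | _] = set0)//; apply/seteqP; split.
pose b z := turns p (vs z) (us z 0%N); pose nb z := predC (b z).
have mb s : measurable_fun setT (b ^~ s) by exact: measurable_turns.
have mnb s : measurable_fun setT (nb ^~ s).
  by apply: (measurableT_comp _ (mb s)); exact: measurable_neg.
have ml := IHl _ (fun z => us z \o S) (measurable_masked mb mvs) (fun k s => mus k.+1 s).
have mr := IHr _ (fun z => us z \o S) (measurable_masked mnb mvs) (fun k s => mus k.+1 s).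
have mB : measurable [set z | b z t].
  by have h := mb t measurableT [set true] Logic.I; rewrite setTI in h; exact: h.
rewrite (_ : [set z | _] =
  ([set z | b z t] `&` [set z | Q (route l (masked (b z) (vs z)) (us z \o S) t)]) `|`
  (~` [set z | b z t] `&` [set z | Q (route r (masked (nb z) (vs z)) (us z \o S) t)])).
  by apply: measurableU; apply: measurableI => //; exact: measurableC.
apply/seteqP; split => z; rewrite /setU /setI /setC /= -/(b z).
  by case: ifPn => bt Qz; [left|right; split => //; exact/negP].
by case: ifPn => bt [[]//|[]//] => /(_ bt).
Qed.

End measurability.

Section good.
Variables (N : V -> R) (B : R) (T : nat).
Hypothesis hN : measurable_seminorm N.

Definition good_walk p vs (u : nat -> R) : Prop :=
  forall t, (t <= T)%N ->
    N (walk sigma p 0 vs u t) <= B /\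
    `|pull sigma (walk sigma p 0 vs u t) (vs t)| <= 1 / 5.

(** Both children read the same seed rows [us \o S], so one row per level suffices. The resulting
    dependence between siblings is harmless, as failures are only added up. *)
Fixpoint good tr vs us : Prop :=
  if tr is Node p l r then
    let b := turns p vs (us 0%N) in
    [/\ good_walk p vs (us 0%N), good l (masked b vs) (us \o S) &
        good r (masked (predC b) vs) (us \o S)]
  else True.

(** The bound on the pull excludes the idealized mean step, so every step adds [(1 - p) v] or
    [- p v] and the position records the excess sent left. *)
Lemma good_walk_sum p vs u t : good_walk p vs u -> (t <= T)%N ->
  \sum_(s < t) masked (turns p vs u) vs s =
  p *: (\sum_(s < t) vs s) + walk sigma p 0 vs u t.
Proof.
move=> gw; elim: t => [|t IHt] tT; first by rewrite !big_ord0 scaler0 addr0.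
rewrite !big_ord_recr/= IHt ?(ltnW tT)// /walk_step.
have [_ ->] := gw _ (ltnW tT).
rewrite /masked -/(turns p vs u t); case: ifP => _; rewrite scalerDr.
  by rewrite scalerBl scale1r; apply/rowP => i; rewrite !mxE; ring.
by rewrite scaleNr; apply/rowP => i; rewrite !mxE; ring.
Qed.

Definition routed_sum (A : pred I) tr vs us t : V :=
  \sum_(s < t | A (route tr vs us s)) vs s.

(** The children receive [p D + y] and [(1 - p) D - y], where [D] is the sum of the vectors entering
    the node. Their own errors are bounded by induction, and the new error is [y] times the
    difference of their shares. *)
Lemma good_discrepancy (A : pred I) tr vs us t : good tr vs us -> (t <= T)%N ->
  N (routed_sum A tr vs us t - share A tr *: \sum_(s < t) vs s) <=
  variation A tr * B.
Proof.
rewrite /routed_sum; elim: tr vs us => [c|p l IHl r IHr] vs us /=.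
  move=> _ _; case: (A c) => /=.
    by rewrite scale1r subrr (seminorm0 hN) mul0r.
  by rewrite big_pred0// scale0r subr0 (seminorm0 hN) mul0r.
move=> [gw gl gr] tT; set b := turns p vs (us 0%N) in gl gr *.
have {IHl}hl := IHl _ _ gl tT; have {IHr}hr := IHr _ _ gr tT.
have sl := good_walk_sum gw tT; rewrite -/b in sl.
set y := walk _ _ _ _ _ _ in sl; set D := \sum_(s < t) vs s in sl *.
have sr : \sum_(s < t) masked (predC b) vs s = (1 - p) *: D - y.
  have : \sum_(s < t) masked b vs s + \sum_(s < t) masked (predC b) vs s = D.
    rewrite -big_split; apply: eq_bigr => s _ /=; rewrite /masked /=.
    by case: (b s); rewrite ?addr0 ?add0r.
  rewrite sl => /(canRL (addKr _)) ->; rewrite scalerBl scale1r.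
  by rewrite opprD addrC addrA.
rewrite sl in hl; rewrite sr in hr.
set dl := \sum_(s < t | A (route l _ _ _)) _ in hl.
set dr := \sum_(s < t | A (route r _ _ _)) _ in hr.
have -> : \sum_(s < t | A (if b s then route l (masked b vs) (us \o S) s
    else route r (masked (predC b) vs) (us \o S) s)) vs s = dl + dr.
  rewrite /dl /dr big_mkcond [\sum_(s < t | A (route l _ _ _)) _]big_mkcond.
  rewrite [\sum_(s < t | A (route r _ _ _)) _]big_mkcond -big_split.
  apply: eq_bigr => s _ /=; rewrite /masked /=.
  by case: (b s); rewrite /= ?if_same ?addr0 ?add0r.
have [Ny _] := gw _ tT; rewrite -/y in Ny.
set a := share A l in hl *; set c := share A r in hr *.
rewrite (_ : _ - _ = (dl - a *: (p *: D + y)) + (dr - c *: ((1 - p) *: D - y))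
    + (a - c) *: y); last by apply/rowP => i; rewrite !mxE; ring.
apply: le_trans (seminormD hN _ _) _; rewrite !mulrDl; apply: lerD.
  by apply: le_trans (seminormD hN _ _) _; exact: lerD.
by rewrite (seminormZ hN) ler_wpM2l.
Qed.

Lemma measurable_good_walk d (Z : measurableType d) p (vs : Z -> nat -> V)
    (u : Z -> nat -> R) :
  (forall s, measurable_fun setT (vs ^~ s)) ->
  (forall s, measurable_fun setT (u ^~ s)) ->
  measurable [set z | good_walk p (vs z) (u z)].
Proof.
move=> mvs mu.
pose E t := [set z | N (walk sigma p 0 (vs z) (u z) t) <= B] `&`
  [set z | `|pull sigma (walk sigma p 0 (vs z) (u z) t) (vs z t)| <= 1 / 5].
have mw t : measurable_fun setT (fun z => walk sigma p 0 (vs z) (u z) t).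
  by apply: measurable_walk => //; exact: measurable_cst.
have mE t : measurable (E t).
  apply: measurableI; rewrite -[X in measurable X]setTI.
    exact: (mw t measurableT _ (measurable_seminorm_le hN B)).
  apply: measurable_fun_le => //.
  apply: measurableT_comp; first exact: normr_measurable.
  exact: measurable_pull.
rewrite (_ : [set z | _] = \bigcap_t (if (t <= T)%N then E t else setT)).
  by apply: bigcapT_measurable => t; case: ifP.
apply/seteqP; split => z /= h t; first by case: ifP => // tT _; exact: h.
by move=> tT; have := h t Logic.I; rewrite tT.
Qed.

Lemma measurable_good d (Z : measurableType d) tr (vs : Z -> nat -> V)
    (us : Z -> nat -> nat -> R) :
  (forall s, measurable_fun setT (vs ^~ s)) ->
  (forall k s, measurable_fun setT (fun z => us z k s)) ->
  measurable [set z | good tr (vs z) (us z)].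
Proof.
elim: tr vs us => [c|p l IHl r IHr] vs us mvs mus /=.
  by rewrite (_ : [set _ | _] = setT)//; apply/seteqP; split.
pose b z := turns p (vs z) (us z 0%N); pose nb z := predC (b z).
have mb s : measurable_fun setT (b ^~ s) by exact: measurable_turns.
have mnb s : measurable_fun setT (nb ^~ s).
  by apply: (measurableT_comp _ (mb s)); exact: measurable_neg.
have ml := IHl _ (fun z => us z \o S) (measurable_masked mb mvs) (fun k s => mus k.+1 s).
have mr := IHr _ (fun z => us z \o S) (measurable_masked mnb mvs) (fun k s => mus k.+1 s).
have mgw := measurable_good_walk p mvs (mus 0%N).
have := measurableI _ _ (measurableI _ _ mgw ml) mr.
congr measurable; apply/seteqP; split => z /=; first by case=> -[].
by case.
Qed.

Notation seed_row := (iid_row (@unif R) T).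

Definition seed_of D (u : 'rV['rV[measurableTypeR R]_T]_D) (k s : nat) : R :=
  entry (entry u k) s.

Lemma measurable_seed_of D k s :
  measurable_fun setT (fun u => @seed_of D u k s).
Proof.
apply: (measurableT_comp (measurable_entry s)); exact: measurable_entry.
Qed.

Variable delta : R.
Hypothesis delta0 : 0 <= delta.
Hypothesis walk_bad : forall p vs, 1 / 5 <= p <= 4 / 5 ->
  (forall s, enorm (vs s) <= 1) ->
  (seed_row [set u | ~ good_walk p vs (entry u)] <= delta%:E)%E.

Let enorm_masked b vs s : (forall s, enorm (vs s) <= 1) -> enorm (masked b vs s) <= 1.
Proof.
by move=> h; rewrite /masked; case: ifP => // _; rewrite /enorm dot0l sqrtr0.
Qed.

(** Fubini over the root row: once it is fixed, the sequences presented to the children are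
    deterministic, so [walk_bad], which is uniform in the sequence, applies below it. Each node
    costs [delta]. *)
Lemma bad_seed_le D tr vs : (depth tr <= D)%N -> balanced tr ->
  (forall s, enorm (vs s) <= 1) ->
  (iid_row seed_row D [set u | ~ good tr vs (seed_of u)]
    <= ((node_count tr)%:R * delta)%:E)%E.
Proof.
elim: tr D vs => [c|p l IHl r IHr] D vs /=.
  move=> _ _ _; rewrite (_ : [set _ | _] = set0) ?measure0 ?mul0r//.
  by apply/seteqP; split => // u /=.
case: D => // D; rewrite ltnS geq_max => /andP[dl dr] [p01 bl br] vs1.
have mgood tr' D' vs' : measurable [set u : 'rV['rV[measurableTypeR R]_T]_D' |
    good tr' vs' (seed_of u)].
  apply: measurable_good => [s|k s]; first exact: measurable_cst.
  exact: measurable_seed_of.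
have mgw : measurable [set u : 'rV[measurableTypeR R]_T | good_walk p vs (entry u)].
  apply: measurable_good_walk => s; first exact: measurable_cst.
  exact: measurable_entry.
pose E := [set u : 'rV['rV[measurableTypeR R]_T]_D.+1 | ~ good (Node p l r) vs (seed_of u)].
have mE : measurable E by apply: measurableC; exact: mgood.
pose W := [set u : 'rV[measurableTypeR R]_T | ~ good_walk p vs (entry u)].
have mW : measurable W by exact: measurableC.
pose k : R := (node_count l)%:R * delta + (node_count r)%:R * delta.
have k0 : 0 <= k by rewrite addr_ge0// mulr_ge0.
have mi d' (S : measurableType d') (G : set S) : measurable G ->
    measurable_fun setT (fun u => (\1_G u : R)%:E).
  by move=> mG; apply/measurable_EFinP; exact: measurable_indic.
have i0 (S : Type) (G : set S) u : (0 <= (\1_G u : R)%:E)%E by rewrite lee_fin.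
have k0E : (0 <= k%:E)%E by rewrite lee_fin.
apply: (@le_trans _ _ (\int[seed_row]_u ((\1_W u)%:E + cst k%:E u))%E); last first.
  rewrite (ge0_integralD seed_row measurableT (fun u _ => i0 _ W u) (mi _ _ _ mW)
    (fun _ _ => k0E) (measurable_cst _)).
  rewrite (integral_probability_cst seed_row) integral_indic// setIT.
  rewrite (_ : (_.+1)%:R * delta = delta + k); last first.
    by rewrite /k -natr1 natrD; ring.
  by rewrite (EFinD delta k); apply: leeD => //; exact: walk_bad.
rewrite -[X in iid_row _ _ X]/E -[X in iid_row _ _ X]setIT -integral_indic//.
rewrite ge0_integral_iid_rowS; [|exact: mi|exact: i0].
apply: ge0_le_integral.
- exact: measurableT.
- by move=> u _; apply: integral_ge0 => us _; exact: i0.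
- pose F (z : 'rV[measurableTypeR R]_T * 'rV['rV[measurableTypeR R]_T]_D) :=
    (\1_E (row_cat z) : R)%:E.
  apply: (@measurable_fun_Tonelli _ _ _ _ _ (iid_row seed_row D) F) => [|z]; last exact: i0.
  apply: (measurableT_comp (mi _ _ _ mE)); exact: measurable_row_cat.
- by apply: emeasurable_funD; [exact: mi|exact: measurable_cst].
move=> u _ /=; pose b := turns p vs (entry u).
have seedS (us : 'rV['rV[measurableTypeR R]_T]_D) : seed_of (row_cat (u, us)) \o S = seed_of us.
  by apply/funext => j; apply/funext => s; rewrite /seed_of /= entryS.
have seed0 (us : 'rV['rV[measurableTypeR R]_T]_D) : seed_of (row_cat (u, us)) 0%N = entry u.
  by apply/funext => s; rewrite /seed_of entry0.
have goodE (us : 'rV['rV[measurableTypeR R]_T]_D) :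
    good (Node p l r) vs (seed_of (row_cat (u, us))) <->
    [/\ good_walk p vs (entry u), good l (masked b vs) (seed_of us) &
        good r (masked (predC b) vs) (seed_of us)].
  by rewrite /= seedS seed0.
have [gw|bw] := pselect (good_walk p vs (entry u)); last first.
  apply: (@le_trans _ _ (\int[iid_row seed_row D]_us cst 1%E us)%E).
    apply: ge0_le_integral.
    - exact: measurableT.
    - by move=> us _; exact: i0.
    - apply: (measurableT_comp (mi _ _ _ mE)).
      exact: (measurableT_comp (@measurable_row_cat _ _ D) (pair1_measurable u)).
    - exact: measurable_cst.
    by move=> us _; rewrite lee_fin indicE; case: (_ \in _).
  rewrite (integral_probability_cst (iid_row seed_row D)) indicE mem_set//.
  by rewrite leeDl.
rewrite indicE memNset//= add0e.
pose El := [set us : 'rV['rV[measurableTypeR R]_T]_D | ~ good l (masked b vs) (seed_of us)].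
pose Er := [set us : 'rV['rV[measurableTypeR R]_T]_D |
  ~ good r (masked (predC b) vs) (seed_of us)].
have mEl : measurable El by apply: measurableC; exact: mgood.
have mEr : measurable Er by apply: measurableC; exact: mgood.
apply: (@le_trans _ _ (\int[iid_row seed_row D]_us ((\1_El us)%:E + (\1_Er us)%:E))%E).
  apply: ge0_le_integral.
  - exact: measurableT.
  - by move=> us _; exact: i0.
  - apply: (measurableT_comp (mi _ _ _ mE)).
    exact: (measurableT_comp (@measurable_row_cat _ _ D) (pair1_measurable u)).
  - by apply: emeasurable_funD; exact: mi.
  move=> us _; rewrite -EFinD lee_fin !indicE.
  have [/set_mem Eu|_] := boolP (_ \in E); last by rewrite addr_ge0.
  have [//|gl] := boolP (us \in El); first by rewrite lerDl.
  have [//|gr] := boolP (us \in Er); first by rewrite lerDr.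
  exfalso; apply: Eu; apply/goodE; split => //.
    by apply: contrapT => h; move/negP: gl; apply; exact/mem_set.
  by apply: contrapT => h; move/negP: gr; apply; exact/mem_set.
rewrite (ge0_integralD (iid_row seed_row D) measurableT (fun w _ => i0 _ El w)
  (mi _ _ _ mEl) (fun w _ => i0 _ Er w) (mi _ _ _ mEr)).
rewrite !integral_indic// !setIT /k EFinD; apply: leeD.
  by apply: IHl => // s; exact: enorm_masked.
by apply: IHr => // s; exact: enorm_masked.
Qed.

End good.
End routing.

(** * Balanced trees over a sorted list of chunks *)

Section chunk_tree.
Context {R : realType} {I : eqType}.
Variables (c0 : I) (wt : I -> R).
Hypothesis wt12 : forall c, 1 <= wt c <= 2.
Implicit Types (s : seq I) (A : pred I).

Fixpoint chunk_tree (d : nat) s : color_tree R I :=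
  if d is e.+1 then
    if (size s <= 1)%N then Leaf (head c0 s)
    else let m := (size s)./2 in
      Node ((\sum_(c <- take m s) wt c) / (\sum_(c <- s) wt c))
        (chunk_tree e (take m s)) (chunk_tree e (drop m s))
  else Leaf (head c0 s).

Let weight_bnd s : (size s)%:R <= \sum_(c <- s) wt c <= 2 * (size s)%:R.
Proof.
elim: s => [|c s /andP[IH1 IH2]]; first by rewrite big_nil mulr0 lexx.
rewrite big_cons /= -natr1; have /andP[? ?] := wt12 c; apply/andP; split; lra.
Qed.

Lemma chunk_tree_depth d s : (depth (chunk_tree d s) <= d)%N.
Proof.
elim: d s => //= d IHd s; case: ifP => //= _.
by rewrite ltnS geq_max !IHd.
Qed.

Let half_sizes s : (1 < size s)%N ->
  let m := (size s)./2 in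
  [/\ size (take m s) = m, size (drop m s) = (size s - m)%N, (0 < m)%N &
     (m <= size s - m <= m.+1)%N].
Proof.
move=> s1 m; have e := odd_double_half (size s).
have mle : (m <= size s)%N by rewrite -e -addnn /m; lia.
split; [by rewrite size_takel|by rewrite size_drop|by rewrite /m half_gt0|].
by rewrite -{1 2}e -/m -addnn; case: (odd _); lia.
Qed.

Let sub_sizes d s : (1 < size s)%N -> (size s <= 2 ^ d.+1)%N ->
  (0 < size (take (size s)./2 s) <= 2 ^ d)%N /\
  (0 < size (drop (size s)./2 s) <= 2 ^ d)%N.
Proof.
move=> s1 s2; have [-> -> m0 /andP[m1 m2]] := half_sizes s1.
have e := odd_double_half (size s); rewrite expnS in s2.
by split; apply/andP; split => //; lia.
Qed.

(** The halves have [m] and at most [m + 1] chunks of weight in [[1, 2]], so the left fraction is at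
    least [m / (3 m + 2) >= 1 / 5] and at most 2/3. *)
Lemma chunk_tree_balanced d s : (0 < size s <= 2 ^ d)%N -> balanced (chunk_tree d s).
Proof.
elim: d s => //= d IHd s /andP[s0 sd]; case: (leqP (size s) 1) => //= s1.
have [hl hr] := sub_sizes s1 sd.
split; [|exact: IHd|exact: IHd].
have [tl td m0 /andP[m1 m2]] := half_sizes s1.
set m := (size s)./2 in tl td m0 m1 m2 hl hr *.
rewrite -{2 4}(cat_take_drop m s) big_cat /=.
have /andP[] := weight_bnd (take m s); have /andP[] := weight_bnd (drop m s).
rewrite tl td; set a := \sum_(c <- take m s) wt c; set b := \sum_(c <- drop m s) wt c.
have h1 : m%:R <= (size s - m)%:R :> R by rewrite ler_nat.
have h2 : (size s - m)%:R <= m%:R + 1 :> R by rewrite natr1 ler_nat.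
have h3 : 1 <= m%:R :> R by rewrite ler1n.
move=> b1 b2 a1 a2; have ab : 0 < a + b by lra.
by rewrite ler_pdivlMr// ler_pdivrMr//; apply/andP; split; lra.
Qed.

Lemma chunk_tree_count d s : (0 < size s <= 2 ^ d)%N ->
  (node_count (chunk_tree d s) < size s)%N.
Proof.
elim: d s => [|d IHd] s /andP[s0 sd] //=; case: (leqP (size s) 1) => //= s1.
have [hl hr] := sub_sizes s1 sd.
have := IHd _ hl; have := IHd _ hr.
have : size s = (size (take (size s)./2 s) + size (drop (size s)./2 s))%N.
  by rewrite -size_cat cat_take_drop.
by lia.
Qed.

Lemma chunk_tree_share A d s : (0 < size s <= 2 ^ d)%N ->
  share A (chunk_tree d s) = (\sum_(c <- s | A c) wt c) / (\sum_(c <- s) wt c).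
Proof.
have leaf c : (A c)%:R = (\sum_(c <- [:: c] | A c) wt c) / (\sum_(c <- [:: c]) wt c) :> R.
  have w0 : wt c != 0 by have /andP[? _] := wt12 c; rewrite gt_eqF//; lra.
  by rewrite big_mkcond !big_seq1; case: (A c); rewrite ?mul0r// divff.
have pos s' : (0 < size s')%N -> \sum_(c <- s') wt c != 0.
  move=> h; have /andP[h1 _] := weight_bnd s'; rewrite gt_eqF//.
  by apply: lt_le_trans h1; rewrite ltr0n.
elim: d s => [|d IHd] s /=.
  by case: s => [|c []]//= _; exact: leaf.
move=> /andP[s0 sd]; case: (leqP (size s) 1) => [|s1].
  by case: s s0 {sd} => [|c []]//= _ _; exact: leaf.
have [hl hr] := sub_sizes s1 sd.
rewrite /= !IHd//; set m := (size s)./2 in hl hr *.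
have pl := pos _ (proj1 (andP hl)); have pr := pos _ (proj1 (andP hr)).
have ps := pos _ s0.
have -> : \sum_(c <- s | A c) wt c =
    \sum_(c <- take m s | A c) wt c + \sum_(c <- drop m s | A c) wt c.
  by rewrite -big_cat cat_take_drop.
have sE : \sum_(c <- s) wt c = \sum_(c <- take m s) wt c + \sum_(c <- drop m s) wt c.
  by rewrite -big_cat cat_take_drop.
rewrite sE in ps *; move: pl pr ps.
set a := \sum_(c <- take m s) wt c; set b := \sum_(c <- drop m s) wt c.
by move=> pl pr ps; field; rewrite pl pr ps.
Qed.

Lemma share_bnd A (tr : color_tree R I) : balanced tr -> 0 <= share A tr <= 1.
Proof.
elim: tr => [c _|p l IHl r IHr [p01 /IHl l01 /IHr r01]] /=.
  by rewrite ler0n lern1 leq_b1.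
move: p01 l01 r01; set a := share A l; set b := share A r.
by move=> /andP[? ?] /andP[? ?] /andP[? ?]; apply/andP; split; nra.
Qed.

Let chunk_tree_mono A d s b : (0 < size s <= 2 ^ d)%N ->
  all (fun c => A c == b) s ->
  variation A (chunk_tree d s) = 0 /\ share A (chunk_tree d s) = b%:R.
Proof.
elim: d s => [|d IHd] s /=.
  by case: s => [|c []]//= _; rewrite andbT => /eqP ->.
move=> /andP[s0 sd] As; case: (leqP (size s) 1) => [|s1].
  by case: s s0 {sd} As => [|c []]//= _; rewrite andbT => /eqP ->.
have [hl hr] := sub_sizes s1 sd.
move: As; rewrite -{1}(cat_take_drop (size s)./2 s) all_cat => /andP[Al Ar] /=.
have [-> ->] := IHd _ hl Al; have [-> ->] := IHd _ hr Ar.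
by rewrite subrr normr0 !addr0; split => //; ring.
Qed.

(** The pairwise condition makes [A] a prefix of [s]. At every node either the left half lies in [A]
    or the right half avoids it; that half has variation 0, so a single path contributes, by at most
    1 per level. *)
Lemma chunk_tree_variation A d s : (0 < size s <= 2 ^ d)%N ->
  pairwise (fun x y => A y ==> A x) s ->
  variation A (chunk_tree d s) <= d%:R.
Proof.
elim: d s => [|d IHd] s //= /andP[s0 sd] As.
case: (leqP (size s) 1) => [_|s1] /=; first by rewrite ler0n.
have [hl hr] := sub_sizes s1 sd.
move: As; rewrite -{1}(cat_take_drop (size s)./2 s) pairwise_cat => /and3P[lr pl pr].
have /andP[l0 l1] := share_bnd A (chunk_tree_balanced hl).
have /andP[r0 r1] := share_bnd A (chunk_tree_balanced hr).
have d1 : `|share A (chunk_tree d (take (size s)./2 s)) -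
            share A (chunk_tree d (drop (size s)./2 s))| <= 1.
  by rewrite ler_norml; apply/andP; split; lra.
rewrite -natr1.
have [al|/allPn[x xl Ax]] := boolP (all (fun c => A c == true) (take (size s)./2 s)).
  have [-> _] := chunk_tree_mono hl al.
  by have := IHd _ hr pr; lra.
have ar : all (fun c => A c == false) (drop (size s)./2 s).
  apply/allP => y yr; apply/eqP; apply: contraNF Ax => Ay; apply/eqP.
  by move/allrelP: lr => /(_ _ _ xl yr); rewrite Ay.
have [-> _] := chunk_tree_mono hr ar.
by have := IHd _ hl pl; lra.
Qed.

End chunk_tree.

(** * The norms of the theorem *)

Section borel_rows.
Context {R : realType} {n : nat}.
Notation V := 'rV[R]_n.

Let box (z : 'rV[rat]_n * nat) : set V :=
  [set x | forall i, `|x ord0 i - ratr (z.1 ord0 i)| < z.2.+1%:R^-1].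

Let measurable_box z : measurable (box z).
Proof.
rewrite (_ : box z = \bigcap_(i in [set: 'I_n])
    [set x | `|x ord0 i - ratr (z.1 ord0 i)| < z.2.+1%:R^-1]).
  apply: fin_bigcap_measurable => // i _.
  have m : measurable_fun setT (fun x : V => `|x ord0 i - ratr (z.1 ord0 i)| < z.2.+1%:R^-1).
    apply: measurable_fun_ltr; last exact: measurable_cst.
    apply: measurableT_comp; first exact: normr_measurable.
    by apply: measurable_funB; [exact: measurable_row_coord|exact: measurable_cst].
  by have h := m measurableT [set true] Logic.I; rewrite setTI in h; exact: h.
by apply/seteqP; split => x h i; [move=> _; exact: h|exact: (h i Logic.I)].
Qed.

Let approx (a d : R) : 0 < d -> exists q : rat, `|a - ratr q| < d.
Proof.
move=> d0; have [|q] := @rat_in_itvoo R (a - d) (a + d); first by lra.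
rewrite in_itv/= => /andP[q1 q2]; exists q.
by rewrite ltr_norml; apply/andP; split; lra.
Qed.

(** Boxes with rational centres and radii [1 / k.+1] form a countable base and are measurable
    coordinatewise. This links the topology, in which bodies are given, to the product
    sigma-algebra. *)
Lemma open_measurable_row (U : set V) : open U -> measurable U.
Proof.
move=> oU.
have -> : U = \bigcup_z (if `[< box z `<=` U >] then box z else set0).
  apply/seteqP; split => x; last first.
    by move=> [z _]; case: asboolP => // h; exact: h.
  move=> Ux; have /nbhs_ballP[e /= e0 xU] := open_nbhs_nbhs (conj oU Ux).
  pose k := Num.truncn (2 / e).
  have ke : k.+1%:R^-1 < e / 2.
    have h := truncnS_gt (2 / e); rewrite -/k in h.
    rewrite -[ltRHS]invrK ltf_pV2 ?posrE ?invr_gt0 ?divr_gt0// invf_div//.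
  have k0 : 0 < k.+1%:R^-1 :> R by rewrite invr_gt0.
  have /choice[q hq] : forall i : 'I_n, exists q : rat, `|x ord0 i - ratr q| < k.+1%:R^-1.
    move=> i; exact: approx.
  exists (\row_i q i, k) => //; rewrite asboolT.
    by move=> i; rewrite mxE; exact: hq.
  move=> y hy; apply: xU; split => // i j; rewrite ord1.
  rewrite -ball_normE /=; have := hy j; rewrite mxE => /lt_trans /(_ ke) h1.
  have h2 := lt_trans (hq j) ke.
  have -> : x ord0 j - y ord0 j = (x ord0 j - ratr (q j)) - (y ord0 j - ratr (q j)) by ring.
  by apply: le_lt_trans (ler_normB _ _) _; lra.
apply: countable_bigcupT_measurable; first exact: countableP.
by move=> z; case: ifP.
Qed.

End borel_rows.

(** * The gauge of a symmetric convex body *)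

Section body_norm.
Context {R : realType} {n : nat}.
Notation V := 'rV[R]_n.
Variable K : set V.
Hypothesis hK : symmetric_convex_body K.
Notation N := (body_norm K).

Let convexK (x y : V) t : K x -> K y -> 0 <= t <= 1 -> K (t *: x + (1 - t) *: y).
Proof.
move=> Kx Ky t01; have [cK _ _ _] := hK.
have [t0 t1] := andP t01.
pose l : {i01 R} := Itv01 t0 t1.
by have := cK x y l (mem_set Kx) (mem_set Ky) => /set_mem.
Qed.

(** For an interior point [a], [x] is the midpoint of [a + x] and [- (a - x)]. *)
Let inner_ball : exists2 e : R, 0 < e & forall x : V, (forall i, `|x ord0 i| < e) -> K x.
Proof.
have [_ _ [a /nbhs_ballP[e /= e0 aK]] sK] := hK.
exists e => // x xe.
have Ka1 : K (a + x).
  apply: aK; split => // i j; rewrite ord1 -ball_normE /= !mxE opprD addNKr normrN; exact: xe.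
have Ka2 : K (a - x).
  by apply: aK; split => // i j; rewrite ord1 -ball_normE /= !mxE opprB addrC subrK; exact: xe.
have := convexK (t := 1 / 2) Ka1 (sK _ Ka2).
rewrite [X in K X](_ : _ = x); first by apply; lra.
by apply/rowP => i; rewrite !mxE; lra.
Qed.

Let scales (x : V) := [set s : R | 0 < s /\ exists2 y, K y & x = s *: y].

Let scales_lb (x : V) : has_lbound (scales x).
Proof. by exists 0 => s [/ltW]. Qed.

Let scales_mem (x : V) (s e : R) : 0 < s -> (forall y : V, (forall i, `|y ord0 i| < e) -> K y) ->
  (forall i, `|x ord0 i| < s * e) -> scales x s.
Proof.
move=> s0 he hx; split => //; exists (s^-1 *: x); last first.
  by rewrite scalerA divff ?scale1r// gt_eqF.
by apply: he => i; rewrite mxE normrM gtr0_norm ?invr_gt0// ltr_pdivrMl.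
Qed.

Let N_le (x : V) s : scales x s -> N x <= s.
Proof. exact: ge_inf. Qed.

Let scales_nonempty (x : V) : scales x !=set0.
Proof.
have [e e0 he] := inner_ball.
pose m := \sum_i `|x ord0 i|.
have mi i : `|x ord0 i| <= m.
  by rewrite /m (bigD1 i)//= lerDl sumr_ge0.
have m0 : 0 <= m by apply: sumr_ge0.
exists ((m + 1) / e); apply: (scales_mem _ he); first by rewrite divr_gt0//; lra.
by move=> i; rewrite mulfVK ?gt_eqF//; have := mi i; lra.
Qed.

Let N_ge0 (x : V) : 0 <= N x.
Proof. by apply: (lb_le_inf (scales_nonempty _)) => s [/ltW]. Qed.

Let N0 : N 0 = 0.
Proof.
apply/eqP; rewrite eq_le N_ge0 andbT; apply/ler_addgt0Pr => e e0; rewrite add0r.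
have [r r0 hr] := inner_ball; apply: N_le; apply: (scales_mem e0 hr) => i.
by rewrite mxE normr0 mulr_gt0.
Qed.

Let ND (x y : V) : N (x + y) <= N x + N y.
Proof.
have key s t : scales x s -> scales y t -> N (x + y) <= s + t.
  move=> [s0 [a Ka ->]] [t0 [b Kb ->]]; apply: N_le; split; first by lra.
  have st : s + t != 0 by rewrite gt_eqF//; lra.
  exists ((s / (s + t)) *: a + (1 - s / (s + t)) *: b).
    apply: convexK => //; rewrite divr_ge0 ?ler_pdivrMr; [|lra..].
    by apply/andP; split; lra.
  rewrite scalerDr !scalerA; congr (_ *: _ + _ *: _); by field.
rewrite -lerBlDr; apply: (lb_le_inf (scales_nonempty _)) => s hs; rewrite lerBlDl -lerBlDr.
by apply: (lb_le_inf (scales_nonempty _)) => t ht; rewrite lerBlDl; exact: key.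
Qed.

Let NZpos a (x : V) : 0 < a -> N (a *: x) <= a * N x.
Proof.
move=> a0; rewrite -ler_pdivrMl//; apply: (lb_le_inf (scales_nonempty _)) => s [s0 [y Ky ->]].
rewrite ler_pdivrMl//; apply: N_le; split; first exact: mulr_gt0.
by exists y => //; rewrite scalerA.
Qed.

Let NN (x : V) : N (- x) <= N x.
Proof.
have [_ _ _ sK] := hK.
apply: (lb_le_inf (scales_nonempty _)) => s [s0 [y Ky ->]]; apply: N_le; split => //.
by exists (- y); [exact: sK|rewrite scalerN].
Qed.

Let NZ a (x : V) : N (a *: x) = `|a| * N x.
Proof.
have pos b (y : V) : 0 < b -> N (b *: y) = b * N y.
  move=> b0; apply/eqP; rewrite eq_le NZpos//=.
  have := @NZpos b^-1 (b *: y); rewrite invr_gt0 scalerA mulVf ?gt_eqF// scale1r.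
  by move=> /(_ b0); rewrite ler_pdivlMl.
have sym (y : V) : N (- y) = N y.
  by apply/eqP; rewrite eq_le NN /= -{1}(opprK y) NN.
have [a0|a0|<-] := ltrgtP 0 a.
- by rewrite pos// gtr0_norm.
- by rewrite ltr0_norm// -sym -scaleNr pos ?oppr_gt0.
- by rewrite scale0r N0 normr0 mul0r.
Qed.

Let open_lt t : open [set x : V | N x < t].
Proof.
rewrite openE => x /= xt; rewrite /interior; apply/nbhs_ballP.
have [e e0 he] := inner_ball.
exists ((t - N x) / 2 * e); first by rewrite /= mulr_gt0// divr_gt0// subr_gt0.
move=> y [_ xy] /=; apply: (@le_lt_trans _ _ (N x + N (y - x))).
  by have := ND x (y - x); rewrite subrKC.
have : N (y - x) <= (t - N x) / 2.
  apply: N_le; apply: (scales_mem _ he); first by rewrite divr_gt0// subr_gt0.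
  by move=> i; have := xy ord0 i; rewrite -ball_normE /= !mxE distrC.
by lra.
Qed.

Lemma body_norm_seminorm : measurable_seminorm N.
Proof.
split; [exact: ND|exact: NZ|].
apply: (measurability _ (RGenCInfty.measurableE R)) => _ [_ [a ->] <-].
rewrite setTI (_ : _ @^-1` _ = ~` [set x : V | N x < a]).
  by apply: measurableC; apply: open_measurable_row; exact: open_lt.
apply/seteqP; split => x /=; rewrite in_itv/= andbT leNgt; first exact/negP.
by move=> h; exact/negP.
Qed.

Lemma body_norm_gaussian : ((1 / 2)%:E <= gaussian R n K)%E ->
  ((1 / 2)%:E <= gaussian R n [set x : V | (N x <= 1)%R])%E.
Proof.
move=> h; apply: le_trans h _; apply: le_measure; rewrite ?inE.
- have [_ cK _ _] := hK; rewrite -(setCK K); apply: measurableC.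
  by apply: open_measurable_row; apply: closed_openC; apply: compact_closed.
- exact: (measurable_seminorm_le body_norm_seminorm).
by move=> x Kx /=; apply: N_le; split => //; exists x => //; rewrite scale1r.
Qed.

End body_norm.

(** * Linear forms and the test norm *)

Section linear_forms.
Context {R : realType} {n : nat}.
Notation V := 'rV[R]_n.
Implicit Types (z : V) (S : {fset V}).

Lemma linear_seminorm z (a : R) : 0 <= a ->
  measurable_seminorm (fun x => a * `|dot x z|).
Proof.
move=> a0; split.
- by move=> x y; rewrite dotDl -mulrDr ler_wpM2l// ler_normD.
- by move=> b x; rewrite dotZl normrM mulrCA.
apply: measurable_funM; first exact: measurable_cst.
apply: measurableT_comp; first exact: normr_measurable.
by apply: measurable_fun_dot => //; exact: measurable_cst.
Qed.

(* Chernoff bound: both exponential martingales [exp(<h, x> - |h|^2 / 2)],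
   [h = 2 z] and [h = - 2 z], have mean 1. *)
Lemma linear_gaussian z : enorm z <= 1 ->
  ((1 / 2)%:E <= gaussian R n [set x : V | (1 / 2 * `|dot x z| <= 1)%R])%E.
Proof.
move=> z1; have dz : dot z z <= 1.
  by rewrite -(sqr_sqrtr (dot_ge0 z)) exprn_ile1// ?sqrtr_ge0.
set A := [set x : V | _].
have mA : measurable A by exact: (measurable_seminorm_le (@linear_seminorm z (1 / 2) _)).
have mAC : measurable (~` A) by exact: measurableC.
have martingale h : (\int[gaussian R n]_x (expR (dot h x - dot h h / 2))%:E = 1)%E.
  have := gaussian_cameron_martin h (f := cst 1%E) (measurable_cst _) (fun _ => lee01).
  rewrite (integral_probability_cst (gaussian R n)) => ->.
  by apply: eq_integral => x _; rewrite mul1e.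
have me h : measurable_fun setT (fun x : V => (expR (dot h x - dot h h / 2))%:E).
  apply: measurable_expE; apply: measurable_funB; last exact: measurable_cst.
  by apply: measurable_fun_dot => //; exact: measurable_cst.
have e0 h (x : V) : (0 <= (expR (dot h x - dot h h / 2))%:E)%E by rewrite lee_fin expR_ge0.
(* Off [A], [|<z, x>| > 2], so one of the two exponents is at least [2 * 2 - 2 |z|^2 >= 2], and
   [expR 2 >= 4]. *)
have : (4%:E * gaussian R n (~` A) <= 2%:E)%E.
  rewrite -[X in gaussian R n X]setIT -integral_indic//.
  have mi : measurable_fun setT (fun x : V => (\1_(~` A) x : R)%:E).
    by apply/measurable_EFinP; exact: measurable_indic.
  have i0 (x : V) : (0 <= (\1_(~` A) x : R)%:E)%E by rewrite lee_fin.
  have four : 0 <= 4 :> R by lra.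
  rewrite -(ge0_integralZl_EFin (gaussian R n) measurableT (fun x _ => i0 x) mi four).
  rewrite (_ : 2%:E = 1 + 1)%E; last by rewrite -EFinD; congr EFin; lra.
  rewrite -{1}(martingale (2 *: z)) -(martingale (- (2 *: z))).
  rewrite -(ge0_integralD (gaussian R n) measurableT (fun x _ => e0 _ x) (me _)
    (fun x _ => e0 _ x) (me _)).
  apply: ge0_le_integral.
  - exact: measurableT.
  - by move=> x _; rewrite -EFinM lee_fin mulr_ge0.
  - exact: measurable_funeM.
  - by apply: emeasurable_funD; exact: me.
  move=> x _; rewrite -EFinM -EFinD lee_fin indicE.
  have [/set_mem xA|_] := boolP (x \in ~` A); last by rewrite mulr0 addr_ge0 ?expR_ge0.
  have e2 : 4 <= expR 2 :> R.
    rewrite (_ : 2 = 1 + 1 :> R); last by lra.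
    by rewrite expRD; have := @expR_ge1Dx R 1; nra.
  have {xA}xz : 2 < `|dot z x|.
    by rewrite dotC ltNge; apply/negP => h; apply: xA; rewrite /A /=; lra.
  rewrite mulr1; have [p|p] := leP 0 (dot z x).
    rewrite ger0_norm// in xz; apply: le_trans e2 _.
    rewrite -[leLHS]addr0; apply: lerD; last exact: expR_ge0.
    by rewrite ler_expR !dotE; lra.
  rewrite ltr0_norm// in xz; apply: le_trans e2 _.
  rewrite -[leLHS]add0r; apply: lerD; first exact: expR_ge0.
  by rewrite ler_expR !dotE; lra.
rewrite probability_setC//.
have -> : gaussian R n A = (fine (gaussian R n A))%:E by rewrite fineK// fin_num_measure.
by rewrite -EFinB -EFinM !lee_fin; lra.
Qed.

Lemma test_norm_le S x (B : R) : 0 <= B ->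
  (forall z, z \in S -> `|dot x z| <= B) -> test_norm S x <= B.
Proof.
move=> B0 h; rewrite /test_norm big_seq.
by elim/big_ind: _ => // a b a1 b1; rewrite ge_max a1.
Qed.

Lemma test_norm_ge S x z : z \in S -> `|dot x z| <= test_norm S x.
Proof.
move=> zS; have : z \in enum_fset S by [].
rewrite /test_norm; elim: (enum_fset S) => // y s IHs.
rewrite in_cons big_cons le_max => /predU1P[->|/IHs->]; first by rewrite lexx.
by rewrite orbT.
Qed.

Lemma test_norm_ge0 S x : 0 <= test_norm S x.
Proof.
rewrite /test_norm; elim/big_ind: _ => // a b a0 b0; by rewrite le_max a0.
Qed.

Lemma test_norm_seminorm S : measurable_seminorm (test_norm S).
Proof.
split.
- move=> x y; apply: test_norm_le; first by rewrite addr_ge0// test_norm_ge0.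
  move=> z zS; rewrite dotDl; apply: le_trans (ler_normD _ _) _.
  by apply: lerD; exact: test_norm_ge.
- move=> a x; rewrite /test_norm; elim: (enum_fset S) => [|z s IHs].
    by rewrite !big_nil mulr0.
  by rewrite !big_cons IHs dotZl normrM maxr_pMr.
rewrite /test_norm; elim: (enum_fset S) => [|z s IHs].
  by under eq_fun do rewrite big_nil; exact: measurable_cst.
have mz : measurable_fun setT (fun x : V => `|dot x z|).
  apply: measurableT_comp; first exact: normr_measurable.
  by apply: measurable_fun_dot => //; exact: measurable_cst.
have := measurable_maxr mz IHs; congr measurable_fun.
by apply/funext => x; rewrite big_cons.
Qed.

End linear_forms.

(** * The online algorithm *)

Section product_lower_bound.
Context d1 d2 (T1 : measurableType d1) (T2 : measurableType d2) (R : realType).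
Local Open Scope ereal_scope.

(** The integral is a supremum over simple functions below [f], so one scaled indicator gives the
    bound without measurability of [f]. Applied to the measures of sections, it bounds the product
    measure of an event from below. *)
Lemma integral_ge_scale_indic (m : {measure set T1 -> \bar R}) (f : T1 -> \bar R)
    (A : set T1) (a : R) : measurable A -> (0 <= a)%R ->
  (forall x, 0 <= f x) -> (forall x, A x -> a%:E <= f x) ->
  a%:E * m A <= \int[m]_x f x.
Proof.
move=> mA a0 f0 fa; rewrite ge0_integralTE//; apply: ereal_sup_ubound => /=.
exists (scale_nnsfun (indic_nnsfun R mA) a0); last first.
  by rewrite sintegralrM//= sintegral_indic.
move=> x; change ((a * \1_A x)%:E <= f x); rewrite indicE.
case: (boolP (x \in A)) => [/set_mem/fa|_].
  by rewrite mulr1.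
by rewrite mulr0.
Qed.

Lemma product_probability_ge (P : probability T1 R) (Q : probability T2 R)
    (E : set (T1 * T2)) (A : set T1) (a : R) :
  measurable A -> P A = 1 ->
  (forall x, A x -> a%:E <= Q (xsection E x)) -> a%:E <= (P \x Q) E.
Proof.
move=> mA PA Qa; have [a0|/ltW a0] := leP 0%R a; last first.
  by apply: (@le_trans _ _ 0); rewrite ?lee_fin// measure_ge0.
rewrite -[a%:E]mule1 -PA; apply: integral_ge_scale_indic => // x /=.
Qed.

End product_lower_bound.

Section tree_algorithm.
Context {R : realType} {n q : nat}.
Notation V := 'rV[R]_n.
Variables (sigma : R) (tr : color_tree R 'I_q) (T D : nat).
Notation seeds := 'rV['rV[measurableTypeR R]_T]_D.

(** Earlier choices are recomputed from the seed and the vectors rather than read from [cs]. The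
    current vector has index [(size vs).-1]. *)
Let tree_choose (vs : seq V) (cs : seq 'I_q) (u : seeds) : 'I_q :=
  route sigma tr (nth 0 vs) (seed_of u) (size vs).-1.

Let measurable_tree_choose t (cs : seq 'I_q) (c : 'I_q) :
  measurable [set x : t.-tuple V * seeds | tree_choose x.1 cs x.2 = c].
Proof.
rewrite (_ : [set x | _] = [set x : t.-tuple V * seeds |
    pred1 c (route sigma tr (nth 0 x.1) (seed_of x.2) t.-1)]); last first.
  by apply/seteqP; split => x /=; rewrite /tree_choose size_tuple => /eqP.
apply: (@measurable_route _ _ _ sigma _ _ tr
  (fun x : t.-tuple V * seeds => nth 0 x.1) (fun x => seed_of x.2) t.-1
  [set i | pred1 c i]) => [s|k s].
  have [st|ts] := ltnP s t.
    rewrite (_ : (fun x => _) = (fun v : t.-tuple V => tnth v (Ordinal st)) \o fst).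
      by apply: measurableT_comp; [exact: measurable_tnth|exact: measurable_fst].
    by apply/funext => x /=; rewrite (tnth_nth 0).
  rewrite (_ : (fun x => _) = cst 0); first exact: measurable_cst.
  by apply/funext => x /=; rewrite nth_default// size_tuple.
by apply: (measurableT_comp (measurable_seed_of k s)); exact: measurable_snd.
Qed.

Definition tree_algorithm : online_algorithm R n q :=
  OnlineAlgorithm (iid_row (iid_row (@unif R) T) D) measurable_tree_choose.

Lemma tree_colors (vs : seq V) (u : seeds) t : (t <= size vs)%N ->
  colors (A := tree_algorithm) vs u t =
  mkseq (route sigma tr (nth 0 vs) (seed_of u)) t.
Proof.
elim: t => //= t IHt tv; rewrite IHt ?(ltnW tv)// mkseqS /tree_choose.
rewrite size_takel//=; congr rcons; apply: eq_route => s st.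
by rewrite nth_take.
Qed.

Lemma tree_color_sum (vs : seq V) (u : seeds) t c : (t <= size vs)%N ->
  color_sum (A := tree_algorithm) vs u t c =
  routed_sum sigma (pred1 c) tr (nth 0 vs) (seed_of u) t.
Proof.
move=> tv; rewrite /color_sum tree_colors// /routed_sum.
rewrite (_ : take t vs = mkseq (nth 0 vs) t); last first.
  apply: (@eq_from_nth _ 0); first by rewrite size_takel// size_mkseq.
  by move=> i; rewrite size_takel// => it; rewrite nth_take// nth_mkseq.
rewrite /mkseq zip_map big_map big_mkcond [RHS]big_mkcond /=.
have -> : iota 0 t = index_iota 0 t by rewrite /index_iota subn0.
by rewrite big_mkord.
Qed.

End tree_algorithm.

(** * From fixed inputs to random inputs *)

Section maintains.
Context {R : realType} {n q : nat}.
Notation V := 'rV[R]_n.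
Implicit Types (A : online_algorithm R n q) (w : 'I_q -> R) (N : V -> R).

(** There are countably many colour lists; splitting by the previous list reduces each step to
    [measurable_choose], where that list is fixed. *)
Lemma measurable_colors A (vs : seq V) t (Q : set (seq 'I_q)) :
  measurable [set u : seed A | Q (colors vs u t)].
Proof.
elim: t Q => [|t IHt] Q /=.
  have [Q0|Q0] := pselect (Q [::]).
    by rewrite (_ : [set _ | _] = setT)//; apply/seteqP; split.
  by rewrite (_ : [set _ | _] = set0)//; apply/seteqP; split.
pose F (x : seq 'I_q * 'I_q) := if `[< Q (rcons x.1 x.2) >] then
  [set u : seed A | colors vs u t = x.1] `&`
  [set u | Defs.choose (take t.+1 vs) x.1 u = x.2] else set0.
rewrite (_ : [set _ | _] = \bigcup_x F x).
  apply: countable_bigcupT_measurable; first exact: countableP.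
  move=> [cs c]; rewrite /F; case: asboolP => //= _; apply: measurableI.
    exact: (IHt [set cs]).
  have m := measurable_choose (o := A) (t := size (take t.+1 vs)) cs c.
  have pm := @pair1_measurable _ _ _ (seed A) (in_tuple (take t.+1 vs)).
  by have := pm measurableT _ m; rewrite setTI.
apply/seteqP; split => u /=.
  move=> Qu; exists (colors vs u t, Defs.choose (take t.+1 vs) (colors vs u t) u) => //.
  by rewrite /F asboolT.
by move=> [[cs c] _]; rewrite /F; case: asboolP => //= h [-> ->].
Qed.

(** After division by the weights the reference [W^-1 *: x] is common to all colours and cancels.
    The two deviations add up to [(1 / w c + 1 / w c') * E], which the normalization of [disc] turns
    into [E]. *)
Lemma disc_le A (vs : seq V) (u : seed A) w N t (x : V) (W E : R) :
  measurable_seminorm N -> (forall c, 0 < w c) -> 0 <= E ->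
  (forall c, N (color_sum vs u t c - (w c / W) *: x) <= E) ->
  disc vs u w N t <= E.
Proof.
move=> hN w0 E0 hE; rewrite /disc; elim/big_ind: _ => //.
  by move=> a b a1 b1; rewrite ge_max a1.
move=> [c c'] /= _; have wc := w0 c; have wc' := w0 c'.
set a := color_sum _ _ _ c; set b := color_sum _ _ _ c'.
have -> : (w c)^-1 *: a - (w c')^-1 *: b =
    (w c)^-1 *: (a - (w c / W) *: x) - (w c')^-1 *: (b - (w c' / W) *: x).
  rewrite !scalerBr !scalerA !mulrA !mulVf ?gt_eqF//.
  by rewrite opprB addrA subrK.
rewrite (seminormZ hN) gtr0_norm ?invr_gt0 ?addr_gt0 ?invr_gt0//.
rewrite ler_pdivrMl ?addr_gt0 ?invr_gt0// mulrDl.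
apply: le_trans (seminormB hN _ _) _; rewrite !(seminormZ hN).
by apply: lerD; rewrite gtr0_norm ?invr_gt0//; apply: ler_wpM2l (hE _); rewrite invr_ge0 ltW.
Qed.

Definition keeps A T w N (bound : R) (vs : seq V) : set (seed A) :=
  [set u | forall t, (0 < t <= T)%N -> disc vs u w N t <= bound].

Lemma measurable_keeps A T w N bound vs : measurable (@keeps A T w N bound vs).
Proof.
rewrite (_ : keeps _ _ _ _ _ = \bigcap_t
    (if (0 < t <= T)%N then [set u : seed A | disc vs u w N t <= bound] else setT)).
  apply: bigcapT_measurable => t; case: ifP => // _.
  pose S (cs : seq 'I_q) (c : 'I_q) : V := \sum_(x <- zip (take t vs) cs | x.2 == c) x.1.
  exact: (measurable_colors A vs t [set cs | \big[Num.max/0]_(x : 'I_q * 'I_q | x.1 != x.2)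
    N (((w x.1)^-1 + (w x.2)^-1)^-1 *:
       ((w x.1)^-1 *: S cs x.1 - (w x.2)^-1 *: S cs x.2)) <= bound]).
apply/seteqP; split => u h t; first by case: ifP => // tT _; exact: h.
by move=> tT; have := h t Logic.I; rewrite tT.
Qed.

(** The seed is independent of the input, so a bound for every fixed input in the unit ball
    suffices; almost surely all inputs lie there. *)
Lemma maintains_of_bounded_inputs A T p w N bound failure :
  supported_in_unit_ball p ->
  (forall vs : T.-tuple V, (forall i, enorm (tnth vs i) <= 1) ->
     ((1 - failure)%:E <= seed_law A (keeps T w N bound vs))%E) ->
  maintains T p w N A bound failure.
Proof.
move=> p1 hA d Omega P X [indX lawX].
pose U := [set v : V | enorm v <= 1].
have mU : measurable U.
  have m : measurable_fun setT (fun v : V => enorm v <= 1).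
    apply: measurable_fun_ler; last exact: measurable_cst.
    apply: (measurableT_comp (continuous_measurable_fun (@sqrt_continuous R))).
    exact: measurable_fun_dot.
  by have h := m measurableT [set true] Logic.I; rewrite setTI in h; exact: h.
pose G := \bigcap_(i in [set` [set: 'I_T]%SET]) (X i @^-1` U).
have mG : measurable G.
  apply: fin_bigcap_measurable => // i _.
  by rewrite -[X in measurable X]setTI; exact: measurable_funP.
have PG : P G = 1%E.
  rewrite /G (indX [set: 'I_T]%SET (fun=> U))// big1// => i _.
  have := lawX i U mU; rewrite p1; exact.
apply: (product_probability_ge mG PG) => om Gom.
have -> : xsection [set x | forall t, (0 < t <= T)%N ->
      disc [tuple X i x.1 | i < T] x.2 w N t <= bound] om =
    keeps (A := A) T w N bound [tuple X i om | i < T].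
  by apply/seteqP; split => u; rewrite /xsection /= inE.
by apply: hA => i; rewrite tnth_mktuple; apply: Gom; rewrite /= inE.
Qed.

End maintains.

(** * Failure probabilities *)

Lemma union_bound d (X : measurableType d) (R : realType)
    (m : {measure set X -> \bar R}) (E : set X) (F : (set X)^nat) k (b : R) :
  measurable E -> (forall i, measurable (F i)) ->
  (forall i, (i < k)%N -> (m (F i) <= b%:E)%E) ->
  (forall x, E x -> exists2 i, (i < k)%N & F i x) ->
  (m E <= (k%:R * b)%:E)%E.
Proof.
move=> mE mF Fb EF.
apply: (@le_trans _ _ (m (\big[setU/set0]_(i < k) F i))).
  apply: le_measure; rewrite ?inE//; first exact: bigsetU_measurable.
  by move=> x /EF[i ik Fx]; rewrite -bigcup_mkord; exists i.
apply: le_trans (Boole_inequality _ _) _; first by move=> i _; exact: mF.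
apply: (@le_trans _ _ (\sum_(i < k) b%:E)%E).
  by apply: lee_sum => i _; exact: Fb.
by rewrite sumEFin sumr_const card_ord mulr_natl.
Qed.

Section failure.
Context {R : realType} {n : nat}.
Notation V := 'rV[R]_n.
Variables (sigma : R) (T : nat).
Hypothesis sigma4 : 4 <= sigma.
Notation seeds := 'rV[measurableTypeR R]_T.

(* The pull is at most 1/5 as long as the inner product of the position and the
   step is at most [sigma ^+ 2 / 160]. *)
Definition tail_rate : R := (1 / 320) ^+ 2 / 3000.
Definition tail : R := 6 * expR (- (tail_rate * sigma ^+ 2)).

(** A radius of order [sigma ^+ 2] for a walk of scale [sigma] turns the exponent of [walk_tail]
    into [a ^+ 2 / 3000 * sigma ^+ 2]. *)
Lemma walk_tail_le (p a : R) (N : V -> R) (vs : nat -> V) t :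
  1 / 5 <= p <= 4 / 5 -> 1 / 320 <= a -> measurable_seminorm N ->
  ((1 / 2)%:E <= gaussian R n [set x | (N x <= 1)%R])%E ->
  (forall s, enorm (vs s) <= 1) -> (t <= T)%N ->
  (iid_row unif T [set u : seeds |
     (a * sigma ^+ 2 < N (walk sigma p 0 vs (entry u) t))%R] <= tail%:E)%E.
Proof.
move=> p01 a0 hN N1 vs1 tT; have s0 : 0 < sigma by apply: lt_le_trans sigma4; rewrite ltr0n.
have aS : 0 <= a * sigma ^+ 2 by rewrite mulr_ge0 ?sqr_ge0//; lra.
apply: le_trans (walk_tail sigma4 p01 hN N1 tT vs1 aS) _; rewrite lee_fin /tail.
have : 0 < 3000 :> R by rewrite ltr0n.
rewrite /tail_rate; set M : R := 3000; move: M => M M0.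
apply: ler_wpM2l; first by lra.
rewrite ler_expR lerN2 (_ : (a * sigma ^+ 2) ^+ 2 / (M * sigma ^+ 2) = a ^+ 2 / M * sigma ^+ 2).
  apply: ler_wpM2r; first exact: sqr_ge0.
  apply: ler_wpM2r; first by rewrite invr_ge0 ltW.
  by rewrite lerXn2r// nnegrE; lra.
by field; rewrite !gt_eqF.
Qed.

Lemma tail_ge0 : 0 <= tail.
Proof. by rewrite /tail mulr_ge0 ?expR_ge0. Qed.

Lemma pull_le (y v : V) : 1 / 2 * `|dot y v| <= 1 / 320 * sigma ^+ 2 ->
  `|pull sigma y v| <= 1 / 5.
Proof.
move=> h; have s0 : 0 < sigma by apply: lt_le_trans sigma4; rewrite ltr0n.
have s2 : 0 < sigma ^+ 2 by exact: exprn_gt0.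
rewrite /pull normrM.
have c0 : 0 <= (4 / sigma) ^+ 2 by exact: sqr_ge0.
have d0 : 0 <= (4 / sigma) ^+ 2 * dot v v by exact: mulr_ge0 (dot_ge0 v).
have r : `|pull_rate sigma v| <= 2 * (4 / sigma) ^+ 2.
  rewrite /pull_rate; set D := 1 + _ * dot v v; have D1 : 1 <= D by rewrite lerDl.
  have D0 : 0 < D by lra.
  rewrite ger0_norm; last by apply: divr_ge0; [exact: mulr_ge0|exact: ltW].
  by rewrite ler_pdivrMr// ler_peMr// mulr_ge0.
(* The origin of 320: [2 * 16 / 160 = 1 / 5], and the seminorm in the hypothesis carries a factor
   1/2. *)
apply: (@le_trans _ _ (2 * (4 / sigma) ^+ 2 * (1 / 160 * sigma ^+ 2))).
  by apply: ler_pM => //; lra.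
rewrite (_ : _ * _ = 1 / 5)//; by field; rewrite gt_eqF.
Qed.

(** A union bound over the times 0 to [T]: [b] pays for [N], and [tail] for the linear form [L t] of
    the incoming vector, which controls the pull. *)
Lemma good_walk_failure (p : R) (N : V -> R) (vs : nat -> V) (b : R) :
  1 / 5 <= p <= 4 / 5 -> measurable_seminorm N -> (forall s, enorm (vs s) <= 1) ->
  (forall t, (t <= T)%N -> (iid_row unif T [set u : seeds |
     (sigma ^+ 2 < N (walk sigma p 0 vs (entry u) t))%R] <= b%:E)%E) ->
  (iid_row unif T [set u : seeds | ~ good_walk sigma N (sigma ^+ 2) T p vs (entry u)]
    <= (T.+1%:R * (b + tail))%:E)%E.
Proof.
move=> p01 hN vs1 Nb.
pose w t (u : seeds) := walk sigma p 0 vs (entry u) t.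
pose L t (x : V) := 1 / 2 * `|dot x (vs t)|.
have hL t : measurable_seminorm (L t) by apply: linear_seminorm; lra.
have mw t : measurable_fun setT (w t) by exact: measurable_walk_seed.
have mlt (M : V -> R) (c : R) t : measurable_seminorm M ->
    measurable [set u | c < M (w t u)].
  move=> hM; have h := mw t measurableT _ (measurable_seminorm_gt hM c).
  by rewrite setTI in h; exact: h.
pose E t := [set u | sigma ^+ 2 < N (w t u)].
pose F t := [set u | 1 / 320 * sigma ^+ 2 < L t (w t u)].
apply: (@union_bound _ _ _ _ _ (fun t => E t `|` F t)).
- have mg : measurable [set u : seeds |
      good_walk sigma N (sigma ^+ 2) T p vs (entry u)].
    by apply: measurable_good_walk => // s; exact: measurable_entry.
  exact: measurableC.
- by move=> t; apply: measurableU; exact: mlt.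
- move=> t; rewrite ltnS => tT.
  apply: le_trans (measureU2 _ (mlt _ _ _ hN) (mlt _ _ _ (hL t))) _.
  rewrite EFinD; apply: leeD; first exact: Nb.
  by apply: walk_tail_le => //; exact: linear_gaussian.
move=> u bad; apply: contrapT => h; apply: bad => t tT.
have [Et|/negP Et] := pselect (E t u); first by exfalso; apply: h; exists t => //; left.
have [Ft|/negP Ft] := pselect (F t u); first by exfalso; apply: h; exists t => //; right.
by split; [rewrite leNgt|apply: pull_le; rewrite leNgt].
Qed.

(** The unit ball of the test norm may have small Gaussian measure, so the tail bound is applied to
    each halved test form separately. *)
Lemma test_norm_tail (p : R) (S : {fset V}) (vs : nat -> V) t :
  1 / 5 <= p <= 4 / 5 -> (forall z, z \in S -> enorm z <= 1) ->
  (forall s, enorm (vs s) <= 1) -> (t <= T)%N ->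
  (iid_row unif T [set u : seeds |
     (sigma ^+ 2 < test_norm S (walk sigma p 0 vs (entry u) t))%R]
   <= (#|` S|%:R * tail)%:E)%E.
Proof.
move=> p01 S1 vs1 tT; pose s := enum_fset S.
pose L i (x : V) := 1 / 2 * `|dot x (nth 0 s i)|.
have hL i : measurable_seminorm (L i) by apply: linear_seminorm; lra.
have mw := @measurable_walk_seed R n sigma p T t 0 vs.
have mlt (M : V -> R) (c : R) : measurable_seminorm M ->
    measurable [set u : seeds | c < M (walk sigma p 0 vs (entry u) t)].
  move=> hM; have h := mw measurableT _ (measurable_seminorm_gt hM c).
  by rewrite setTI in h; exact: h.
apply: (@union_bound _ _ _ _ _ (fun i => [set u : seeds |
  1 / 2 * sigma ^+ 2 < L i (walk sigma p 0 vs (entry u) t)])).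
- by apply: mlt; exact: test_norm_seminorm.
- by move=> i; exact: mlt.
- move=> i iS; apply: walk_tail_le => //; first by lra.
  by apply: linear_gaussian; apply: S1; exact: mem_nth.
move=> u /= Su; apply: contrapT => h; move: Su; apply/negP; rewrite -leNgt.
apply: test_norm_le => [|z zS]; first exact: sqr_ge0.
have zs : z \in s by [].
rewrite leNgt; apply/negP => zb; apply: h; exists (index z s); first by rewrite index_mem.
by rewrite /= /L nth_index//; lra.
Qed.

End failure.

(** * A tree with leaf shares proportional to the weights *)

Lemma share_add (R : realType) (I : eqType) (A A1 A2 : pred I) (tr : color_tree R I) :
  (forall c, (A c + A1 c = A2 c)%N) -> share A2 tr = share A tr + share A1 tr.
Proof.
move=> h; elim: tr => [c|p l /= -> r ->] /=; first by rewrite -natrD h.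
by ring.
Qed.

Lemma variation_sub (R : realType) (I : eqType) (A A1 A2 : pred I)
    (tr : color_tree R I) : (forall c, (A c + A1 c = A2 c)%N) ->
  variation A tr <= variation A1 tr + variation A2 tr.
Proof.
move=> h; elim: tr => [c|p l IHl r IHr] /=; first by rewrite addr0.
have := ler_normB (share A2 l - share A2 r) (share A1 l - share A1 r).
rewrite !(share_add _ h) (_ : _ - _ - _ = share A l - share A r); last by ring.
set a := `|_|; set b := `|_|; set c := `|_|; lra.
Qed.

Section proportional_tree.
Context {R : realType} {q : nat}.
Variables (eta : R) (w : 'I_q -> R).
Hypotheses (q0 : (0 < q)%N) (w1 : forall c, 1 <= w c <= eta).

Let k c := Num.truncn (w c).
Let chunks := sort (fun x y : 'I_q => (x <= y)%N)
  (flatten [seq nseq (k c) c | c <- enum 'I_q]).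

Let k_bnd c : 1 <= (k c)%:R :> R /\ (k c)%:R <= w c <= (k c)%:R + 1.
Proof.
have /andP[wc _] := w1 c; have w0 : 0 <= w c by lra.
have /andP[k1 k2] := truncn_itv w0; rewrite -/(k c) in k1 k2.
have : (0 < k c)%N by rewrite lt0n; apply/eqP => k0; rewrite k0 in k2; lra.
rewrite -(ler1n R) => k3; split => //; rewrite k1 natr1; exact: ltW.
Qed.

Let wt c := w c / (k c)%:R.

Let wt12 c : 1 <= wt c <= 2.
Proof.
have [k1 /andP[k2 k3]] := k_bnd c; have k0 : 0 < (k c)%:R :> R by lra.
by rewrite /wt ler_pdivlMr// ler_pdivrMr//; apply/andP; split; lra.
Qed.

Let sum_chunks (F : 'I_q -> R) : \sum_(c <- chunks) F c = \sum_c F c *+ k c.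
Proof.
rewrite (perm_big _ (permEl (perm_sort _ _))) big_flatten big_map /= big_enum /=.
apply: eq_bigr => c _; rewrite big_nseq.
by elim: (k c) => //= m ->; rewrite mulrS.
Qed.

Let wt_sum (A : pred 'I_q) : \sum_(c <- chunks | A c) wt c = \sum_(c | A c) w c.
Proof.
rewrite big_mkcond sum_chunks [RHS]big_mkcond; apply: eq_bigr => c _.
case: (A c); last by rewrite mul0rn.
have [k1 _] := k_bnd c; rewrite -mulr_natr /wt mulfVK// gt_eqF//; lra.
Qed.

Let size_chunks : (size chunks)%:R = \sum_c (k c)%:R :> R.
Proof. by rewrite -(sum_chunks (fun=> 1)) -sum1_size natr_sum. Qed.

Let size_chunks_le : (size chunks)%:R <= q%:R * eta.
Proof.
have -> : q%:R * eta = \sum_(c < q) eta by rewrite sumr_const card_ord mulr_natl.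
rewrite size_chunks; apply: ler_sum => c _.
have [_ /andP[h _]] := k_bnd c; apply: le_trans h _.
by have /andP[] := w1 c.
Qed.

Let size_chunks_gt0 : (0 < size chunks)%N.
Proof.
rewrite -(ltr_nat R) size_chunks (bigD1 (Ordinal q0))//= ltr_pwDl ?sumr_ge0//.
have [h _] := k_bnd (Ordinal q0); lra.
Qed.

Let initial_pairwise j : pairwise (fun x y : 'I_q => (y < j)%N ==> (x < j)%N) chunks.
Proof.
have tr : transitive (fun x y : 'I_q => (x <= y)%N) by move=> x y z; exact: leq_trans.
have : sorted (fun x y : 'I_q => (x <= y)%N) chunks.
  by apply: sort_sorted => x y; exact: leq_total.
rewrite (sorted_pairwise tr); apply: sub_pairwise => x y xy.
by apply/implyP; exact: leq_ltn_trans.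
Qed.

Lemma proportional_tree : exists (d : nat) (tr : color_tree R 'I_q),
  [/\ (depth tr <= d)%N, balanced tr, (node_count tr)%:R <= q%:R * eta,
      d%:R * ln 2 <= ln (q%:R * eta) + ln 2 &
      forall c, share (pred1 c) tr = w c / \sum_i w i /\
        variation (pred1 c) tr <= 2 * d%:R].
Proof.
pose e := trunc_log 2 (size chunks).
have sz : (0 < size chunks <= 2 ^ e.+1)%N.
  by rewrite size_chunks_gt0 ltnW// trunc_log_ltn.
exists e.+1, (chunk_tree (Ordinal q0) wt e.+1 chunks); split.
- exact: chunk_tree_depth.
- exact: (chunk_tree_balanced _ wt12).
- apply: le_trans size_chunks_le; rewrite ler_nat ltnW//.
  exact: chunk_tree_count.
- rewrite -natr1 mulrDl mul1r lerD2r.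
  have -> : e%:R * ln 2 = ln (2 ^+ e) :> R by rewrite lnXn// mulr_natl.
  have c0 : 0 < q%:R * eta by apply: lt_le_trans size_chunks_le; rewrite ltr0n.
  rewrite ler_ln ?posrE ?exprn_gt0//.
  apply: le_trans size_chunks_le; rewrite -natrX ler_nat.
  exact: trunc_logP.
move=> c; split; first by rewrite (chunk_tree_share _ wt12)// !wt_sum big_pred1_eq.
(* In the sorted list the colour [c] is the prefix of colours below [c.+1] minus the prefix of
   colours below [c], whence the factor 2. *)
apply: le_trans (variation_sub (A1 := fun x : 'I_q => (x < c)%N)
  (A2 := fun x : 'I_q => (x < c.+1)%N) _ _) _.
  by move=> x /=; rewrite ltnS -val_eqE /=; case: ltngtP.
rewrite mulrDl mul1r; apply: lerD; apply: (chunk_tree_variation _ wt12) => //;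
  exact: initial_pairwise.
Qed.

End proportional_tree.

(** * Choice of the parameters *)

Section tree_maintains.
Context {R : realType} {n q : nat}.
Notation V := 'rV[R]_n.

Lemma tree_keeps (sigma B delta v W bound : R) (tr : color_tree R 'I_q) (T D : nat)
    (w : 'I_q -> R) (N : V -> R) (vs : T.-tuple V) :
  measurable_seminorm N -> 0 <= delta ->
  (forall p us, 1 / 5 <= p <= 4 / 5 -> (forall s, enorm (us s) <= 1) ->
     (iid_row unif T [set u | ~ good_walk sigma N B T p us (entry u)] <= delta%:E)%E) ->
  (depth tr <= D)%N -> balanced tr -> (forall c, 0 < w c) ->
  (forall c, share (pred1 c) tr = w c / W /\ variation (pred1 c) tr <= v) ->
  0 <= B -> 0 <= bound -> v * B <= bound -> (forall i, enorm (tnth vs i) <= 1) ->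
  ((1 - (node_count tr)%:R * delta)%:E <=
   seed_law (tree_algorithm sigma tr T D) (keeps T w N bound vs))%E.
Proof.
move=> hN delta0 bad trD trb w0 hshare B0 bound0 vB vs1.
have nth1 s : enorm (nth 0 vs s) <= 1.
  have [sT|Ts] := ltnP s T; first by have := vs1 (Ordinal sT); rewrite (tnth_nth 0).
  by rewrite nth_default ?size_tuple// /enorm dot0l sqrtr0.
have failure := bad_seed_le hN delta0 bad trD trb nth1.
set L := seed_law _; pose G := [set u : 'rV['rV[measurableTypeR R]_T]_D |
  good sigma N B T tr (nth 0 vs) (seed_of u)].
have mG : measurable G.
  by apply: measurable_good => // k s; exact: measurable_seed_of.
have GE : ((1 - (node_count tr)%:R * delta)%:E <= L G)%E.
  have LC : (L (~` G) = 1 - L G)%E by exact: probability_setC.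
  have : (L (~` G) <= ((node_count tr)%:R * delta)%:E)%E by exact: failure.
  rewrite LC; have -> : L G = (fine (L G))%:E by rewrite fineK// fin_num_measure.
  by rewrite -EFinB !lee_fin; lra.
apply: le_trans GE _; apply: le_measure; rewrite ?inE//; first exact: measurable_keeps.
move=> u Gu t /andP[_ tT]; apply: (disc_le (W := W) (x := \sum_(s < t) nth 0 vs s)) => // c.
rewrite tree_color_sum ?size_tuple//.
have [sh vh] := hshare c; rewrite -sh; apply: le_trans vB.
apply: le_trans (good_discrepancy hN (pred1 c) Gu tT) _.
exact: ler_wpM2r.
Qed.

(** Disposes of the cases where a logarithm in the bound may vanish: one colour leaves no pair to
    compare, and [n * T = 1] permits failure 1. *)
Lemma trivial_maintains (T : nat) (w : 'I_q -> R) (N : V -> R)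
    (p : probability V R) (bound failure : R) :
  (0 < q)%N -> 0 <= bound -> 0 <= failure -> q = 1%N \/ 1 <= failure ->
  exists A : online_algorithm R n q, maintains T p w N A bound failure.
Proof.
move=> q0 bound0 f0 h; exists (tree_algorithm 4 (Leaf (Ordinal q0)) 0 0).
move=> d Omega P X _; case: h => [q1|f1]; last first.
  by apply: (@le_trans _ _ 0%E); [rewrite lee_fin subr_le0|exact: measure_ge0].
apply: (@product_probability_ge _ _ _ _ _ _ _ _ setT) => //; first exact: probability_setT.
move=> om _; rewrite (_ : xsection _ _ = setT); last first.
  apply/seteqP; split => // u _; rewrite /xsection /= inE => t _.
  rewrite /disc big_pred0// => -[c c']; apply/negbTE; rewrite negbK; apply/eqP.
  apply: val_inj => /=; move: (ltn_ord c) (ltn_ord c').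
  by move: (nat_of_ord c) (nat_of_ord c') => i j; rewrite q1 !ltnS !leqn0 => /eqP-> /eqP->.
by rewrite probability_setT lee_fin gerBl.
Qed.
End tree_maintains.

Section constants.
Context {R : realType}.

Lemma ln_ge_half (z : R) : 2 <= z -> 1 / 2 <= ln z.
Proof.
move=> z2; have z0 : 0 < z by lra.
have := expR_ge1Dx (- ln z); rewrite expRN lnK ?posrE// => h.
have : z^-1 <= 2^-1 by rewrite lef_pV2 ?posrE.
lra.
Qed.

(** With [x = ln (q * eta)] and [y = ln (n * T)], the summands 1, [k], [b] of the rate absorb the
    nodes and steps, the forms and the target. The factor [12 * a.+1], where 12 is [2 * 6], is below
    its own exponential and is absorbed because [x + y >= 1]. *)
Lemma failure_le (a k : nat) (b x y sigma nodes steps forms : R) :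
  0 < b -> 1 / 2 <= x -> 1 / 2 <= y ->
  tail_rate * sigma ^+ 2 = (1 + k%:R + b + 12 * a.+1%:R) * (x + y) ->
  0 <= nodes <= expR x -> 0 <= steps <= 2 * expR y ->
  0 <= forms <= a%:R * expR (k%:R * y) ->
  nodes * (steps * (forms * tail sigma + tail sigma)) <= expR (- b * y).
Proof.
move=> b0 x0 y0 hs /andP[n0 n1] /andP[s0 s1] /andP[f0 f1].
have E0 z : 0 <= expR z :> R by exact: expR_ge0.
have ek1 : 1 <= expR (k%:R * y) by rewrite -expR0 ler_expR mulr_ge0//; lra.
have f2 : forms + 1 <= a.+1%:R * expR (k%:R * y).
  by rewrite -natr1 mulrDl mul1r lerD.
have t0 := tail_ge0 sigma.
rewrite -[X in _ + X]mul1r -mulrDl.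
have h1 : steps * ((forms + 1) * tail sigma) <=
    2 * expR y * (a.+1%:R * expR (k%:R * y) * tail sigma).
  apply: ler_pM => //; first by rewrite mulr_ge0// addr_ge0.
  exact: ler_wpM2r.
apply: (@le_trans _ _ (expR x * (2 * expR y * (a.+1%:R * expR (k%:R * y) * tail sigma)))).
  apply: ler_pM => //; by rewrite !mulr_ge0// addr_ge0.
have a12 : 12 * a.+1%:R <= expR (12 * a.+1%:R) :> R.
  by apply: le_trans (expR_ge1Dx _); rewrite lerDr.
rewrite /tail hs; set m := 1 + _ + _ + _.
rewrite [leLHS](_ : _ = 12 * a.+1%:R *
    (expR x * expR y * expR (k%:R * y) * expR (- (m * (x + y))))); last by ring.
apply: le_trans (ler_wpM2r _ a12) _; first by rewrite !mulr_ge0.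
rewrite -!expRD ler_expR /m.
have k0 : 0 <= k%:R :> R by []; have A0 : 0 <= a.+1%:R :> R by [].
move: k0 A0; set K : R := k%:R; set A : R := a.+1%:R => k0 A0.
have xy : 1 <= x + y by lra.
have : 12 * A <= 12 * A * (x + y) by rewrite ler_peMr// mulr_ge0.
have : 0 <= K * x by rewrite mulr_ge0//; lra.
have : 0 <= b * x by rewrite mulr_ge0//; lra.
by move=> ? ? ?; lra.
Qed.

End constants.

(** Common core of both parts: a seminorm enters only through its tail bound, as [s] times [tail],
    with [s] polynomial in [n * T]. The exponent [r.+1] is adjusted at the end. *)
Lemma online_maintains (R : realType) (a k r : nat) (b : R) : 0 < b ->
  exists2 C : R, 0 < C &
  forall (n T q : nat), (0 < n)%N -> (0 < T)%N -> (0 < q)%N ->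
  forall (eta : R) (w : 'I_q -> R), (forall c, 1 <= w c <= eta) ->
  forall p : probability 'rV[R]_n R, supported_in_unit_ball p ->
  forall (N : 'rV[R]_n -> R) (s : nat), measurable_seminorm N ->
    (s <= a * (n * T) ^ k)%N ->
    (forall (sigma p' : R) (vs : nat -> 'rV[R]_n) t, 4 <= sigma ->
       1 / 5 <= p' <= 4 / 5 -> (forall i, enorm (vs i) <= 1) -> (t <= T)%N ->
       (iid_row unif T [set u : 'rV[measurableTypeR R]_T |
          (sigma ^+ 2 < N (walk sigma p' 0 vs (entry u) t))%R]
        <= (s%:R * tail sigma)%:E)%E) ->
  exists A : online_algorithm R n q,
    maintains T p w N A
      (C * ln (q%:R * eta) ^+ 2 * ln (n * T)%:R ^+ r.+1)
      ((n * T)%:R `^ (- b)).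
Proof.
move=> b0; pose m : R := 1 + k%:R + b + 12 * a.+1%:R.
have m1 : 1 <= m by rewrite /m; have := ler0n R k; have := ler0n R a.+1; lra.
have rate0 : 0 < tail_rate :> R.
  by rewrite /tail_rate divr_gt0 ?exprn_gt0 ?divr_gt0 ?ltr0n.
have rate1 : tail_rate * 16 <= 1 :> R.
  rewrite /tail_rate; have : 3000^-1 <= 1 :> R by rewrite invf_le1 ?ler1n ?ltr0n.
  have : 0 <= 3000^-1 :> R by rewrite invr_ge0 ler0n.
  by set M : R := _^-1; nra.
have [M [M0 M16 ME]] : exists M : R, [/\ 0 < M, 16 <= M & tail_rate * M = m].
  exists (m / tail_rate); split; first by rewrite divr_gt0//; lra.
    by rewrite ler_pdivlMr//; lra.
  by rewrite mulrC mulfVK// gt_eqF.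
exists (32 * M * 2 ^+ r); first by rewrite mulr_gt0 ?exprn_gt0// mulr_gt0.
move=> n T q n0 T0 q0 eta w w1 p p1 N s hN sS hs.
have eta1 : 1 <= eta by have /andP[h1 h2] := w1 (Ordinal q0); exact: le_trans h1 h2.
have nT0 : (0 < n * T)%N by rewrite muln_gt0 n0.
set x := ln (q%:R * eta); set y := ln (n * T)%:R.
have q1 : 1 <= q%:R :> R by rewrite ler1n.
have qe1 : 1 <= q%:R * eta by apply: le_trans q1 _; rewrite ler_peMr// ltW// (lt_le_trans ltr01).
have x0 : 0 <= x by exact: ln_ge0.
have y0 : 0 <= y by apply: ln_ge0; rewrite ler1n.
have bound0 : 0 <= 32 * M * 2 ^+ r * x ^+ 2 * y ^+ r.+1.
  by rewrite !mulr_ge0 ?exprn_ge0// ltW.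
have [q2|q2] := leqP q 1.
  apply: trivial_maintains => //.
  by left; apply/eqP; rewrite eqn_leq q2.
have [nT2|nT2] := leqP (n * T) 1.
  apply: trivial_maintains => //.
  by right; rewrite (_ : (n * T)%N = 1%N) ?powR1//; apply/eqP; rewrite eqn_leq nT2.
have xh : 1 / 2 <= x.
  apply: ln_ge_half; rewrite -[2]mulr1; apply: ler_pM => //; by rewrite ler_nat.
have yh : 1 / 2 <= y by apply: ln_ge_half; rewrite ler_nat.
pose sigma := Num.sqrt (M * (x + y)).
have sE : sigma ^+ 2 = M * (x + y) by rewrite sqr_sqrtr// mulr_ge0 ?addr_ge0// ltW.
have xy1 : 1 <= x + y by lra.
have sigma4 : 4 <= sigma.
  rewrite (_ : 4 = Num.sqrt (4 ^+ 2)); last by rewrite sqrtr_sqr ger0_norm.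
  apply: ler_wsqrtr; apply: (@le_trans _ _ M); first by lra.
  by rewrite ler_peMr// ltW.
have [d [tr [trD trb trn dln hsh]]] := proportional_tree q0 w1.
exists (tree_algorithm sigma tr T d).
apply: maintains_of_bounded_inputs => // vs vs1.
pose delta := T.+1%:R * (s%:R * tail sigma + tail sigma).
have qeE : expR x = q%:R * eta by rewrite lnK// posrE; lra.
have nTE : expR y = (n * T)%:R by rewrite lnK// posrE ltr0n.
have fl : (node_count tr)%:R * delta <= (n * T)%:R `^ (- b).
  rewrite /powR pnatr_eq0 gtn_eqF//; apply: (@failure_le R a k b x y sigma) => //.
  - by rewrite sE mulrA ME.
  - by rewrite ler0n qeE.
  - rewrite ler0n nTE -natrM ler_nat /=.
    by rewrite mul2n -addnn -addn1 leq_add// leq_pmull.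
  - by rewrite ler0n expRM_natl nTE -natrX -natrM ler_nat.
apply: le_trans (tree_keeps (sigma := sigma) (B := sigma ^+ 2) (delta := delta)
  (v := 2 * d%:R) (W := \sum_i w i) hN _ _ trD trb _ _ _ bound0 _ vs1).
- by rewrite lee_fin lerD2l lerN2.
- by rewrite /delta mulr_ge0 ?addr_ge0 ?mulr_ge0 ?tail_ge0.
- move=> p' us p01 us1; apply: good_walk_failure => // t tT; exact: hs.
- by move=> c; have /andP[? _] := w1 c; lra.
- exact: hsh.
- exact: sqr_ge0.
have l2 : 1 / 2 <= ln 2 :> R by exact: ln_ge_half.
have lx : ln 2 <= x.
  rewrite ler_ln ?posrE//; last by lra.
  rewrite -[2]mulr1; apply: ler_pM => //; by rewrite ler_nat.
have dx : d%:R <= 4 * x.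
  have d0 : 0 <= d%:R :> R by [].
  by rewrite -/x in dln; move: dln d0; set D := d%:R => dln d0; nra.
(* The construction gives order [x ^+ 2 * y]; as [2 * y >= 1], higher powers of [y] cost only the
   factor [2 ^+ r]. *)
have yr : y <= 2 ^+ r * y ^+ r.+1.
  rewrite exprS mulrCA -exprMn ler_peMr//; apply: exprn_ege1; lra.
rewrite sE; apply: (@le_trans _ _ (32 * M * x ^+ 2 * y)); last first.
  rewrite [leRHS](_ : _ = 32 * M * x ^+ 2 * (2 ^+ r * y ^+ r.+1)); last by ring.
  by apply: ler_wpM2l yr; rewrite !mulr_ge0 ?sqr_ge0// ltW.
(* Variation [2 d] with [d <= 4 x], times the radius [M * (x + y)], where [x + y <= 4 x y] since
   both are at least 1/2. *)
apply: (@le_trans _ _ (2 * (4 * x) * (M * (4 * x * y)))); last first.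
  by rewrite le_eqVlt; apply/orP; left; apply/eqP; ring.
apply: ler_pM.
- by rewrite mulr_ge0.
- by rewrite mulr_ge0 ?addr_ge0// ltW.
- by rewrite ler_wpM2l.
apply: ler_wpM2l; first exact: ltW.
by nra.
Qed.

Theorem theorem1p5 (R : realType) :
  (forall (a k : nat) (b : R), 0 < b ->
   exists2 C : R, 0 < C &
   forall (n T q : nat), (0 < n)%N -> (0 < T)%N -> (0 < q)%N ->
   forall (eta : R) (w : 'I_q -> R), (forall c, 1 <= w c <= eta) ->
   forall p : probability 'rV[R]_n R, supported_in_unit_ball p ->
   forall S : {fset 'rV[R]_n}, (#|` S| <= a * (n * T) ^ k)%N ->
     (forall z, z \in S -> enorm z <= 1) ->
   exists A : online_algorithm R n q,
     maintains T p w (test_norm S) A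
       (C * ln (q%:R * eta) ^+ 2 * ln (n * T)%:R ^+ 4)
       ((n * T)%:R `^ (- b)))
  /\
  (forall c b : R, 0 < c -> 0 < b ->
   exists2 C : R, 0 < C &
   forall (n T q : nat), (0 < n)%N -> (0 < T)%N -> (0 < q)%N ->
   forall (eta : R) (w : 'I_q -> R), (forall i, 1 <= w i <= eta) ->
   forall p : probability 'rV[R]_n R, supported_in_unit_ball p ->
     subexponential_tails c p ->
   forall K : set 'rV[R]_n, symmetric_convex_body K ->
     ((1 / 2)%:E <= gaussian R n K)%E ->
   exists A : online_algorithm R n q,
     maintains T p w (body_norm K) A
       (C * ln (q%:R * eta) ^+ 2 * ln (n * T)%:R ^+ 5)
       ((n * T)%:R `^ (- b))).
Proof.
split.
  move=> a k b b0; have [C C0 hC] := online_maintains a k 3 b0; exists C => //.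
  move=> n T q n0 T0 q0 eta w w1 p p1 S Sa S1.
  apply: (hC n T q n0 T0 q0 eta w w1 p p1 _ _ (test_norm_seminorm S) Sa).
  by move=> sigma p' vs t sigma4 p01 vs1 tT; exact: test_norm_tail.
(* The unit ball of the gauge has Gaussian measure at least 1/2, so a single tail bound suffices:
   [s = 1], hence [a = 1] and [k = 0]. *)
move=> c b _ b0; have [C C0 hC] := online_maintains 1 0 4 b0; exists C => //.
move=> n T q n0 T0 q0 eta w w1 p p1 _ K hK K2.
have hN := body_norm_seminorm hK.
apply: (hC n T q n0 T0 q0 eta w w1 p p1 _ 1%N hN) => //.
move=> sigma p' vs t sigma4 p01 vs1 tT; rewrite mul1r -[sigma ^+ 2]mul1r.
apply: walk_tail_le => //; last exact: body_norm_gaussian.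
by rewrite ler_pdivrMr ?ltr0n// mul1r ler1n.
Qed.
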